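(* Let $M=(M_k)$ be a log-convex weight sequence. Let $E,F,G$ be convenient vector spaces, let $U\subseteq E$ and $V\subseteq F$ be $c^\infty$-open, and let $f:U\to F$ and $g:V\to G$ be mappings with $f(U)\subseteq V$. If $f$ and $g$ are $C^{[M]}$, then $g\circ f:U\to G$ is $C^{[M]}$. (This is asserted both for $C^{[M]}=C^{(M)}$ and for $C^{[M]}=C^{\{M\}}$.)
   Context: $\mathbb N=\{0,1,2,\dots\}$. A weight sequence $M=(M_k)_{k\in\mathbb N}$ is a sequence of positive reals with $M_0=1\le M_1$. It is log-convex if $M_k^2\le M_{k-1}M_{k+1}$ for all $k\ge1$. $C^{[M]}$ stands, within one statement, either everywhere for $C^{(M)}$ (Beurling type) or everywhere for $C^{\{M\}}$ (Roumieu type). Banach spaces: for an open subset $U$ of a Banach space $E$, $C^{(M)}(U,\mathbb R)$ (resp. $C^{\{M\}}(U,\mathbb R)$) is the set of all $C^\infty$ (infinitely often Fréchet differentiable) functions $f:U\to\mathbb R$ such that for every compact convex $K\subseteq U$ and for every $\rho>0$ (resp. for every compact convex $K\subseteq U$ there is some $\rho>0$ such that) $$\sup\Big\{\frac{\|f^{(k)}(x)\|_{L^k(E,\mathbb R)}}{k!\,\rho^k M_k}:x\in K,\ k\in\mathbb N\Big\}<\infty .$$ Convenient vector spaces: a convenient vector space is a real Hausdorff locally convex space that is Mackey complete. The $c^\infty$-topology on it is the final topology with respect to all $C^\infty$-curves $\mathbb R\to E$. A mapping $f:U\to F$ on a $c^\infty$-open $U\subseteq E$ is $C^\infty$ if it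 maps $C^\infty$-curves in $U$ to $C^\infty$-curves in $F$. $F^*$ is the space of continuous linear functionals on $F$. For a closed absolutely convex bounded $B\subseteq E$, $E_B$ is the linear span of $B$ normed by the Minkowski functional of $B$ (a Banach space), $i_B:E_B\to E$ is the inclusion, and $U_B=U\cap E_B$. Define $$C^{[M]}(U,F)=\{f\in C^\infty(U,F):\ \ell\circ f\circ i_B\in C^{[M]}(U_B,\mathbb R)\ \text{for all }\ell\in F^*\text{ and all such }B\};$$ $f$ is called $C^{[M]}$ if $f\in C^{[M]}(U,F)$. *)

(* Defs.v *)
From HB Require Import structures.
From mathcomp Require Import all_boot all_order all_algebra.
From mathcomp Require Import all_classical all_reals.
From mathcomp Require Import topology tvs normedtype landau derive convex sequences.

Set Implicit Arguments.
Unset Strict Implicit.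
Unset Printing Implicit Defensive.

Import Order.TTheory GRing.Theory Num.Theory.
Import numFieldNormedType.Exports.
Local Open Scope classical_set_scope.
Local Open Scope ring_scope.

Definition weight_sequence (R : realType) (M : nat -> R) : Prop :=
  [/\ forall k, 0 < M k, M 0%N = 1 & 1 <= M 1%N].

Definition log_convex (R : realType) (M : nat -> R) : Prop :=
  forall k, M k.+1 ^+ 2 <= M k * M k.+2.

Section MultilinearForms.
Context {R : realType} (X : normedModType R) (k : nat).

Definition replace_arg (v : 'I_k -> X) (i : 'I_k) (x : X) : 'I_k -> X :=
  fun j => if j == i then x else v j.

Definition multilinear (f : ('I_k -> X) -> R) : Prop :=
  forall (v : 'I_k -> X) (i : 'I_k) (a : R) (x y : X),
    f (replace_arg v i (a *: x + y)) =
    a * f (replace_arg v i x) + f (replace_arg v i y).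

Definition bounded_form (f : ('I_k -> X) -> R) : Prop :=
  exists C, forall v, `|f v| <= C * \prod_(i < k) `|v i|.

Definition mform_pred : {pred ('I_k -> X) -> R^o} :=
  fun f => `[< multilinear f /\ bounded_form f >].

Record mform := Mform {
  mform_fun :> ('I_k -> X) -> R^o ; _ : mform_fun \in mform_pred }.

HB.instance Definition _ := [isSub for mform_fun].
HB.instance Definition _ := [Choice of mform by <:].

Lemma mform_submod : submod_closed mform_pred.
Proof.
split.
  apply/asboolP; split; first by move=> v i a x y; rewrite mulr0 addr0.
  by exists 0 => v; rewrite normr0 mul0r.
move=> a f g /asboolP[lf [C Cf]] /asboolP[lg [D Dg]]; apply/asboolP; split.
  have agE v : (a *: f + g) v = a * f v + g v by [].
  move=> v i b x y; rewrite !agE lf lg !mulrDr !mulrA (mulrC a b).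
  by rewrite addrACA.
exists (`|a| * C + D) => v.
rewrite [X in `|X|](_ : _ = a * f v + g v)// (le_trans (ler_normD _ _))// normrM mulrDl lerD// -mulrA.
by rewrite ler_wpM2l.
Qed.

HB.instance Definition _ := GRing.isSubmodClosed.Build R _ mform_pred
  mform_submod.
HB.instance Definition _ := [SubChoice_isSubLmodule of mform by <:].

Lemma mform_linear (f : mform) : multilinear f.
Proof. by have /asboolP[] := valP f. Qed.

Lemma mform_bounded (f : mform) : bounded_form f.
Proof. by have /asboolP[] := valP f. Qed.

Definition unit_args : set ('I_k -> X) := [set v | forall i, `|v i| <= 1].

Definition mform_norm (f : mform) : R := sup [set `|f v| | v in unit_args].

Lemma mform_scale (f : mform) (a : 'I_k -> R) (v : 'I_k -> X) :
  f (fun i => a i *: v i) = (\prod_i a i) * f v.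
Proof.
have scale1 w i b : f (replace_arg w i (b *: w i)) = b * f w.
  have := mform_linear f w i b (w i) 0; rewrite addr0 => ->.
  have := mform_linear f w i (-1) 0 0; rewrite scaler0 addr0 mulN1r addNr => ->.
  rewrite addr0; congr (_ * f _); apply/funext => j.
  by rewrite /replace_arg; case: eqP => // ->.
suff H s : uniq s -> f (fun i => if i \in s then a i *: v i else v i) =
    (\prod_(i <- s) a i) * f v.
  rewrite -[index_enum _]enumT -H ?enum_uniq//; congr (mform_fun f _).
  by apply/funext => i; rewrite mem_enum.
elim: s => [_|i s ih /= /andP[nis us]]; first by rewrite big_nil mul1r.
rewrite big_cons -mulrA -ih// -(scale1 _ i); congr (mform_fun f _).
apply/funext => j; rewrite /replace_arg inE (negbTE nis).
by case: eqP => // ->.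
Qed.

Lemma mform_has_sup (f : mform) : has_sup [set `|f v| | v in unit_args].
Proof.
have [C Cf] := mform_bounded f; split.
  by exists `|f (fun=> 0)|, (fun=> 0) => // i; rewrite normr0.
exists `|C| => _ [v v1 <-]; rewrite (le_trans (Cf v))//.
rewrite (le_trans (ler_norm _))// normrM -[leRHS]mulr1 ler_wpM2l// normr_prod.
apply: prodr_ile1 => i _; rewrite normr_id normr_ge0 v1//.
Qed.

Lemma mform_norm_ub (f : mform) v : unit_args v -> `|f v| <= mform_norm f.
Proof.
by move=> v1; apply: (sup_upper_bound (mform_has_sup f)); exists v.
Qed.

Lemma mform_norm_lub (f : mform) C :
  (forall v, unit_args v -> `|f v| <= C) -> mform_norm f <= C.
Proof.
move=> Cf; apply: ge_sup; first by have [] := mform_has_sup f.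
by move=> _ [v v1 <-]; exact: Cf.
Qed.

Lemma mform_norm_ge0 (f : mform) : 0 <= mform_norm f.
Proof.
apply: (le_trans _ (@mform_norm_ub f (fun=> 0) _)) => //.
by move=> i; rewrite normr0.
Qed.

Lemma mform_le (f : mform) v : `|f v| <= mform_norm f * \prod_i `|v i|.
Proof.
pose w i := `|v i|^-1 *: v i.
have -> : f v = (\prod_i `|v i|) * f w.
  rewrite -mform_scale; congr (mform_fun f _); apply/funext => i; rewrite /w.
  have [->|vi0] := eqVneq (v i) 0; first by rewrite !scaler0.
  by rewrite scalerA divff ?normr_eq0// scale1r.
rewrite normrM ger0_norm ?prodr_ge0// mulrC ler_wpM2r ?prodr_ge0//.
apply: mform_norm_ub => i; rewrite normrZ normfV normr_id.
have [->|vi0] := eqVneq (v i) 0; first by rewrite normr0 mulr0.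
by rewrite mulVf ?normr_eq0.
Qed.

Lemma mform_normD (f g : mform) :
  mform_norm (f + g) <= mform_norm f + mform_norm g.
Proof.
apply: mform_norm_lub => v v1; rewrite [X in `|X|](_ : _ = f v + g v)//.
by rewrite (le_trans (ler_normD _ _))// lerD// mform_norm_ub.
Qed.

Lemma mform_normZ (a : R) (f : mform) :
  mform_norm (a *: f) = `|a| * mform_norm f.
Proof.
have aE v : (a *: f) v = a * f v by [].
apply/eqP; rewrite eq_le; apply/andP; split.
  apply: mform_norm_lub => v v1.
  by rewrite aE normrM ler_wpM2l// mform_norm_ub.
have [->|a0] := eqVneq a 0; first by rewrite normr0 mul0r mform_norm_ge0.
rewrite -ler_pdivlMl ?normr_gt0//; apply: mform_norm_lub => v v1.
by rewrite ler_pdivlMl ?normr_gt0// -normrM -aE mform_norm_ub.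
Qed.

Lemma mform_norm0_eq0 (f : mform) : mform_norm f = 0 -> f = 0.
Proof.
move=> f0; apply/val_inj/funext => v; apply/eqP; rewrite -normr_le0.
by rewrite (le_trans (mform_le f v))// f0 mul0r.
Qed.

HB.instance Definition _ := Lmodule_isNormed.Build R mform
  mform_normD mform_normZ mform_norm0_eq0.

(* Junk value [0] when [g] is not bounded multilinear. *)
Definition to_mform (g : ('I_k -> X) -> R) : mform := insubd (0 : mform) g.

Lemma to_mformE (g : ('I_k -> X) -> R) :
  multilinear g -> bounded_form g -> to_mform g = g :> (_ -> _).
Proof.
by move=> lg bg; rewrite /to_mform -[LHS]/(val _) insubdK//; apply/asboolP.
Qed.

End MultilinearForms.

Arguments mform_norm : simpl never.

Section FrechetDerivatives.
Context {R : realType} (X : normedModType R).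

(* [fderiv f k x] is the k-th derivative of [f] at [x], as an element of
   L^k(X, R): (fderiv f k.+1 x)(v_0, ..., v_k) is the value at (v_1, ..., v_k)
   of the Frechet derivative at [x], in the direction v_0, of the map
   [fderiv f k] from [X] to the normed space L^k(X, R). *)
Fixpoint fderiv (f : X -> R) (k : nat) : X -> mform X k :=
  match k with
  | 0 => fun x => to_mform (fun=> f x)
  | k'.+1 => fun x => to_mform (fun v : 'I_k'.+1 -> X =>
      'd (fderiv f k') x (v ord0) (fun i => v (lift ord0 i)))
  end.

Definition smooth_on (U : set X) (f : X -> R) : Prop :=
  forall k x, U x -> differentiable (fderiv f k) x.

Lemma fderiv0E (f : X -> R) x v : fderiv f 0 x v = f x.
Proof.
rewrite /= to_mformE//; first by move=> ? [].
by exists `|f x| => w; rewrite big_ord0 mulr1.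
Qed.

Lemma fderivSE (f : X -> R) k x v : differentiable (fderiv f k) x ->
  fderiv f k.+1 x v = 'd (fderiv f k) x (v ord0) (fun i => v (lift ord0 i)).
Proof.
move=> df; rewrite /= to_mformE//.
  move=> w i a y z; case: (unliftP ord0 i) => [j|] -> /=.
    have r0 t : replace_arg w (lift ord0 j) t ord0 = w ord0 by [].
    have rS t : (fun l => replace_arg w (lift ord0 j) t (lift ord0 l)) =
        replace_arg (fun l => w (lift ord0 l)) j t.
      by apply/funext => l; rewrite /replace_arg (inj_eq lift_inj).
    by rewrite !r0 !rS mform_linear.
  have r0 t : replace_arg w ord0 t ord0 = t by [].
  have rS t : (fun l => replace_arg w ord0 t (lift ord0 l)) =
      fun l => w (lift ord0 l) by apply/funext.
  by rewrite !r0 !rS linearP.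
have /linear_bounded_continuous/linear_boundedP := diff_continuous df.
move=> /pinfty_ex_gt0[C C0 dC]; exists C => w.
rewrite big_ord_recl mulrA (le_trans (mform_le _ _))//.
by rewrite ler_wpM2r ?prodr_ge0//; exact: dC.
Qed.

End FrechetDerivatives.

Variant dc_type := Beurling | Roumieu.

Section BanachClasses.
Context {R : realType} (X : completeNormedModType R).

Definition dc_bounded (M : nat -> R) (rho : R) (K : set X) (f : X -> R) : Prop :=
  has_ubound [set `|fderiv f k x| / (k`!%:R * rho ^+ k * M k)
             | x in K & k in [set: nat]].

(* [f] is a total function; [smooth_on U] and the derivatives at points of [U]
   depend only on its restriction to [U] when [U] is open. *)
Definition dc_banach (t : dc_type) (M : nat -> R) (U : set X) (f : X -> R) :
    Prop :=
  smooth_on U f /\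
  forall K : set X, compact K -> convex_set K -> K `<=` U ->
    match t with
    | Beurling => forall rho, 0 < rho -> dc_bounded M rho K f
    | Roumieu => exists2 rho, 0 < rho & dc_bounded M rho K f
    end.

End BanachClasses.

Section LocallyConvex.
Context {R : realType} (E : tvsType R).

(* Von Neumann boundedness: [B] is absorbed by every neighborhood of 0. *)
Definition tvs_bounded (B : set E) : Prop :=
  forall U, nbhs 0 U -> \forall r \near +oo, B `<=` *:%R (r : R) @` U.

(* Requiring [B] to be nonempty amounts to requiring [0] in [B]. *)
Definition absolutely_convex (B : set E) : Prop :=
  B !=set0 /\ forall (a b : R) x y,
    `|a| + `|b| <= 1 -> B x -> B y -> B (a *: x + b *: y).

Definition mackey_cauchy (u : nat -> E) : Prop :=
  exists (B : set E) (mu : nat -> nat -> R),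
    [/\ absolutely_convex B, tvs_bounded B,
        mu p.1 p.2 @[p --> (\oo, \oo)] --> (0 : R) &
        forall n m, exists2 b, B b & u n - u m = mu n m *: b].

Definition mackey_complete : Prop :=
  forall u, mackey_cauchy u -> exists l : E, u @ \oo --> l.

End LocallyConvex.

HB.mixin Record Tvs_isConvenient (R : realType) E & Tvs R E := {
  convenient_hausdorff : hausdorff_space E;
  convenient_mackey_complete : mackey_complete E
}.

#[short(type="convenientType")]
HB.structure Definition Convenient (R : realType) :=
  {E of Tvs R E & Tvs_isConvenient R E}.

Section SmoothCurves.
Context {R : realType} (E : tvsType R).

Definition curve_derivative (c c' : R -> E) : Prop :=
  forall t : R, h^-1 *: (c (t + h) - c t) @[h --> (0 : R)^'] --> c' t.

(* The successive derivatives [D n] of [c] are unique when [E] is Hausdorff. *)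
Definition smooth_curve (c : R -> E) : Prop :=
  exists2 D : nat -> R -> E,
    D 0%N = c & forall n, curve_derivative (D n) (D n.+1).

Definition cinfty_open (U : set E) : Prop :=
  forall c, smooth_curve c -> open (c @^-1` U).

End SmoothCurves.

(* Maps on [U] are total functions whose values outside [U] are irrelevant. *)
Definition smooth_map (R : realType) (E F : tvsType R) (U : set E)
    (f : E -> F) : Prop :=
  forall c : R -> E, smooth_curve c -> (forall t, U (c t)) ->
    smooth_curve (f \o c).

Record disk (R : realType) (E : tvsType R) := Disk {
  disk_set :> set E;
  disk_closed : closed disk_set;
  disk_absolutely_convex : absolutely_convex disk_set;
  disk_bounded : tvs_bounded disk_set
}.

Section DiskSpace.
Context {R : realType} (E : convenientType R) (B : disk E).

Definition lin_span (A : set E) : set E :=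
  [set x | forall V : set E, A `<=` V -> V 0 ->
    (forall (a : R) y z, V y -> V z -> V (a *: y + z)) -> V x].

Definition dilations (x : E) : set R :=
  [set r | 0 < r /\ exists2 b, disk_set B b & x = r *: b].

Definition minkowski_functional (x : E) : R := inf (dilations x).

Lemma disk0 : disk_set B 0.
Proof.
have [[b Bb] ac] := disk_absolutely_convex B.
rewrite -[0]addr0 -[X in X + _](scale0r b) -[X in _ + X](scale0r b).
by apply: ac => //; rewrite normr0 addr0.
Qed.

Lemma diskZ a b : `|a| <= 1 -> disk_set B b -> disk_set B (a *: b).
Proof.
move=> a1 Bb; rewrite -[_ *: _]addr0 -(scaler0 _ 0).
by apply: (disk_absolutely_convex B).2 => //; [rewrite normr0 addr0|exact: disk0].
Qed.

Lemma dilations_le x r s : r <= s -> dilations x r -> dilations x s.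
Proof.
move=> rs [r0 [b Bb ->]]; have s0 := lt_le_trans r0 rs; split=> //.
exists ((r / s) *: b); last by rewrite scalerA mulrC divfK ?gt_eqF.
apply: diskZ => //; rewrite ger0_norm; last by rewrite divr_ge0// ltW.
by rewrite ler_pdivrMr// mul1r.
Qed.

Lemma dilationsD x y r s :
  dilations x r -> dilations y s -> dilations (x + y) (r + s).
Proof.
move=> [r0 [b Bb ->]] [s0 [c Bc ->]]; have rs0 : 0 < r + s by rewrite addr_gt0.
split=> //; exists ((r / (r + s)) *: b + (s / (r + s)) *: c); last first.
  by rewrite scalerDr !scalerA !(mulrC (r + s)) !divfK ?gt_eqF.
apply: (disk_absolutely_convex B).2 => //.
have rs1 t : 0 < t -> `|t / (r + s)| = t / (r + s).
  by move=> t0; rewrite ger0_norm// divr_ge0// ltW.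
by rewrite !rs1// -mulrDl divff ?gt_eqF.
Qed.

Lemma dilationsZ a x r : a != 0 -> dilations x r -> dilations (a *: x) (`|a| * r).
Proof.
move=> a0 [r0 [b Bb ->]]; have na0 : 0 < `|a| by rewrite normr_gt0.
split; first by rewrite mulr_gt0.
exists ((a / `|a|) *: b).
  by apply: diskZ => //; rewrite normrM normfV normr_id divff ?gt_eqF.
by rewrite !scalerA mulrAC [`|a| * _]mulrC divfK ?gt_eqF.
Qed.

Lemma dilations0 r : 0 < r -> dilations 0 r.
Proof. by move=> r0; split=> //; exists 0; [exact: disk0|rewrite scaler0]. Qed.

Lemma lin_spanP x : lin_span B x <-> dilations x !=set0.
Proof.
split=> [xB|[r [r0 [b Bb ->]]] V BV V0 VD]; last first.
  by rewrite -[_ *: _]addr0; apply: VD => //; exact: BV.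
apply: (xB [set y | dilations y !=set0]) => [b Bb||a y z [r yr] [s zs]].
- by exists 1; split=> //; exists b => //; rewrite scale1r.
- by exists 1; exact: dilations0.
- have [->|a0] := eqVneq a 0; first by rewrite scale0r add0r; exists s.
  by exists (`|a| * r + s); apply: dilationsD => //; exact: dilationsZ.
Qed.

Lemma dilations_lb x : has_lbound (dilations x).
Proof. by exists 0 => r [/ltW]. Qed.

Lemma minkowski_ge0 x : 0 <= minkowski_functional x.
Proof.
have [x0|/set0P xN0] := eqVneq (dilations x) set0.
  by rewrite /minkowski_functional x0 inf0.
by apply: lb_le_inf => // s [/ltW].
Qed.

Lemma minkowski_lt x r :
  dilations x !=set0 -> minkowski_functional x < r -> dilations x r.
Proof.
move=> x0 xr; have [s xs sr] := inf_lt x0 xr.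
exact: dilations_le (ltW sr) xs.
Qed.

Lemma minkowski_le x r : dilations x r -> minkowski_functional x <= r.
Proof. by move=> xr; apply: ge_inf => //; exact: dilations_lb. Qed.

Definition disk_space_pred : {pred E} := fun x => `[< lin_span B x >].

(* The carrier of E_B; it is made a normed space by [minkowski_functional] and
   Mackey completeness of [E] makes it a Banach space. *)
Record disk_space := DiskSpace {
  disk_incl : E; _ : disk_incl \in disk_space_pred }.

HB.instance Definition _ := [isSub for disk_incl].
HB.instance Definition _ := [Choice of disk_space by <:].

Lemma disk_space_submod : submod_closed disk_space_pred.
Proof.
split=> [|a x y /asboolP xB /asboolP yB]; apply/asboolP.
  by move=> V _ V0 _.
by move=> V BV V0 VD; apply: (VD); [exact: xB|exact: yB].
Qed.

HB.instance Definition _ := GRing.isSubmodClosed.Build R E disk_space_pred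
  disk_space_submod.
HB.instance Definition _ := [SubChoice_isSubLmodule of disk_space by <:].

Lemma disk_space_dilations (x : disk_space) : dilations (disk_incl x) !=set0.
Proof. by apply/lin_spanP/asboolP; exact: (valP x). Qed.

Definition disk_norm (x : disk_space) : R := minkowski_functional (disk_incl x).

Lemma disk_normD x y : disk_norm (x + y) <= disk_norm x + disk_norm y.
Proof.
apply/ler_addgt0Pl => e e0; apply: minkowski_le.
have -> : e + (disk_norm x + disk_norm y) =
    (disk_norm x + e / 2) + (disk_norm y + e / 2).
  by rewrite addrACA -splitr addrC.
have e20 : 0 < e / 2 by rewrite divr_gt0.
by apply: dilationsD; (apply: minkowski_lt;
  [exact: disk_space_dilations|rewrite ltrDl]).
Qed.

Lemma disk_normZ (a : R) x : disk_norm (a *: x) = `|a| * disk_norm x.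
Proof.
have le_normZ b y : b != 0 -> disk_norm (b *: y) <= `|b| * disk_norm y.
  move=> b0; rewrite -ler_pdivrMl ?normr_gt0//.
  apply: lb_le_inf; first exact: disk_space_dilations.
  move=> r yr; rewrite ler_pdivrMl ?normr_gt0//.
  by apply: minkowski_le; exact: dilationsZ.
have [->|a0] := eqVneq a 0.
  rewrite scale0r normr0 mul0r; apply/eqP; rewrite eq_le minkowski_ge0 andbT.
  by apply/ler_addgt0Pl => e e0; rewrite addr0; apply/minkowski_le/dilations0.
apply/eqP; rewrite eq_le le_normZ//= -ler_pdivlMl ?normr_gt0// -normfV.
by rewrite (le_trans _ (le_normZ _ _ _)) ?invr_eq0// scalerA mulVf// scale1r.
Qed.

Lemma disk_norm0_eq0 x : disk_norm x = 0 -> x = 0.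
Proof.
move=> x0; apply: val_inj => /=.
apply: (@convenient_hausdorff R E) => U V xU V0.
exists (disk_incl x); split; first exact: nbhs_singleton.
have [r [r0 BV]] : exists r : R, 0 < r /\ B `<=` *:%R r @` V.
  near (+oo : set_system R) => r; exists r; split=> //.
  near: r; exact: disk_bounded.
have [|_ [b /BV[v Vv <-] ->]] := @minkowski_lt (disk_incl x) r^-1
  (disk_space_dilations x).
  by rewrite -[minkowski_functional _]/(disk_norm x) x0 invr_gt0.
by rewrite scalerA mulVf ?gt_eqF// scale1r.
Unshelve. all: by end_near. Qed.

HB.instance Definition _ := Lmodule_isNormed.Build R disk_space
  disk_normD disk_normZ disk_norm0_eq0.

Lemma disk_normE (x : disk_space) : `|x| = minkowski_functional (disk_incl x).
Proof. by []. Qed.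

Lemma disk_space_complete (F : set_system disk_space) :
  ProperFilter F -> cauchy F -> cvg F.
Proof.
move=> FF /cauchyP Fc.
pose e (n : nat) : R := n.+1%:R^-1.
have e0 n : 0 < e n by rewrite invr_gt0.
have /choice[u Fu] : forall n, exists x, F (ball x (e n)).
  by move=> n; exact: Fc.
have u_dist n m : `|u n - u m| < e n + e m.
  have [y [yn ym]] := filter_ex (filterI (Fu n) (Fu m)).
  move: yn ym; rewrite -!ball_normE /= => yn ym.
  rewrite -(subrKA y) (le_lt_trans (ler_normD _ _))// ltrD//.
  by rewrite distrC.
have u_dil n m : dilations (disk_incl (u n) - disk_incl (u m)) (e n + e m).
  exact: (minkowski_lt (disk_space_dilations (u n - u m)) (u_dist n m)).
have e_cvg : e @ \oo --> (0 : R) by exact: cvg_harmonic.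
have [|l ul] := @convenient_mackey_complete R E (@disk_incl \o u).
  exists B, (fun n m => e n + e m); split.
  - exact: disk_absolutely_convex.
  - exact: disk_bounded.
  - rewrite -[X in _ --> X]addr0; apply: cvgD.
      by apply: cvg_comp e_cvg; exact: cvg_fst.
    by apply: cvg_comp e_cvg; exact: cvg_snd.
  - by move=> n m; have [_] := u_dil n m.
have l_dil n : dilations (disk_incl (u n) - l) (e n + e n).
  have ee0 : 0 < e n + e n by rewrite addr_gt0.
  split=> //; exists ((e n + e n)^-1 *: (disk_incl (u n) - l)); last first.
    by rewrite scalerA divff ?gt_eqF// scale1r.
  pose w m := (e n + e n)^-1 *: (disk_incl (u n) - disk_incl (u m)).
  have w_cvg : w @ \oo --> (e n + e n)^-1 *: (disk_incl (u n) - l).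
    apply: (@continuous2_cvg _ R^o E E _ _ _ _ (fun a x => a *: x)).
    - exact: (scale_continuous ((e n + e n)^-1 : R^o, disk_incl (u n) - l)).
    - exact: cvg_cst.
    - apply: (@continuous2_cvg _ E E E _ _ _ _ (fun x y => x - y)).
      + by move=> A; exact: (@sub_continuous E (disk_incl (u n), l) A).
      + exact: cvg_cst.
      + exact: ul.
  have w_near : \forall m \near \oo, disk_set B (w m).
    near=> m.
    have enm : e n + e m <= e n + e n.
      rewrite lerD2l lef_pV2 ?qualifE//= ler_nat ltnS.
      by near: m; exact: nbhs_infty_ge.
    have [_ [b Bb unm]] := dilations_le enm (u_dil n m).
    by rewrite /w unm scalerA mulVf ?gt_eqF// scale1r.
  exact: (closed_cvg _ (@disk_closed R E B) w_near _ w_cvg).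
have lB : l \in disk_space_pred.
  apply/asboolP; rewrite -(subKr (disk_incl (u 0)) l).
  move=> V BV V0 VD; rewrite addrC -scaleN1r; apply: (VD).
    by apply: ((lin_spanP _).2 _ V BV V0 VD); exists (e 0 + e 0).
  exact: ((lin_spanP _).2 (disk_space_dilations (u 0)) V BV V0 VD).
apply/cvg_ex; exists (DiskSpace lB); apply/cvgrPdist_lt => eps eps0.
have [n n_eps] : exists n, e n + e n + e n < eps.
  suff: \forall n \near \oo, e n + e n + e n < eps by move=> /filter_ex.
  have e3 : e n + e n + e n @[n --> \oo] --> (0 : R).
    by rewrite -[X in _ --> X]addr0 -[X in _ --> X + _]addr0;
      apply: cvgD => //; exact: cvgD.
  by have /(_ _ _ eps0) := cvgr_lt _ e3; apply.
apply: filterS (Fu n) => y; rewrite -ball_normE /= => un_y.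
rewrite (le_lt_trans _ n_eps)// -(subrKA (u n)) (le_trans (ler_normD _ _))//.
by rewrite lerD ?(ltW un_y)// distrC; exact: (minkowski_le (l_dil n)).
Unshelve. all: by end_near. Qed.

HB.instance Definition _ := Uniform_isComplete.Build disk_space
  disk_space_complete.

End DiskSpace.

Definition dc_convenient (R : realType) (E F : convenientType R) (t : dc_type)
    (M : nat -> R) (U : set E) (f : E -> F) : Prop :=
  smooth_map U f /\
  forall (l : {linear F -> R^o}) (B : disk E), continuous l ->
    dc_banach t M (@disk_incl R E B @^-1` U) (l \o f \o @disk_incl R E B).

(* Main.v *)
(** The derivatives of [g o f] along [E_B] are given by the Faa di Bruno formula, and
    log-convexity bounds its terms by [M_j * M_{a_1} ... M_{a_j} <= M_1^j * M_k].  To apply the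
    hypothesis on [g] one needs a disk [B'] of [F] such that [f] and its derivatives take values
    in [F_{B'}] on the given compact set.  Such a [B'] is a polar
    [{x | |l x| <= b l for all l in F*}]: it is bounded because weakly bounded sets are bounded
    (Hahn-Banach and a gliding hump), and membership is tested by functionals.  In the Roumieu
    case the radius depends on [l]; this is circumvented by replacing the geometric weights by
    arbitrary submultiplicative weights [r_k] with [r_k rho^k] bounded for every [rho], which
    still detect exponential growth.  Openness of [U_B] and [V_{B'}] follows from a smooth curve
    through a fast converging sequence.  Compact sets in [F_{B'}] are made convex, locally, by
    Mazur's theorem.  Frechet smoothness of [g o f] on [E_B] follows from the existence of all
    iterated directional derivatives once these are locally bounded. *)
Require Import Defs.
From HB Require Import structures.
From mathcomp Require Import all_boot all_order all_algebra.
From mathcomp Require Import all_classical all_reals.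
From mathcomp Require Import interval_inference finmap.
From mathcomp Require Import topology tvs normedtype landau derive convex sequences.
From mathcomp Require Import exp realfun.
From mathcomp Require Import ring lra zify.

Set Implicit Arguments.
Unset Strict Implicit.
Unset Printing Implicit Defensive.

Import Order.TTheory GRing.Theory Num.Theory.
Import numFieldNormedType.Exports.
Local Open Scope classical_set_scope.
Local Open Scope ring_scope.

(** * Hahn-Banach theorem and weakly bounded sets *)

(** A map into [F] is known only through its compositions with functionals, and [g] only through its
    restrictions to the normed spaces spanned by disks. So each analytic step has to find a disk in
    which the vectors at hand are norm bounded. Constants that depend on the functional [l] are
    harmless, since they become the value [b l] that defines the polar; what has to be common to all
    [l] is the rest of the estimate: the interval on a line, the rate of convergence of a sequence,
    the growth in the order of differentiation. The same device produces the derivatives of [f] as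
    vectors of [F]: the difference quotients are Mackey-Cauchy with respect to a polar of this kind.
    A single disk is available along one line through a point, not on a neighborhood of it, and this
    is why the terms of the formula are differentiated direction by direction and Frechet
    differentiability is recovered only at the end. *)

Section HahnBanach.
Context {R : realType} (V : lmodType R) (p : V -> R).
Hypothesis pD : forall x y, p (x + y) <= p x + p y.
Hypothesis pZ : forall a x, p (a *: x) = `|a| * p x.

Let p0 : p 0 = 0.
Proof. by rewrite -(scale0r 0) pZ normr0 mul0r. Qed.

Let pN x : p (- x) = p x.
Proof. by rewrite -scaleN1r pZ normrN1 mul1r. Qed.

Lemma seminorm_ge0 x : 0 <= p x.
Proof.
by have := pD x (- x); rewrite subrr p0 pN; lra.
Qed.

(** A partial linear functional is encoded by its graph. Single-valuedness follows from the
    domination, because [p 0 = 0]. *)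
Definition dominated_graph (S : set (V * R^o)) : Prop :=
  (forall (a : R) u v, S u -> S v -> S (a *: u + v)) /\
  (forall u, S u -> u.2 <= p u.1).

(** The value [c] at [x0] has to lie between all v.2 - p (v.1 - x0) and all p (u.1 + x0) - u.2.
    Subadditivity puts the former below the latter, so the supremum of the former works; homogeneity
    reduces the coefficient t to 1 and -1. *)
Lemma dominated_graph_extend (S : set (V * R^o)) (x0 : V) :
  dominated_graph S -> S 0 ->
  exists c : R, dominated_graph
    [set u | exists v (t : R), S v /\ u = v + t *: ((x0, c) : V * R^o)].
Proof.
move=> [SD Sp] S0.
have SB u v : S u -> S v -> S (u + v) by rewrite -{2}(scale1r u); exact: SD.
have SZ (a : R) u : S u -> S (a *: u) by move=> Su; rewrite -[_ *: _]addr0; exact: SD.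
pose T := [set r | exists2 u, S u & r = u.2 - p (u.1 - x0)].
have T0 : T !=set0 by exists (0 - p (0 - x0)), 0.
have Tub u : S u -> ubound T (p (u.1 + x0) - u.2).
  move=> Su _ [v Sv ->]; rewrite lerBlDr addrAC lerBrDr.
  rewrite (le_trans (Sp _ (SB _ _ Sv Su)))//=.
  by rewrite (le_trans _ (pD _ _))// addrACA subrr addr0 addrC.
have supT : has_sup T by split=> //; exists (p (0 + x0) - 0); exact: (Tub 0).
exists (sup T); split=> [a u v [u' [s [Su ->]]] [v' [t [Sv ->]]]|].
  exists (a *: u' + v'), (a * s + t); split; first exact: SD.
  by rewrite scalerDr scalerDl scalerA !addrA; congr (_ + _); rewrite addrAC.
move=> _ [u [t [Su ->]]] /=.
have [t0|t0|->] := ltgtP t 0; last by rewrite !scale0r !addr0 Sp.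
- have /= := sup_upper_bound supT (ex_intro2 _ _ _ (SZ (- t)^-1 u Su) erefl).
  have -> : p (u.1 + t *: x0) = - t * p ((- t)^-1 *: u.1 - x0).
    rewrite -{1}(@gtr0_norm _ (- t)) ?oppr_gt0// -pZ scalerBr scalerA.
    by rewrite divff ?oppr_eq0 ?lt_eqF// scale1r scaleNr opprK.
  have e : u.2 = - t * ((- t)^-1 * u.2) by rewrite mulrA divff ?oppr_eq0 ?lt_eqF// mul1r.
  move: e; set c := sup T; set q := p _; set y := _^-1 * u.2.
  by rewrite /GRing.scale/= -/y => ->; nra.
- have /= := ge_sup T0 (Tub _ (SZ t^-1 u Su)).
  have -> : p (u.1 + t *: x0) = t * p (t^-1 *: u.1 + x0).
    rewrite -{2}(gtr0_norm t0) -pZ scalerDr scalerA.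
    by rewrite divff ?gt_eqF// scale1r.
  have e : u.2 = t * (t^-1 * u.2) by rewrite mulrA divff ?gt_eqF// mul1r.
  move: e; set c := sup T; set q := p _; set y := _^-1 * u.2.
  by rewrite /GRing.scale/= -/y => ->; nra.
Qed.

Lemma hahn_banach (w : V) :
  exists l : {linear V -> R^o}, (forall x, `|l x| <= p x) /\ l w = p w.
Proof.
pose H0 : set (V * R^o) := [set u | exists a : R, u = a *: ((w, p w) : V * R^o)].
have H0d : dominated_graph H0.
  split=> [a _ _ [s ->] [t ->]|_ [a ->]].
    by exists (a * s + t); rewrite scalerDl scalerA.
  by rewrite /= pZ ler_wpM2r ?seminorm_ge0// ler_norm.
have H00 : H0 0 by exists 0; rewrite scale0r.
(* The union with [H0] makes the predicate true of the empty set, which is the union of the empty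
   chain. *)
have [|A [Ad Amax]] := @Zorn_bigcup _ (fun G => dominated_graph (G `|` H0)).
  move=> F FP totF.
  have FU u v : ((\bigcup_(X in F) X) `|` H0) u -> ((\bigcup_(X in F) X) `|` H0) v ->
      exists G, [/\ dominated_graph (G `|` H0), (G `|` H0) u, (G `|` H0) v &
        G `<=` \bigcup_(X in F) X].
    move=> [[X FX Xu]|Hu] [[Y FY Yv]|Hv].
    - have [XY|YX] := totF _ _ FX FY.
        by exists Y; split; [exact: FP|left; exact: XY|left|exact: bigcup_sup].
      by exists X; split; [exact: FP|left|left; exact: YX|exact: bigcup_sup].
    - by exists X; split; [exact: FP|left|right|exact: bigcup_sup].
    - by exists Y; split; [exact: FP|right|left|exact: bigcup_sup].
    - by exists set0; rewrite set0U; split.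
  split=> [a u v Uu Uv|u Uu].
    have [G [[Gd _] Gu Gv GF]] := FU _ _ Uu Uv.
    by have [Guv|] := Gd a _ _ Gu Gv; [left; exact: GF|right].
  by have [G [[_ Gp] Gu _ _]] := FU _ _ Uu Uu; exact: Gp.
set S := A `|` H0 in Ad; have [SD Sp] := Ad.
have S0 : S 0 by right.
have SZ (a : R) u : S u -> S (a *: u) by move=> Su; rewrite -[_ *: _]addr0; exact: SD.
have Stot x : exists r, S (x, r).
  have [c Bd] := dominated_graph_extend x Ad S0.
  apply: contrapT => Sx; set B := (X in dominated_graph X) in Bd.
  have SB : S `<=` B by move=> u Su; exists u, 0; rewrite scale0r addr0.
  apply: (Amax B).
    split=> [u Au|BA]; first by apply: SB; left.
    apply: Sx; exists c; left; apply: BA; exists 0, 1; rewrite scale1r add0r.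
    by split.
  by rewrite setUidl// => u Hu; apply: SB; right.
have Suniq x r s : S (x, r) -> S (x, s) -> r = s.
  move=> Sr Ss; suff le a b : S (x, a) -> S (x, b) -> a <= b.
    by apply/eqP; rewrite eq_le !le.
  move=> Sa Sb; have /Sp := SD (-1) _ _ Sb Sa.
  by rewrite /= !scaleN1r addNr p0 addrC subr_le0.
have /choice[l Sl] := Stot.
have lL : linear (l : V -> R^o).
  by move=> a u v; apply: (Suniq (a *: u + v)) => //; exact: (SD _ _ _ (Sl u) (Sl v)).
pose L := HB.pack (l : V -> R^o) (GRing.isLinear.Build R V R^o _ l lL) : {linear V -> R^o}.
exists L; split=> [x|].
  rewrite ler_norml (Sp _ (Sl x)) andbT lerNl -pN.
  have /Sp := SZ (-1) _ (Sl x).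
  by rewrite /= !scaleN1r.
by apply: (Suniq w); [exact: Sl|right; exists 1; rewrite scale1r].
Qed.

End HahnBanach.

(** * Seminorms and continuous functionals on a locally convex space *)

Lemma convex_setP (R : realType) (V : lmodType R) (A : set V) :
  convex_set A <-> forall x y (t : R), 0 <= t -> t <= 1 -> A x -> A y ->
    A (t *: x + (1 - t) *: y).
Proof.
split=> [cA x y t t0 t1 Ax Ay|cA x y l /set_mem Ax /set_mem Ay].
  exact: (set_mem (cA x y (Itv01 t0 t1) (mem_set Ax) (mem_set Ay))).
by apply/mem_set; apply: cA.
Qed.

Lemma scale_cvg0 (R : realType) (F : tvsType R) (x : F) : (r : R) *: x @[r --> 0] --> (0 : F).
Proof.
rewrite -[X in _ --> X](scale0r x).
apply: (@continuous2_cvg _ R^o F F _ _ _ _ (fun a x => a *: x)) => /=.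
- exact: (scale_continuous (0 : R^o, x)).
- exact: cvg_id.
- exact: cvg_cst.
Qed.

(** [p] is the Minkowski functional of the intersection of [W] and -[W], for a convex neighborhood
    [W] inside [N]; the symmetry gives absolute homogeneity. *)
Lemma tvs_seminorm (R : realType) (F : tvsType R) (N : set F) : nbhs 0 N ->
  exists p : F -> R, [/\ forall x y, p (x + y) <= p x + p y,
    forall (a : R) x, p (a *: x) = `|a| * p x, nbhs 0 [set x | p x <= 1] &
    forall x, p x < 1 -> N x].
Proof.
move=> N0; have [B Bconv [Bopen Bbasis]] := @locally_convex R F.
have [W [BW W0] WN] := Bbasis 0 N N0.
have Wn : nbhs 0 W by apply: open_nbhs_nbhs; split=> //; exact: Bopen.
pose A := [set x | W x /\ W (- x)].
have An : nbhs 0 A.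
  apply: filterI => //.
  by apply: (@opp_continuous F 0); rewrite oppr0.
have A0 : A 0 by exact: nbhs_singleton.
have /convex_setP cW := Bconv W (mem_set BW).
have cA x y (t : R) : 0 <= t -> t <= 1 -> A x -> A y -> A (t *: x + (1 - t) *: y).
  move=> t0 t1 [Wx WNx] [Wy WNy]; split; first exact: cW.
  by rewrite opprD -!scalerN; exact: cW.
pose dil x := [set r : R | 0 < r /\ A (r^-1 *: x)].
have dil0 x : dil x !=set0.
  have : \forall r \near (0 : R), A (r *: x) by exact: scale_cvg0.
  move=> /nbhs_ballP[e /= e0 eA]; exists ((e / 2)^-1); split.
    by rewrite invr_gt0 divr_gt0.
  rewrite invrK; apply: eA; rewrite /ball/= sub0r normrN gtr0_norm ?divr_gt0//.
  by rewrite ltr_pdivrMr// ltr_pMr// ltr1n.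
have lb x : has_lbound (dil x) by exists 0 => r [/ltW].
have dil_le x r s : r <= s -> dil x r -> dil x s.
  move=> rs [r0 Ar]; have s0 := lt_le_trans r0 rs; split=> //.
  have -> : s^-1 *: x = (r / s) *: (r^-1 *: x) + (1 - r / s) *: 0.
    by rewrite scaler0 addr0 scalerA mulrAC divff ?gt_eqF// mul1r.
  apply: cA => //; first by rewrite divr_ge0// ltW.
  by rewrite ler_pdivrMr// mul1r.
pose p x := inf (dil x).
have p_lt x r : p x < r -> dil x r.
  by move=> /(inf_lt (dil0 x))[s xs /ltW sr]; exact: dil_le xs.
have p_le x r : dil x r -> p x <= r by move=> xr; exact: ge_inf.
have p_ge0 x : 0 <= p x by apply: lb_le_inf => // r [/ltW].
have p0 : p 0 = 0.
  apply/eqP; rewrite eq_le p_ge0 andbT; apply/ler_addgt0Pl => e e0.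
  by rewrite addr0; apply: p_le; split=> //; rewrite scaler0.
exists p; split.
- move=> x y; apply/ler_addgt0Pl => e e0; apply: p_le.
  have e20 : 0 < e / 2 by rewrite divr_gt0.
  have [r0 Ar] : dil x (p x + e / 2) by apply: p_lt; rewrite ltrDl.
  have [s0 As] : dil y (p y + e / 2) by apply: p_lt; rewrite ltrDl.
  have -> : e + (p x + p y) = (p x + e / 2) + (p y + e / 2).
    by rewrite addrACA -splitr addrC.
  move: (p x + e / 2) (p y + e / 2) r0 s0 Ar As => r s r0 s0 Ar As.
  split; first by rewrite addr_gt0.
  have rs0 : r + s != 0 by rewrite gt_eqF// addr_gt0.
  have -> : (r + s)^-1 *: (x + y) =
      (r / (r + s)) *: (r^-1 *: x) + (1 - r / (r + s)) *: (s^-1 *: y).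
    have -> : 1 - r / (r + s) = s / (r + s).
      by rewrite -{1}(divff rs0) -mulrBl addrAC subrr add0r.
    rewrite scalerDr !scalerA mulrAC divff ?gt_eqF// mul1r.
    by rewrite mulrAC divff ?gt_eqF// mul1r.
  apply: cA => //; first by rewrite divr_ge0// ltW// addr_gt0.
  by rewrite ler_pdivrMr ?addr_gt0// mul1r lerDl ltW.
- have le_pZ (a : R) x : a != 0 -> p (a *: x) <= `|a| * p x.
    move=> a0; rewrite -ler_pdivrMl ?normr_gt0//.
    apply: lb_le_inf => // r [r0 Ar]; rewrite ler_pdivrMl ?normr_gt0//.
    apply: p_le; split; first by rewrite mulr_gt0 ?normr_gt0.
    rewrite scalerA; have [a_gt0|a_lt0] := ltrP 0 a.
      by rewrite gtr0_norm// invfM mulrAC mulVf// mul1r.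
    rewrite ler0_norm// invfM invrN !mulNr mulrAC mulVf// mul1r scaleNr.
    by case: Ar; split=> //; rewrite opprK.
  move=> a x; have [->|a0] := eqVneq a 0.
    by rewrite scale0r normr0 mul0r p0.
  apply/eqP; rewrite eq_le le_pZ//= -ler_pdivlMl ?normr_gt0// -normfV.
  by rewrite (le_trans _ (le_pZ _ _ _)) ?invr_eq0// scalerA mulVf// scale1r.
- apply: filterS An => x Ax; apply: p_le; split=> //.
  by rewrite invr1 scale1r.
- move=> x /p_lt[_ [+ _]]; rewrite invr1 scale1r; exact: WN.
Qed.

Section SeminormContinuity.
Context {R : realType} {F : tvsType R} (p : F -> R).
Hypothesis pD : forall x y, p (x + y) <= p x + p y.
Hypothesis pZ : forall (a : R) x, p (a *: x) = `|a| * p x.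
Hypothesis pn : nbhs 0 [set x | p x <= 1].

Lemma seminorm_continuous (l : {linear F -> R^o}) (C : R) :
  (forall x, `|l x| <= C * p x) -> continuous l.
Proof.
move=> lC x; apply/cvgrPdist_lt => e e0.
have C0 : 0 < `|C| + 1 by rewrite ltr_wpDl.
pose k := (`|C| + 1) / e.
have k0 : 0 < k by rewrite divr_gt0.
have : k *: (x - y) @[y --> x] --> (0 : F).
  rewrite -(scaler0 _ k) -(subrr x).
  apply: (@continuous2_cvg _ R^o F F _ _ _ _ (fun a x => a *: x)) => /=.
  - exact: (@scale_continuous R F (k, x - x)).
  - exact: cvg_cst.
  - apply: (@continuous2_cvg _ F F F _ _ _ _ (fun x y => x - y)).
    + by move=> B; exact: (@sub_continuous F (x, x) B).
    + exact: cvg_cst.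
    + exact: cvg_id.
move=> /(_ _ pn) H; apply: (@filterS F (nbhs (x : F)) _ _ _ _ H) => {H} y /=; rewrite pZ gtr0_norm// => kp.
rewrite -linearB (le_lt_trans (lC _))//.
have p_ge0 := seminorm_ge0 pD pZ (x - y).
have : p (x - y) <= e / (`|C| + 1).
  by rewrite -[e / _]invf_div -[leRHS]mulr1 ler_pdivlMl.
rewrite ler_pdivlMr// => H.
rewrite (le_lt_trans (ler_wpM2r p_ge0 (ler_norm C)))//.
rewrite lt_neqAle (le_trans _ H) ?andbT; last by rewrite mulrC ler_wpM2l// lerDl.
have [P0|P0] := eqVneq (p (x - y)) 0; first by rewrite P0 mulr0 lt_eqF.
rewrite lt_eqF// (lt_le_trans _ H)// mulrC ltr_pM2l ?ltrDl//.
by rewrite lt_neqAle eq_sym P0.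
Qed.

End SeminormContinuity.

(** For the seminorm [p] of any neighborhood of 0, Hahn-Banach gives a continuous [l] with
    [l x = p x]. Hence [p x = 0], and [x] lies in every neighborhood of 0. *)
Lemma tvs_separation (R : realType) (F : tvsType R) (x : F) :
  hausdorff_space F ->
  (forall l : {linear F -> R^o}, continuous l -> l x = 0) -> x = 0.
Proof.
move=> hF l0; apply: hF => U V xU V0; exists x; split; first exact: nbhs_singleton.
have [p [pD pZ pn pV]] := tvs_seminorm V0.
have [l [lp lx]] := hahn_banach pD pZ x.
apply: pV; rewrite -lx l0//.
by apply: (seminorm_continuous pD pZ pn (C := 1)) => y; rewrite mul1r.
Qed.

Lemma cvg_dominated_increments (R : realType) (u e : nat -> R) :
  (forall n m, (n <= m)%N -> `|u m - u n| <= e n) -> e @ \oo --> (0 : R) ->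
  exists2 l : R, u @ \oo --> l & forall n, `|l - u n| <= e n.
Proof.
move=> ue e0.
have : cvg (u @ \oo).
  apply: cauchy_cvg; apply: cauchy_exP => d d0.
  have [n en] : exists n, e n < d.
    have : \forall n \near \oo, e n < d by exact: (cvgr_lt 0).
    by move=> /filter_ex.
  exists (u n); exists n => // m /= nm; rewrite -ball_normE /= distrC.
  exact: le_lt_trans (ue _ _ nm) en.
move=> /cvg_ex[l ul]; exists l => // n.
have H : `|u m - u n| @[m --> \oo] --> `|l - u n|.
  by apply: cvg_norm; apply: cvgB => //; exact: cvg_cst.
apply: (cvgr_to_le H).
by exists n => // m /= nm; exact: ue.
Qed.

Section WeaklyBounded.
Context {R : realType} {F : tvsType R}.

Let hump_sign (a : R) : R := if 0 <= a then 1 else -1.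

Let hump_signP (a b : R) : 0 <= b -> b <= `|a + hump_sign a * b|.
Proof.
rewrite /hump_sign => b0; case: ifPn => [a0|]; last rewrite -ltNge => a0.
  by rewrite mul1r; have := ler_norm (a + b); lra.
by rewrite mulN1r; have := ler_norm (- (a - b)); rewrite normrN; lra.
Qed.

(* Sokal's gliding hump: a functional that is large on the [n]-th vector is
   added with weight [3^-n] and the sign that does not cancel the partial sum. *)
Lemma weakly_bounded_seminorm (W : set F) (p : F -> R) :
  (forall x y, p (x + y) <= p x + p y) ->
  (forall (a : R) x, p (a *: x) = `|a| * p x) -> nbhs 0 [set x | p x <= 1] ->
  (forall l : {linear F -> R^o}, continuous l ->
    exists b, forall x, W x -> `|l x| <= b) ->
  exists b, forall x, W x -> p x <= b.
Proof.
move=> pD pZ pn Wl; apply: contrapT => Wp.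
have p_ge0 x : 0 <= p x by exact: seminorm_ge0.
(* The n-th hump contributes 3^-n p(w n) at [w n] and the later ones at most half of that, so the
   limit functional exceeds n there. *)
have /choice[w wP] : forall n : nat, exists x, W x /\ 2 * n%:R * 3 ^+ n < p x.
  move=> n; apply: contrapT => H; apply: Wp; exists (2 * n%:R * 3 ^+ n) => x Wx.
  by rewrite leNgt; apply/negP => ?; apply: H; exists x.
have /choice[l lP] := fun n => hahn_banach pD pZ (w n).
pose s := fix s (n : nat) : F -> R := if n is m.+1 then
  fun x => s m x + hump_sign (s m (w m)) * (3 ^- m * l m x) else fun=> 0.
have sS n x : s n.+1 x = s n x + hump_sign (s n (w n)) * (3 ^- n * l n x) by [].
have sZ n (a : R) x y : s n (a *: x + y) = a * s n x + s n y.
  elim: n => [|n ih]; first by rewrite /= mulr0 addr0.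
  by rewrite !sS ih linearP /GRing.scale/=; ring.
(* The geometric tail: the sum of 3^-m p(x) over m >= n. *)
pose e x n : R := 3 / 2 * 3 ^- n * p x.
have sB x n m : (n <= m)%N -> `|s m x - s n x| <= e x n - e x m.
  elim: m => [|m ih]; first by rewrite leqn0 => /eqP ->; rewrite !subrr normr0.
  rewrite leq_eqVlt => /orP[/eqP <-|]; first by rewrite !subrr normr0.
  rewrite ltnS => /ih H.
  have : `|hump_sign (s m (w m)) * (3 ^- m * l m x)| <= e x m - e x m.+1.
    have -> : e x m - e x m.+1 = 3 ^- m * p x.
      by rewrite /e exprS invfM; field; rewrite expf_neq0.
    rewrite normrM (_ : `|hump_sign _| = 1) ?mul1r; last first.
      by rewrite /hump_sign; case: ifP; rewrite ?normrN1 ?normr1.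
    rewrite normrM ger0_norm ?invr_ge0 ?exprn_ge0// ler_wpM2l ?invr_ge0 ?exprn_ge0//.
    by case: (lP m).
  have := ler_normD (s m x - s n x) (hump_sign (s m (w m)) * (3 ^- m * l m x)).
  by rewrite sS addrAC; lra.
have e_ge0 x n : 0 <= e x n by rewrite /e !mulr_ge0// invr_ge0 exprn_ge0.
have e_cvg x : e x @ \oo --> (0 : R).
  rewrite -(mul0r (p x)) -(mulr0 (3 / 2)).
  apply: cvgMl; apply: cvgMr; under eq_fun do rewrite -exprVn.
  apply: cvg_expr; rewrite normfV ger0_norm// invf_lt1//; lra.
have /choice[S Slim] : forall x, exists S, s n x @[n --> \oo] --> S /\
    forall n, `|S - s n x| <= e x n.
  move=> x; have [n m nm|S sS' HS] := @cvg_dominated_increments R (s^~ x) (e x) _ (e_cvg x).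
    by apply: (le_trans (sB x _ _ nm)); rewrite gerBl.
  by exists S.
have SL : linear (S : F -> R^o).
  move=> a x y; have [Sx _] := Slim x; have [Sy _] := Slim y; have [Sxy _] := Slim (a *: x + y).
  apply: (norm_cvg_unique Sxy).
  have -> : (fun n => s n (a *: x + y)) = (fun n => a * s n x + s n y).
    by apply/funext => n; rewrite sZ.
  by apply: cvgD => //; apply: cvgMr.
pose L := HB.pack (S : F -> R^o) (GRing.isLinear.Build R F R^o _ S SL) : {linear F -> R^o}.
have Lc : continuous L.
  apply: (seminorm_continuous pD pZ pn (C := 3 / 2)) => x.
  have [_ /(_ 0%N)] := Slim x; rewrite /= subr0 /e expr0 invr1 mulr1; exact.
have [b Lb] := Wl L Lc.
have [n bn] : exists n : nat, b < n%:R.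
  exists (Num.truncn `|b|).+1; rewrite (le_lt_trans (ler_norm b))//.
  by rewrite truncnS_gt.
have [Wn pwn] := wP n; have := Lb _ Wn; apply/negP; rewrite -ltNge.
rewrite (lt_trans bn)//.
have [_ /(_ n.+1)] := Slim (w n).
have -> : e (w n) n.+1 = 3 ^- n * p (w n) / 2.
  by rewrite /e exprS invfM; field; rewrite expf_neq0.
have : 3 ^- n * p (w n) <= `|s n.+1 (w n)|.
  rewrite sS; have [_ ->] := lP n; apply: hump_signP.
  by rewrite mulr_ge0// invr_ge0 exprn_ge0.
have : 2 * n%:R < 3 ^- n * p (w n).
  by rewrite ltr_pdivlMl ?exprn_gt0// mulrC.
rewrite -[L (w n)]/(S (w n)).
have := ler_normD (S (w n)) (s n.+1 (w n) - S (w n)).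
rewrite (addrC (S _)) subrK distrC; lra.
Qed.

Lemma weakly_bounded (W : set F) :
  (forall l : {linear F -> R^o}, continuous l ->
    exists b, forall x, W x -> `|l x| <= b) ->
  tvs_bounded W.
Proof.
move=> Wl U U0; have [p [pD pZ pn pU]] := tvs_seminorm U0.
have [b Wb] := weakly_bounded_seminorm pD pZ pn Wl.
near=> r => x Wx.
have r0 : 0 < r by near: r; exact: nbhs_pinfty_gt.
exists (r^-1 *: x); last by rewrite scalerA divff ?gt_eqF// scale1r.
apply: pU; rewrite pZ gtr0_norm ?invr_gt0// ltr_pdivrMl// mulr1.
rewrite (le_lt_trans (Wb _ Wx))//.
by near: r; apply: nbhs_pinfty_gt; rewrite num_real.
Unshelve. all: by end_near. Qed.

(* Every scalarwise bounded family lies in a set of this form, which by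
   [weakly_bounded] is a bounded disk; norms in the space it spans are estimated by
   testing against functionals only. *)
Definition polar_set (b : {linear F -> R^o} -> R) : set F :=
  [set x | forall l : {linear F -> R^o}, continuous l -> `|l x| <= `|b l|].

Lemma polar_closed b : closed (polar_set b).
Proof.
have -> : polar_set b = \bigcap_(l in [set l : {linear F -> R^o} | continuous l])
    (l @^-1` [set y : R | `|y| <= `|b l|]).
  by apply/seteqP; split=> x /= H l ?; exact: H.
apply: closed_bigI => l lc.
apply: (@closed_comp F R^o l) => [x _|]; first exact: lc.
rewrite (_ : [set y | _] = Num.norm @^-1` [set y : R | y <= `|b l|])//.
apply: closed_comp; last exact: closed_le.
by move=> x _; exact: norm_continuous.
Qed.

Lemma polar_absolutely_convex b : absolutely_convex (polar_set b).
Proof.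
split; first by exists 0 => l _; rewrite linear0 normr0.
move=> r s x y rs Bx By l lc; rewrite linearP linearZ/= (le_trans (ler_normD _ _))//.
rewrite !normrM (@le_trans _ _ ((`|r| + `|s|) * `|b l|))//.
  by rewrite mulrDl lerD// ler_wpM2l// ?Bx ?By.
by rewrite -[leRHS]mul1r ler_wpM2r.
Qed.

Lemma polar_bounded b : tvs_bounded (polar_set b).
Proof. by apply: weakly_bounded => l lc; exists `|b l| => x; exact. Qed.

Definition polar_disk b : disk F :=
  Disk (@polar_closed b) (@polar_absolutely_convex b) (@polar_bounded b).

End WeaklyBounded.

(** * Smooth curves through fast converging sequences *)

Lemma is_deriveP (R : numFieldType) (V W : normedModType R) (f : V -> W) (x v : V) (d : W) :
  is_derive x v f d <->
  h^-1 *: (f (x + h *: v) - f x) @[h --> (0 : R)^'] --> d.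
Proof.
have -> : (fun h : R => h^-1 *: (f (x + h *: v) - f x)) =
    (fun h => h^-1 *: ((f \o shift x) (h *: v) - f x)).
  by apply/funext => h /=; rewrite (addrC x).
split=> [[fd <-]|fd]; first exact: fd.
by split; [apply/cvg_ex; exists d|apply/cvg_lim => //; exact: norm_hausdorff].
Qed.

Lemma is_derive_curve (R : realType) (X : normedModType R) (c : R -> X) (d : X) (t : R) :
  is_derive t 1 c d -> h^-1 *: (c (t + h) - c t) @[h --> (0 : R)^'] --> d.
Proof.
move=> /is_deriveP; set u := (X in X @ _ --> _ -> _).
have -> // : u = fun h => h^-1 *: (c (t + h) - c t).
by apply/funext => h; rewrite /u [h%:A]mulr1.
Qed.

Lemma near0_norm (R : realFieldType) (P : R -> Prop) (e : R) : 0 < e ->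
  (forall h, `|h| < e -> P h) -> \forall h \near (0 : R), P h.
Proof.
move=> e0 eP; apply/nbhs_ballP; exists e => //= h.
by rewrite /ball/= sub0r normrN; exact: eP.
Qed.

(** Quadratic remainders are what is at hand wherever a derivative is checked directly: at 0 for
    flat functions and for the special curve, and for curves lifted to a disk space. *)
Lemma is_derive_quadratic (R : realFieldType) (V W : normedModType R) (f : V -> W)
    (x v : V) (d : W) (C : R) :
  (\forall h \near (0 : R), `|f (x + h *: v) - f x - h *: d| <= C * h ^+ 2) ->
  is_derive x v f d.
Proof.
move=> fC; apply/is_deriveP/cvgrPdist_lt => e e0.
have C0 : 0 < `|C| + 1 by rewrite ltr_wpDl.
near=> h.
have h0 : h != 0 by near: h; exact: nbhs_dnbhs_neq.
rewrite distrC -[X in _ - X]scale1r -(mulVf h0) -scalerA -scalerBr normrZ normfV.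
rewrite ltr_pdivrMl ?normr_gt0// (@le_lt_trans _ _ (C * h ^+ 2))//.
  by near: h; exact: nbhs_dnbhs.
rewrite -real_normK ?num_real// expr2 mulrCA ltr_pM2l ?normr_gt0//.
rewrite (@le_lt_trans _ _ ((`|C| + 1) * `|h|))//.
  by rewrite ler_wpM2r// (le_trans (ler_norm C))// lerDl.
rewrite -ltr_pdivlMl//; near: h; apply: nbhs_dnbhs.
by apply: (@near0_norm _ _ ((`|C| + 1)^-1 * e)); rewrite ?mulr_gt0 ?invr_gt0.
Unshelve. all: by end_near. Qed.

(** * Smooth bump functions *)

Section FlatFunction.
Context {R : realType}.

(* [flat p] extends [t |-> p(1/t) e^(-1/t)] by zero; the family of these functions
   is closed under differentiation. *)
Definition flat (p : {poly R}) (t : R) : R :=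
  if 0 < t then p.[t^-1] * expR (- t^-1) else 0.

(** With s = 1/t one has ds/dt = -s^2, so p(s) e^-s has the derivative s^2 (p - p')(s) e^-s. *)
Definition flat_deriv (p : {poly R}) : {poly R} := 'X^2 * (p - p^`()).

Lemma flat_le0 p t : t <= 0 -> flat p t = 0.
Proof. by rewrite /flat ltNge => ->. Qed.

Lemma horner_bound (p : {poly R}) :
  exists C, 0 <= C /\ forall s, 1 <= s -> `|p.[s]| <= C * s ^+ size p.
Proof.
exists (\sum_(i < size p) `|p`_i|); split; first by apply: sumr_ge0.
move=> s s1; rewrite horner_coef (le_trans (ler_norm_sum _ _ _))// mulr_suml.
apply: ler_sum => i _; rewrite normrM ler_wpM2l// ger0_norm; last first.
  by rewrite exprn_ge0// (le_trans _ s1).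
by rewrite ler_weXn2l// ltnW.
Qed.

(** The exponential series gives e^s >= s^(n+1) / (n+1)! with n + 1 two above the exponent that
    bounds p; the two spare powers of s = 1/t become t^2. This is the estimate that makes the
    derivative at 0 vanish. *)
Lemma flat_quadratic p : exists C, forall t, t < 1 -> `|flat p t| <= C * t ^+ 2.
Proof.
have [C [C0 pC]] := horner_bound p.
exists (C * (size p).+2`!%:R) => t t1.
rewrite /flat; case: ifPn => t0; last by rewrite normr0 mulr_ge0 ?sqr_ge0// mulr_ge0.
have s1 : 1 <= t^-1 by rewrite invf_ge1// ltW.
have s0 : 0 < t^-1 by rewrite invr_gt0.
rewrite normrM (ger0_norm (expR_ge0 _)) expRN.
rewrite ler_pdivrMr ?expR_gt0// (le_trans (pC _ s1))// -!mulrA ler_wpM2l//.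
have := expR_ge1Dxn (size p).+1 (ltW s0).
set n := (size p).+1; set e := expR _ => H.
have {}H : t^-1 ^+ n.+1 <= n.+1`!%:R * e.
  rewrite mulrC -ler_pdivrMr ?ltr0n ?fact_gt0//; apply: le_trans H.
  by rewrite lerDr.
have -> : t^-1 ^+ size p = t ^+ 2 * t^-1 ^+ n.+1.
  by rewrite /n !exprS expr0 mulr1; field; rewrite gt_eqF.
by rewrite (mulrA t) -expr2 [leRHS]mulrCA ler_wpM2l ?sqr_ge0.
Qed.

Lemma flat_is_derive p (t : R) : is_derive t (1 : R) (flat p) (flat (flat_deriv p) t).
Proof.
have [t0|t0|->] := ltgtP t 0.
- rewrite (flat_le0 _ (ltW t0)); apply: near_eq_is_derive (is_derive_cst 0 t 1).
  by near=> y; rewrite flat_le0// ltW//; near: y; exact: lt_nbhsl.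
- have tn0 : t != 0 by rewrite gt_eqF.
  rewrite /flat t0.
  apply: (@near_eq_is_derive _ _ _ (fun y : R => (fun s => p.[s] * expR (- s)) (y^-1))).
    by near=> y; rewrite ifT//; near: y; exact: lt_nbhsr.
  have dV : is_derive t 1 (fun y : R => y^-1) (- t ^- 2 *: 1).
    exact: (@is_deriveV _ id).
  have dP : is_derive t^-1 1 (horner p * (expR \o -%R)) (p.[t^-1] *: (expR (- t^-1) * -1) + expR (- t^-1) *: p^`().[t^-1]).
    apply: is_deriveM.
  apply: (is_derive_eq (is_derive1_comp dP dV)).
  rewrite /flat_deriv hornerM hornerXn hornerD hornerN /GRing.scale/= exprVn; ring.
- rewrite flat_le0//; have [C pC] := flat_quadratic p.
  apply: (is_derive_quadratic (C := C)); apply: (near0_norm ltr01) => h h1.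
  rewrite (flat_le0 _ (lexx 0)) subr0 scaler0 subr0 add0r.
  by rewrite (_ : h *: (1 : R) = h) ?pC ?(le_lt_trans (ler_norm h))// /GRing.scale/= mulr1.
Unshelve. all: by end_near. Qed.


(** A sum over a list, because the product rule turns one product into two; the sign coming from the
    reflected argument 1 - t is absorbed by the second polynomial. *)
Definition bump (L : seq ({poly R} * {poly R})) (t : R) : R :=
  \sum_(u <- L) flat u.1 t * flat u.2 (1 - t).

Definition bump_deriv (L : seq ({poly R} * {poly R})) :=
  flatten [seq [:: (flat_deriv u.1, u.2); (u.1, - flat_deriv u.2)] | u <- L].

Lemma flatN p t : flat (- p) t = - flat p t.
Proof. by rewrite /flat; case: ifP; rewrite ?oppr0// hornerN mulNr. Qed.

Lemma bump_is_derive L (t : R) : is_derive t (1 : R) (bump L) (bump (bump_deriv L) t).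
Proof.
elim: L => [|[p q] L ih].
  have -> : bump [::] = cst 0 by apply/funext => s; rewrite /bump big_nil.
  exact: is_derive_cst.
have -> : bump ((p, q) :: L) = flat p * (flat q \o (fun s => 1 - s)) + bump L.
  by apply/funext => s; rewrite /bump big_cons.
have d1 : is_derive t (1 : R) (fun s : R => 1 - s) (0 - 1).
  exact: (is_deriveB (is_derive_cst (1 : R) t (1 : R)) (is_derive_id t (1 : R))).
have dM := is_deriveM (flat_is_derive p t)
  (is_derive1_comp (g := fun s : R => 1 - s) (flat_is_derive q (1 - t)) d1).
apply: (is_derive_eq (is_deriveD dM ih)).
rewrite /bump /bump_deriv/= !big_cons/= flatN /GRing.scale/=.
by rewrite addrA; congr (_ + _); ring.
Qed.

Lemma bump_eq0 L t : t <= 0 \/ 1 <= t -> bump L t = 0.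
Proof.
move=> t01; rewrite /bump big1// => u _.
case: t01 => [t0|t1]; first by rewrite flat_le0// mul0r.
by rewrite [X in _ * X]flat_le0 ?mulr0// subr_le0.
Qed.

Lemma bump_bounded L : exists C, forall t, `|bump L t| <= C.
Proof.
have cL : {within `[0, 1], continuous (bump L)}.
  apply: continuous_subspaceT => t; apply: differentiable_continuous.
  by apply/derivable1_diffP; have [] := bump_is_derive L t.
have [M [_ HM]] := compact_bounded (continuous_compact cL (@segment_compact R 0 1)).
exists (`|M| + 1) => t; have M1 : M < `|M| + 1.
  by rewrite (le_lt_trans (ler_norm M))// ltrDl.
have [t01|] := boolP (t \in `[0, 1]); first by apply: HM => //; exists t.
rewrite in_itv/= negb_and -!ltNge => /orP[/ltW|/ltW] H.
  by rewrite bump_eq0 ?normr0//; left.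
by rewrite bump_eq0 ?normr0//; right.
Qed.

Lemma exists_bump : exists b : nat -> R -> R,
  [/\ forall k (t : R), is_derive t (1 : R) (b k) (b k.+1 t),
      forall k t, t <= 0 \/ 1 <= t -> b k t = 0,
      forall k, exists C, forall t, `|b k t| <= C & 0 < b 0%N (1 / 2)].
Proof.
exists (fun k => bump (iter k bump_deriv [:: (1, 1)])); split.
- by move=> k t; rewrite iterS; exact: bump_is_derive.
- by move=> k t; exact: bump_eq0.
- by move=> k; exact: bump_bounded.
- rewrite /bump big_seq1/= /flat subr_gt0 !ifT ?hornerC ?mul1r ?mulr_gt0 ?expR_gt0//; lra.
Qed.

End FlatFunction.

(** * A smooth curve through a fast converging sequence *)

Section SpecialCurve.
Context {R : realType} {X : normedModType R} (a : nat -> X) (b : nat -> R -> R).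
Hypothesis b_der : forall k (t : R), is_derive t (1 : R) (b k) (b k.+1 t).
Hypothesis b_supp : forall k t, t <= 0 \/ 1 <= t -> b k t = 0.
Hypothesis b_bound : forall k, exists C, forall t, `|b k t| <= C.
Hypothesis a_fast : forall n, `|a n| <= 2 ^- (n * n).

(** The k-th derivative of the n-th bump, squeezed into [2^-n, 2^(1-n)]. Each differentiation costs
    a factor 2^n, which the decay 2^-(n n) of [a] outweighs. *)
Definition special_term k n (t : R) : X := (2 ^+ n) ^+ k *: (b k (2 ^+ n * t - 1) *: a n).

Lemma special_term_eq0 k n t : 2 ^+ n * t <= 1 \/ 2 <= 2 ^+ n * t ->
  special_term k n t = 0.
Proof.
by move=> H; rewrite /special_term b_supp ?scale0r ?scaler0//; case: H; [left|right]; lra.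
Qed.

Lemma special_term_is_derive k n (t : R) :
  is_derive t (1 : R) (special_term k n) (special_term k.+1 n t).
Proof.
have d1 : is_derive t (1 : R) (fun s : R => 2 ^+ n * s - 1) (2 ^+ n *: (1 : R) - 0).
  exact: (is_deriveB (is_deriveZ (2 ^+ n) (is_derive_id t (1 : R))) (is_derive_cst (1 : R) t (1 : R))).
have dB := is_derive1_comp (g := fun s : R => 2 ^+ n * s - 1) (b_der k (2 ^+ n * t - 1)) d1.
have H : is_derive t (1 : R) (fun s => b k (2 ^+ n * s - 1) *: a n)
    ((b k.+1 (2 ^+ n * t - 1) * (2 ^+ n *: (1 : R) - 0)) *: a n).
  apply/is_deriveP; have /is_deriveP := dB.
  set u := (X in X @ _ --> _ -> _) => /(@cvgZr_tmp _ _ _ _ _ _ _ (a n)); apply: cvg_trans.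
  apply: near_eq_cvg; near=> h; rewrite /u /=.
  by rewrite -scalerBl scalerA.
apply: (is_derive_eq (is_deriveZ _ H)).
rewrite /special_term subr0 [(2 ^+ n)%:A](_ : _ = 2 ^+ n); last exact: mulr1.
by rewrite !scalerA; congr (_ *: _); rewrite exprSr; ring.
Unshelve. all: by end_near. Qed.

Lemma special_sum_stable k (t : R) N N' : (N <= N')%N ->
  (forall n, (N <= n)%N -> special_term k n t = 0) ->
  \sum_(0 <= n < N') special_term k n t = \sum_(0 <= n < N) special_term k n t.
Proof.
move=> NN' H; rewrite (big_cat_nat (leq0n N) NN')//= [X in _ + X]big_nat_cond.
by rewrite [X in _ + X]big1 ?addr0// => n /andP[/andP[/H]].
Qed.

(** At t > 0 the terms with n > 2/t vanish, because 2^n > n; at t <= 0 all of them vanish. By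
    [special_curveE] the precise cutoff is immaterial. *)
Definition special_curve k (t : R) : X :=
  \sum_(0 <= n < (Num.truncn (2 / t)).+1) special_term k n t.

Lemma special_curveE k (t : R) N :
  (forall n, (N <= n)%N -> special_term k n t = 0) ->
  special_curve k t = \sum_(0 <= n < N) special_term k n t.
Proof.
move=> H; rewrite /special_curve; set M := _.+1.
have HM n : (M <= n)%N -> special_term k n t = 0.
  move=> Mn; apply: special_term_eq0.
  have [t0|t0] := lerP t 0.
    by left; rewrite (le_trans (mulr_ge0_le0 _ t0))// exprn_ge0.
  right; rewrite -ler_pdivrMr// (le_trans (ltW (truncnS_gt _)))//.
  by rewrite (@le_trans _ _ n%:R) ?ler_nat// -natrX ler_nat ltnW// ltn_expl.
have [MN|/ltnW NM] := leqP M N; first by rewrite (special_sum_stable MN).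
by rewrite (special_sum_stable NM).
Qed.

Lemma special_curve_le0 k (t : R) : t <= 0 -> special_curve k t = 0.
Proof.
move=> t0; rewrite (@special_curveE _ _ 0%N) ?big_nil// => n _.
by apply: special_term_eq0; left; rewrite (le_trans (mulr_ge0_le0 _ t0))// exprn_ge0.
Qed.

(** From n (k+1) <= (k+1)^2 + n^2 the n-th term is at most 2^((k+1)^2) 2^-n. *)
Lemma special_sum_bound k : exists A, forall N,
  \sum_(0 <= n < N) (2 ^+ n) ^+ k * `|a n| <= A.
Proof.
exists (2 ^+ (k.+1 * k.+1) * 2) => N.
suff H : \sum_(0 <= n < N) (2 ^+ n) ^+ k * `|a n| <=
    2 ^+ (k.+1 * k.+1) * (2 - 2 * 2 ^- N).
  by rewrite (le_trans H)// ler_wpM2l ?exprn_ge0// gerBl mulr_ge0// invr_ge0 exprn_ge0.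
elim: N => [|N ih]; first by rewrite big_nil expr0 invr1 mulr1 subrr mulr0.
rewrite big_nat_recr//= (le_trans (lerD ih (ler_wpM2l _ (a_fast N)))) ?exprn_ge0//.
rewrite -exprM.
have H : (N * k + N <= k.+1 * k.+1 + N * N)%N by nia.
have {}H : 2 ^+ (N * k) * 2 ^- (N * N) <= 2 ^+ (k.+1 * k.+1) * 2 ^- N :> R.
  rewrite ler_pdivrMr ?exprn_gt0// mulrAC ler_pdivlMr ?exprn_gt0//.
  by rewrite -!exprD ler_eXn2l// ltr1n.
rewrite (le_trans (lerD (lexx _) H))// -mulrDr ler_wpM2l ?exprn_ge0//.
by rewrite exprS invfM; lra.
Qed.

Lemma special_curve_is_derive k (t : R) :
  is_derive t (1 : R) (special_curve k) (special_curve k.+1 t).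
Proof.
have [t0|t0|->] := ltgtP t 0.
- rewrite special_curve_le0 ?ltW//; apply: near_eq_is_derive (is_derive_cst 0 t 1).
  by near=> y; rewrite special_curve_le0// ltW//; near: y; exact: lt_nbhsl.
(* The cutoff 4/t serves all s > t/2, so that near t the curve is a fixed finite sum. *)
- have tz n s : t / 2 < s -> ((Num.truncn (4 / t)).+1 <= n)%N ->
      forall k, special_term k n s = 0.
    move=> ts Mn k'; apply: special_term_eq0; right.
    rewrite -ler_pdivrMr; last by rewrite (lt_trans _ ts)// divr_gt0.
    rewrite (@le_trans _ _ (4 / t))//.
      rewrite (_ : 4 / t = 2 / (t / 2)); last by field; rewrite gt_eqF.
      by rewrite ler_wpM2l// lef_pV2 ?posrE ?ltW// ?(lt_trans _ ts)// divr_gt0.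
    rewrite (le_trans (ltW (truncnS_gt _)))//.
    by rewrite (@le_trans _ _ n%:R) ?ler_nat// -natrX ler_nat ltnW// ltn_expl.
  rewrite (@special_curveE _ _ (Num.truncn (4 / t)).+1); last first.
    by move=> n Nn; apply: tz => //; rewrite ltr_pdivrMr// ltr_pMr// ltr1n.
  apply: (@near_eq_is_derive _ _ _ (fun s => \sum_(0 <= n < (Num.truncn (4 / t)).+1)
      special_term k n s)).
    near=> s; rewrite -special_curveE// => n Nn; apply: tz => //.
    by near: s; apply: lt_nbhsr; rewrite ltr_pdivrMr// ltr_pMr// ltr1n.
  elim: (_.+1) => [|N ih].
    rewrite big_nil (_ : (fun _ => _) = cst 0); first exact: is_derive_cst.
    by apply/funext => s; rewrite big_nil.
  rewrite big_nat_recr//= (_ : (fun _ => _) = (fun s => \sum_(0 <= n < N) special_term k n s) + special_term k N).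
    by apply: is_deriveD => //; exact: special_term_is_derive.
  by apply/funext => s; rewrite big_nat_recr.
- rewrite special_curve_le0//; have [C bC] := b_bound k.
  have C0 : 0 <= C by rewrite (le_trans _ (bC 0)).
  have [A HA] := special_sum_bound k.+2.
  apply: (is_derive_quadratic (C := C * A)); apply: (near0_norm ltr01) => h h1.
  rewrite (@special_curve_le0 _ 0)// subr0 scaler0 subr0 add0r [h%:A]mulr1.
  have A0 : 0 <= A by have := HA 0%N; rewrite big_nil.
  have [h0|h0] := lerP h 0.
    by rewrite special_curve_le0// normr0 mulr_ge0 ?sqr_ge0// mulr_ge0.
  rewrite /special_curve (le_trans (ler_norm_sum _ _ _))//.
  apply: le_trans (ler_wpM2r (sqr_ge0 h) (ler_wpM2l C0 (HA (Num.truncn (2 / h)).+1))).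
  rewrite mulr_sumr mulr_suml; apply: ler_sum => n _.
  (* A nonzero term has 2^n h > 1, so the factor (2^n h)^2 can be inserted: it yields h^2 at the
     price of two more powers of 2^n. *)
  have [H|H] := lerP (2 ^+ n * h) 1.
    rewrite (special_term_eq0 _ (or_introl H)) normr0.
    by rewrite mulr_ge0 ?sqr_ge0// mulr_ge0.
  rewrite /special_term !normrZ ger0_norm ?exprn_ge0//.
  rewrite (@le_trans _ _ ((2 ^+ n) ^+ k * (C * `|a n|)))//.
    by rewrite ler_wpM2l ?exprn_ge0// ler_wpM2r.
  have -> : C * ((2 ^+ n) ^+ k.+2 * `|a n|) * h ^+ 2 =
    ((2 ^+ n) ^+ k * (C * `|a n|)) * ((2 ^+ n * h) ^+ 2).
    by rewrite !exprSr !expr0; ring.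
  by rewrite ler_peMr ?mulr_ge0 ?exprn_ge0// exprn_ege1// ltW.
Unshelve. all: by end_near. Qed.

(** At t = 3/2 2^-n one has 2^m t <= 3/4 for m < n and 2^m t >= 3 for m > n, so only the n-th bump
    is active, at its argument 1/2. *)
Lemma special_curve_point n : special_curve 0 (3 / 2 * 2 ^- n) = b 0%N (1 / 2) *: a n.
Proof.
have z m : m != n -> special_term 0 m (3 / 2 * 2 ^- n) = 0.
  rewrite neq_ltn => mn; apply: special_term_eq0; case/orP: mn => mn; [left|right].
    rewrite mulrCA -ler_pdivlMl ?divr_gt0// ler_pdivrMr ?exprn_gt0//.
    rewrite -(subnK mn) exprD exprS; set e := 2 ^+ m.
    have : 1 <= 2 ^+ (n - m.+1) :> R by rewrite exprn_ege1// ler1n.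
    have : 0 < e by rewrite exprn_gt0.
    nra.
  rewrite mulrCA -ler_pdivrMl ?divr_gt0// ler_pdivlMr ?exprn_gt0//.
  rewrite -(subnK mn) exprD exprS; set e := 2 ^+ n.
  have : 1 <= 2 ^+ (m - n.+1) :> R by rewrite exprn_ege1// ler1n.
  have : 0 < e by rewrite exprn_gt0.
  nra.
rewrite (@special_curveE _ _ n.+1); last by move=> m nm; apply: z; rewrite gtn_eqF.
rewrite big_nat_recr//= big_nat_cond big1 ?add0r.
  rewrite /special_term expr0 scale1r; congr (b _ _ *: _).
  by field; rewrite expf_neq0.
by move=> m /andP[/andP[_ mn] _]; apply: z; rewrite ltn_eqF.
Qed.

End SpecialCurve.

(** * Open sets in the space spanned by a disk *)

Section DiskSpaceTopology.
Context {R : realType} {E : convenientType R} (B : disk E).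

Lemma disk_inclD (x y : disk_space B) : disk_incl (x + y) = disk_incl x + disk_incl y.
Proof. by []. Qed.

Lemma disk_inclB (x y : disk_space B) : disk_incl (x - y) = disk_incl x - disk_incl y.
Proof. by []. Qed.

Lemma disk_inclZ (a : R) (x : disk_space B) : disk_incl (a *: x) = a *: disk_incl x.
Proof. by []. Qed.

Lemma disk_incl_continuous : continuous (@disk_incl R E B).
Proof.
move=> x N /= xN.
have H : nbhs (0 : E) [set y | N (disk_incl x + y)].
  have : disk_incl x + y @[y --> (0 : E)] --> disk_incl x + 0.
    apply: (@continuous2_cvg _ E E E _ _ _ _ (fun x y => x + y)).
    - by move=> A; exact: (@add_continuous E (disk_incl x, 0) A).
    - exact: cvg_cst.
    - exact: cvg_id.
  by rewrite addr0; exact.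
have [r [r0 Br]] : exists r : R, 0 < r /\ disk_set B `<=` *:%R r @` [set y | N (disk_incl x + y)].
  near (+oo : set_system R) => r; exists r; split=> //.
  near: r; exact: disk_bounded.
apply/nbhs_ballP; exists r^-1; first by rewrite /= invr_gt0.
move=> y; rewrite -ball_normE /= distrC => yx.
have [_ [b /Br[v Nv <-] yE]] :
    dilations B (disk_incl (y - x)) r^-1.
  by apply: minkowski_lt yx; exact: disk_space_dilations.
move: yE Nv; rewrite scalerA mulVf ?gt_eqF// scale1r disk_inclB => <-.
by rewrite /= addrC subrK.
Unshelve. all: by end_near. Qed.

(** Otherwise points [y n] outside [U] approach [x] like 2^-(n n), and a smooth curve that is at [x]
    at time 0 meets [y n] at time 3/2 2^-n, although it stays in [U] near 0. The radius carries the
    factor [b 0 (1/2)] because the curve only reaches x + b 0 (1/2) a_n. *)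
Lemma cinfty_open_disk (U : set E) : cinfty_open U -> open (@disk_incl R E B @^-1` U).
Proof.
move=> Uo; rewrite openE => x Ux; rewrite /interior; apply: contrapT => nU.
have [b [bder bsupp bbound b0]] := @exists_bump R.
have /choice[y yP] : forall n : nat, exists y : disk_space B,
    `|y - x| <= b 0%N (1 / 2) * 2 ^- (n * n) /\ ~ U (disk_incl y).
  move=> n; apply: contrapT => H; apply: nU; apply/nbhs_ballP.
  exists (b 0%N (1 / 2) * 2 ^- (n * n)).
    by rewrite /= mulr_gt0// invr_gt0 exprn_gt0.
  move=> z; rewrite -ball_normE /= distrC => zx; apply: contrapT => nUz.
  by apply: H; exists z; split=> //; exact: ltW.
pose a n := (b 0%N (1 / 2))^-1 *: (y n - x).
have afast n : `|a n| <= 2 ^- (n * n).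
  by rewrite normrZ gtr0_norm ?invr_gt0// ler_pdivrMl//; case: (yP n).
pose D k t : disk_space B := if k is 0%N then x + special_curve a b k t else special_curve a b k t.
have Dd k (t : R) : is_derive t (1 : R) (D k) (D k.+1 t).
  have H := special_curve_is_derive bder bsupp bbound afast.
  case: k => [|k]; last exact: H.
  by apply: (is_derive_eq (is_deriveD (is_derive_cst x t (1 : R)) (H 0%N t))); rewrite add0r.
have cs : smooth_curve (fun t => disk_incl (D 0%N t)).
  exists (fun k t => disk_incl (D k t)) => // k t.
  have /= H := is_derive_curve (Dd k t).
  exact: (cvg_comp _ _ H (@disk_incl_continuous (D k.+1 t))).
have D0 : D 0%N 0 = x by rewrite /D (special_curve_le0 _ bsupp) ?addr0.
have U0 : U (disk_incl (D 0%N 0)) by rewrite D0.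
have /nbhs_ballP[e /= e0 eU] := open_nbhs_nbhs (conj (Uo _ cs) U0).
have [n en] : exists n : nat, 3 / 2 * 2 ^- n < e.
  have H : 3 / 2 * 2 ^- n @[n --> \oo] --> (0 : R).
    rewrite -(mulr0 (3 / 2)); apply: cvgMr; under eq_fun do rewrite -exprVn.
    by apply: cvg_expr; rewrite normfV ger0_norm// invf_lt1//; lra.
  have : \forall n \near \oo, 3 / 2 * 2 ^- n < e by exact: (cvgr_lt 0).
  by move=> /filter_ex.
have [_] := yP n; apply.
have -> : y n = x + special_curve a b 0 (3 / 2 * 2 ^- n).
  by rewrite (special_curve_point a bsupp) /a scalerA divff ?gt_eqF// scale1r addrC subrK.
apply: eU.
rewrite /ball/= sub0r normrN ger0_norm// mulr_ge0 ?divr_ge0// invr_ge0 exprn_ge0//.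
Qed.

End DiskSpaceTopology.

(** * Higher derivatives as functions of lists of directions *)

Lemma cvg_prod_ord (R : realType) (T : Type) (F : set_system T) {FF : Filter F} (I : Type)
    (r : seq I) (f : I -> T -> R) (l : I -> R) :
  (forall i, f i x @[x --> F] --> l i) ->
  \prod_(i <- r) f i x @[x --> F] --> \prod_(i <- r) l i.
Proof.
move=> fl; elim: r => [|i r ih].
  rewrite big_nil; under eq_fun do rewrite big_nil.
  exact: cvg_cst.
by rewrite big_cons; under eq_fun do rewrite big_cons; exact: cvgM.
Qed.

Lemma cvg_sum_ord (R : realType) (T : Type) (F : set_system T) {FF : Filter F} (I : Type)
    (r : seq I) (f : I -> T -> R) (l : I -> R) :
  (forall i, f i x @[x --> F] --> l i) ->
  \sum_(i <- r) f i x @[x --> F] --> \sum_(i <- r) l i.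
Proof.
move=> fl; elim: r => [|i r ih].
  rewrite big_nil; under eq_fun do rewrite big_nil.
  exact: cvg_cst.
by rewrite big_cons; under eq_fun do rewrite big_cons; exact: cvgD.
Qed.

Section MultilinearCalculus.
Context {R : realType} {X : normedModType R}.

Section Hybrid.
Variables (m : nat) (A : mform X m).

(** The stations of a telescoping sum from [u] (j = 0) to [v] (j = m): neighbors differ in one
    argument. *)
Definition hybrid (u v : 'I_m -> X) (j : nat) : 'I_m -> X :=
  fun i => if (i < j)%N then v i else u i.

Lemma mform_replaceB (w : 'I_m -> X) i (x y : X) :
  A (replace_arg w i x) - A (replace_arg w i y) = A (replace_arg w i (x - y)).
Proof.
have := mform_linear A w i (-1) y x; rewrite scaleN1r [- y + x]addrC => ->.
by rewrite mulN1r addrC.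
Qed.

Lemma mform_replaceZ (w : 'I_m -> X) i (a : R) (x : X) :
  A (replace_arg w i (a *: x)) = a * A (replace_arg w i x).
Proof.
have := mform_linear A w i (-1) 0 0; rewrite scaler0 addr0 mulN1r addNr => A0.
by have := mform_linear A w i a x 0; rewrite addr0 => ->; rewrite A0 addr0.
Qed.

Lemma mform_telescope (u v : 'I_m -> X) :
  A u - A v = \sum_(j < m) A (replace_arg (hybrid u v j) j (u j - v j)).
Proof.
have -> : u = hybrid u v 0 by apply/funext.
have {2}-> : v = hybrid u v m by apply/funext => i; rewrite /hybrid ltn_ord.
rewrite -opprB -(telescope_sumr (fun j => A (hybrid u v j)))// -sumrN big_mkord.
apply: eq_bigr => j _; rewrite opprB -mform_replaceB; congr (A _ - A _).
  apply/funext => i; rewrite /replace_arg /hybrid; case: eqP => // ->.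
  by rewrite ltnn.
apply/funext => i; rewrite /replace_arg /hybrid ltnS leq_eqVlt.
by case: (eqVneq i j) => [->|]; rewrite ?eqxx// => /negPf; rewrite -val_eqE/= => ->.
Qed.

Lemma mform_cvg0 (T : Type) (F : set_system T) {FF : Filter F} (v : T -> 'I_m -> X)
    (l : 'I_m -> X) (j : 'I_m) :
  (forall i, v t i @[t --> F] --> l i) -> l j = 0 ->
  A (v t) @[t --> F] --> (0 : R).
Proof.
move=> vl lj; apply/norm_cvg0P.
apply: (@squeeze_cvgr _ _ _ _ (cst 0) (fun t => mform_norm A * \prod_i `|v t i|)).
- by near=> t; rewrite normr_ge0 mform_le.
- exact: cvg_cst.
- rewrite -(mulr0 (mform_norm A)); apply: cvgMr.
  rewrite [X in _ --> X](_ : 0 = \prod_i `|l i|).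
    by apply: cvg_prod_ord => i; exact: cvg_norm.
  by rewrite (bigD1 j)//= lj normr0 mul0r.
Unshelve. all: by end_near. Qed.

End Hybrid.

Lemma mform_cvg (m : nat) (T : Type) (F : set_system T) {FF : Filter F}
    (A : T -> mform X m) (B : mform X m) (v : T -> 'I_m -> X) (w : 'I_m -> X) :
  A t @[t --> F] --> B -> (forall i, v t i @[t --> F] --> w i) ->
  (A t (v t) : R) @[t --> F] --> (B w : R).
Proof.
move=> AB vw.
have -> : (fun t => A t (v t)) = fun t => (A t - B) (v t) + (B w + (B (v t) - B w)).
  by apply/funext => t; rewrite [B w + _]addrC subrK -[(A t - B) (v t)]/(A t (v t) - B (v t)) subrK.
rewrite -[X in _ --> X]add0r; apply: cvgD.
  apply/norm_cvg0P.
  apply: (@squeeze_cvgr _ _ _ _ (cst 0) (fun t => `|A t - B| * \prod_i `|v t i|)).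
  - by near=> t; rewrite normr_ge0 mform_le.
  - exact: cvg_cst.
  - rewrite -(mul0r (\prod_i `|w i|)); apply: cvgM.
      by apply/norm_cvg0P; rewrite -(subrr B); apply: cvgB => //; exact: cvg_cst.
    by apply: cvg_prod_ord => i; exact: cvg_norm.
rewrite -[X in _ --> X]addr0; apply: cvgD; first exact: cvg_cst.
under eq_fun do rewrite mform_telescope.
suff : \sum_(j < m) (B (replace_arg (hybrid (v t) w j) j (v t j - w j)) : R) @[t --> F] -->
    \sum_(j < m) (0 : R) by rewrite [\sum_(j < m) 0]big1.
apply: cvg_sum_ord => j.
apply: (@mform_cvg0 _ _ _ _ _ _ (replace_arg w j 0) j); last by rewrite /replace_arg eqxx.
move=> i; rewrite /replace_arg /hybrid; case: eqP => [_|_].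
  by rewrite -(subrr (w j)); apply: cvgB => //; exact: cvg_cst.
by case: (_ < _)%N; [exact: cvg_cst|exact: vw].
Unshelve. all: by end_near. Qed.

(** The difference quotient is exactly the quotient of the form at the moved arguments plus, by
    telescoping, one quotient for each argument; joint continuity of evaluation gives the limits. *)
Lemma mform_curve_derive (m : nat) (A : R -> mform X m) (A' : mform X m)
    (a : R -> 'I_m -> X) (a' : 'I_m -> X) (t : R) :
  is_derive t (1 : R) A A' -> (forall i, is_derive t (1 : R) (a^~ i) (a' i)) ->
  is_derive t (1 : R) (fun s => A s (a s) : R)
    (A' (a t) + \sum_(i < m) A t (replace_arg (a t) i (a' i))).
Proof.
move=> dA da.
have ca i : a (t + h *: (1 : R)) i @[h --> (0 : R)^'] --> a t i.
  have /derivable1_diffP/differentiable_continuous c : derivable (a^~ i) t 1.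
    by have [] := da i.
  have : t + h *: (1 : R) @[h --> (0 : R)^'] --> t.
    rewrite -[X in _ --> X]addr0; apply: cvgD; first exact: cvg_cst.
    under eq_fun do rewrite [_%:A]mulr1.
    by apply: cvg_within_filter; exact: cvg_id.
  by move=> H; exact: (cvg_comp _ _ H c).
apply/is_deriveP.
have -> : (fun h : R => h^-1 *: ((A (t + h *: 1) (a (t + h *: 1)) : R) - A t (a t))) =
    (fun h : R => (h^-1 *: (A (t + h *: 1) - A t)) (a (t + h *: 1)) +
      \sum_(i < m) A t (replace_arg (hybrid (a (t + h *: 1)) (a t) i) i
        (h^-1 *: (a (t + h *: 1) i - a t i)))).
  apply/funext => h.
  have -> : \sum_(i < m) A t (replace_arg (hybrid (a (t + h *: 1)) (a t) i) i
        (h^-1 *: (a (t + h *: 1) i - a t i))) = h^-1 * (A t (a (t + h *: 1)) - A t (a t)).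
    by rewrite mform_telescope mulr_sumr; apply: eq_bigr => i _; rewrite mform_replaceZ.
  transitivity (h^-1 * (A (t + h *: 1) (a (t + h *: 1)) - A t (a (t + h *: 1))) +
      h^-1 * (A t (a (t + h *: 1)) - A t (a t)) : R); last by [].
  by rewrite -mulrDr addrA subrK.
apply: cvgD; first by apply: mform_cvg => //; exact/is_deriveP.
apply: cvg_sum_ord => i; apply: mform_cvg; first exact: cvg_cst.
move=> j; rewrite /replace_arg /hybrid; case: eqP => [_|_]; first exact/is_deriveP.
by case: (_ < _)%N; [exact: cvg_cst|exact: ca].
Qed.

End MultilinearCalculus.

(** * From directional to Frechet derivatives *)

Section DerivativeOnLists.
Context {R : realType} {X : normedModType R}.
Implicit Types (h : X -> R) (y w : X) (vs : seq X).

(** With lists in place of functions on ['I_k], one more derivative is a [cons], and the Faa di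
    Bruno terms become recursive on lists. *)
Definition fderiv_seq h y vs : R :=
  fderiv h (size vs) y (fun i => nth 0 vs i).

Lemma fderiv_seq0 h y : fderiv_seq h y [::] = h y.
Proof. exact: fderiv0E. Qed.

Lemma fderiv_seq_le h y vs :
  `|fderiv_seq h y vs| <= `|fderiv h (size vs) y| * \prod_(v <- vs) `|v|.
Proof.
rewrite (le_trans (mform_le _ _))// ler_wpM2l// ?mform_norm_ge0//.
by rewrite [leRHS](big_nth 0) big_mkord.
Qed.

Lemma fderiv_seq_cons h y w vs : differentiable (fderiv h (size vs)) y ->
  fderiv_seq h y (w :: vs) = 'd (fderiv h (size vs)) y w (fun i => nth 0 vs i).
Proof. by move=> dh; rewrite /fderiv_seq fderivSE. Qed.

Lemma fderiv_seq_is_derive h y w vs : differentiable (fderiv h (size vs)) y ->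
  is_derive y w (fderiv_seq h ^~ vs) (fderiv_seq h y (w :: vs)).
Proof.
move=> dh; rewrite fderiv_seq_cons//.
have /is_deriveP H : is_derive y w (fderiv h (size vs)) ('d (fderiv h (size vs)) y w).
  by split; [exact: diff_derivable|rewrite deriveE].
apply/is_deriveP.
exact: (mform_cvg H (fun i : 'I_(size vs) => cvg_cst (nth 0 vs i : X))).
Qed.

Lemma line_is_derive (W : normedModType R) (f : X -> W) y w (t : R) d :
  is_derive (y + t *: w) w f d <-> is_derive t (1 : R) (fun s => f (y + s *: w)) d.
Proof.
split=> /is_deriveP H; apply/is_deriveP; move: H.
  set u := (X in X @ _ --> _ -> _); set u' := (X in _ -> X @ _ --> _).
  have -> // : u' = u.
  by apply/funext => s; rewrite /u /u' [s%:A]mulr1 scalerDl addrA.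
set u := (X in X @ _ --> _ -> _); set u' := (X in _ -> X @ _ --> _).
have -> // : u' = u.
by apply/funext => s; rewrite /u /u' [s%:A]mulr1 scalerDl addrA.
Qed.

Lemma is_derive_unique (V W : normedModType R) (f : V -> W) (x v : V) d d' :
  is_derive x v f d -> is_derive x v f d' -> d = d'.
Proof. by move=> [_ <-] [_ <-]. Qed.

Section Mean.
(** [D] is an abstract system of iterated directional derivatives. It is instantiated by
    [fderiv_seq] of a smooth function, for mean value and Taylor estimates, and by the Faa di Bruno
    sum, for the smoothness of the composite. *)
Variables (O : set X) (D : X -> seq X -> R).
Hypothesis Dder : forall y w vs, O y -> is_derive y w (D^~ vs) (D y (w :: vs)).

Lemma line_mean_value y w vs :
  (forall t : R, 0 <= t <= 1 -> O (y + t *: w)) ->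
  exists2 t : R, 0 <= t <= 1 & D (y + w) vs - D y vs = D (y + t *: w) (w :: vs).
Proof.
move=> Oyw.
have d (t : R) : 0 <= t <= 1 ->
    is_derive t (1 : R) (fun s => D (y + s *: w) vs) (D (y + t *: w) (w :: vs)).
  by move=> /Oyw Oyt; apply/(@line_is_derive _ (D^~ vs) y w t _); exact: Dder.
have [||t t01] := @MVT_segment R (fun s => D (y + s *: w) vs)
    (fun t => D (y + t *: w) (w :: vs)) 0 1 ler01.
- move=> t; rewrite in_itv/= => /andP[t0 t1]; apply: d.
  by rewrite !ltW.
- apply: derivable_within_continuous => t; rewrite in_itv/= => t01.
  by have [] := d t t01.
rewrite scale1r scale0r addr0 subr0 mulr1 => ->.
by exists t; first by move: t01; rewrite in_itv.
Qed.

Hypothesis Oopen : open O.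
Hypothesis Dbounded : forall y k, O y -> exists d C : R, 0 < d /\
  forall z vs, `|z - y| < d -> size vs = k -> `|D z vs| <= C * \prod_(v <- vs) `|v|.

Lemma segment_ball (y z z' : X) (d t : R) : 0 <= t <= 1 ->
  `|z - y| < d -> `|z' - y| < d -> `|z + t *: (z' - z) - y| < d.
Proof.
move=> /andP[t0 t1] zd z'd.
have -> : z + t *: (z' - z) - y = (1 - t) *: (z - y) + t *: (z' - y).
  have -> : t *: (z' - z) = t *: (z' - y) - t *: (z - y).
    by rewrite -scalerBr opprB addrA subrK.
  by rewrite scalerBl scale1r addrAC [t *: _ - _]addrC addrA.
rewrite (le_lt_trans (ler_normD _ _))// !normrZ ger0_norm ?subr_ge0// ger0_norm//.
have [->|t1'] := eqVneq t 1; first by rewrite subrr mul0r add0r mul1r.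
have {}t1 : 0 < 1 - t by rewrite subr_gt0 lt_neqAle t1'.
have := ler_wpM2l t0 (ltW z'd); rewrite -(ltr_pM2l t1) in zd; lra.
Qed.

Lemma local_lipschitz y k : O y -> exists d C : R, [/\ 0 < d, 0 <= C,
  forall z, `|z - y| < d -> O z &
  forall z z' vs, `|z - y| < d -> `|z' - y| < d -> size vs = k ->
    `|D z' vs - D z vs| <= C * `|z' - z| * \prod_(v <- vs) `|v|].
Proof.
move=> Oy; have [d [C [d0 dC]]] := Dbounded k.+1 Oy.
have /nbhs_ballP[e /= e0 eO] : nbhs y O by exact: open_nbhs_nbhs.
have inO z : `|z - y| < Num.min d e -> O z.
  by rewrite lt_min => /andP[_ ze]; apply: eO; rewrite -ball_normE /= distrC.
exists (Num.min d e), `|C|; split=> //; first by rewrite lt_min d0 e0.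
move=> z z' vs zd z'd vsk.
have zO (t : R) : 0 <= t <= 1 -> O (z + t *: (z' - z)).
  by move=> t01; apply: inO; exact: segment_ball.
have [t t01 H] := line_mean_value vs zO; rewrite [X in D X _](_ : _ = z + (z' - z)); last first.
  by rewrite addrC subrK.
have zt : `|z + t *: (z' - z) - y| < d.
  by have := segment_ball t01 zd z'd; rewrite lt_min => /andP[].
have vsk' : size (z' - z :: vs) = k.+1 by rewrite /= vsk.
rewrite H (le_trans (dC _ _ zt vsk'))//.
by rewrite big_cons mulrA ler_wpM2r ?prodr_ge0// ler_wpM2r// ler_norm.
Qed.

(** The increment is [D] at an intermediate point in the direction z' - z; the Lipschitz bound for
    one more direction moves that point to z. *)
Lemma local_taylor y k : O y -> exists d C : R, [/\ 0 < d, 0 <= C,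
  forall z, `|z - y| < d -> O z &
  forall z z' vs, `|z - y| < d -> `|z' - y| < d -> size vs = k ->
    `|D z' vs - D z vs - D z (z' - z :: vs)| <= C * `|z' - z| ^+ 2 * \prod_(v <- vs) `|v|].
Proof.
move=> Oy; have [d [C [d0 C0 dO dC]]] := local_lipschitz k.+1 Oy.
exists d, C; split=> // z z' vs zd z'd vsk.
have zO (t : R) : 0 <= t <= 1 -> O (z + t *: (z' - z)).
  by move=> t01; apply: dO; exact: segment_ball.
have [t t01 H] := line_mean_value vs zO.
rewrite [X in D X _ - D z vs](_ : _ = z + (z' - z)); last by rewrite addrC subrK.
have vsk' : size (z' - z :: vs) = k.+1 by rewrite /= vsk.
rewrite H (le_trans (dC _ _ _ zd (segment_ball t01 zd z'd) vsk'))//.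
rewrite big_cons mulrA ler_wpM2r ?prodr_ge0// -mulrA ler_wpM2l//.
rewrite addrAC subrr add0r normrZ expr2 ler_wpM2r//.
case/andP: t01 => t0 t1; rewrite ger0_norm//.
by rewrite -[leRHS]mul1r ler_wpM2r.
Qed.

Lemma line_derivative_scale y w vs (a : R) : O y ->
  D y (a *: w :: vs) = a * D y (w :: vs).
Proof.
move=> Oy; apply: (@is_derive_unique _ _ (fun s : R => D (y + s *: (a *: w)) vs) 0 1).
  by apply/(@line_is_derive _ (D^~ vs) y (a *: w) 0 _); rewrite scale0r addr0; exact: Dder.
have H : is_derive (a * 0) (1 : R) (fun s => D (y + s *: w) vs) (D y (w :: vs)).
  by apply/(@line_is_derive _ (D^~ vs) y w _ _); rewrite mulr0 scale0r addr0; exact: Dder.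
have d1 : is_derive (0 : R) (1 : R) (fun s : R => a * s) (a *: (1 : R)).
  exact: (is_deriveZ a (is_derive_id (0 : R) (1 : R))).
have := is_derive1_comp (g := fun s : R => a * s) H d1; rewrite [a%:A]mulr1 mulrC.
by congr is_derive; apply/funext => s /=; rewrite scalerA mulrC.
Qed.

(* Differentiability in every direction with locally bounded second derivatives
   already forces the first derivative to be additive. *)
Lemma line_derivative_add y w w' vs : O y ->
  D y (w + w' :: vs) = D y (w :: vs) + D y (w' :: vs).
Proof.
move=> Oy; have [d [C [d0 C0 dO dC]]] := local_taylor (size vs) Oy.
have [e [C' [e0 C'0 _ eC]]] := local_lipschitz (size vs).+1 Oy.
set P := \prod_(v <- vs) `|v|.
have P0 : 0 <= P by exact: prodr_ge0.
pose L := D y (w + w' :: vs) - (D y (w :: vs) + D y (w' :: vs)).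
pose n := `|w| + `|w'| + 1.
have n0 : 0 < n by rewrite ltr_wpDl// addr_ge0.
(* Reaching y + t(w + w') directly and by way of y + t w costs three Taylor remainders C t^2 n^2 P,
   and moving the base point of the direction w' costs C' t^2 n^2 P. Division by t leaves c t. *)
pose c := (3 * C + C') * n ^+ 2 * P.
suff H : \forall t \near (0 : R)^'+, `|L| <= c * t.
  apply/eqP; rewrite -subr_eq0 -/L -normr_le0.
  have ct : c * t @[t --> (0 : R)^'+] --> (0 : R).
    rewrite -[X in _ --> X](mulr0 c).
    by apply: cvg_at_right_filter; apply: cvgMr; exact: cvg_id.
  exact: (cvgr_to_ge ct H).
near=> t.
have t0 : 0 < t by near: t; exact: nbhs_right_gt.
have tde : t * n < Num.min d e.
  rewrite -ltr_pdivlMr//; near: t; apply: nbhs_right_lt.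
  by rewrite divr_gt0// lt_min d0.
have small u : `|u| <= n -> `|y + t *: u - y| < d /\ `|y + t *: u - y| < e.
  move=> un; apply/andP; rewrite -lt_min addrAC subrr add0r normrZ gtr0_norm//.
  by rewrite (le_lt_trans _ tde)// ler_wpM2l// ltW.
have yy : `|y - y| < d by rewrite subrr normr0.
have yye : `|y - y| < e by rewrite subrr normr0.
have wn : `|w| <= n by rewrite /n -addrA lerDl addr_ge0.
have w'n : `|w'| <= n by rewrite /n addrAC lerDr addr_ge0.
have wwn : `|w + w'| <= n by rewrite (le_trans (ler_normD _ _))// lerDl.
have [wd we] := small w wn; have [wwd _] := small _ wwn.
have := dC _ _ vs yy wwd erefl.
have := dC _ _ vs yy wd erefl.
have := dC _ _ vs wd wwd erefl.
have := eC _ _ (w' :: vs) yye we erefl.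
have yE u : y + t *: u - y = t *: u by rewrite addrAC subrr add0r.
have -> : y + t *: (w + w') - (y + t *: w) = t *: w'.
  by rewrite scalerDr opprD addrACA subrr add0r addrAC subrr add0r.
rewrite !yE !line_derivative_scale//; last exact: dO.
rewrite !normrZ (gtr0_norm t0) big_cons -/P !exprMn.
have sq (u : X) : `|u| <= n -> C * (t ^+ 2 * `|u| ^+ 2) * P <= C * (t ^+ 2 * n ^+ 2) * P.
  move=> un; apply: ler_wpM2r => //; apply: ler_wpM2l => //; apply: ler_wpM2l.
    by rewrite exprn_ge0// ltW.
  by apply: lerXn2r; rewrite ?nnegrE// ltW.
have ww : C' * (t * `|w|) * (`|w'| * P) <= C' * (t * n) * (n * P).
  apply: ler_pM; first by rewrite !mulr_ge0// ltW.
  - by rewrite mulr_ge0.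
  - by apply: ler_wpM2l => //; apply: ler_wpM2l => //; exact: ltW.
  - exact: ler_wpM2r.
move=> H1 /le_trans/(_ (sq _ w'n)) H2 /le_trans/(_ (sq _ wn)) H3 /le_trans/(_ (sq _ wwn)) H4.
have {ww}H1 := le_trans H1 ww.
rewrite -(ler_pM2l t0) -{1}(gtr0_norm t0) -normrM.
have -> : c * t = C' * n * n * P * t + 3 * (C * t * n ^+ 2 * P) by rewrite /c expr2; ring.
have {}H1 : t * `|D (y + t *: w) (w' :: vs) - D y (w' :: vs)| <= t * (C' * (t * n) * (n * P)).
  by rewrite ler_wpM2l// ltW.
rewrite -{1}(gtr0_norm t0) -normrM in H1.
set h1 := (X in `|t * X|) in H1; set h2 := (X in `|X|) in H2.
set h3 := (X in `|X|) in H3; set h4 := (X in `|X|) in H4.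
have -> : t * L = (h2 + h3) + (t * h1 - h4) by rewrite /L /h1 /h2 /h3 /h4; ring.
have := ler_normD (h2 + h3) (t * h1 - h4); have := ler_normD h2 h3.
have := ler_normB (t * h1) h4; nra.
Unshelve. all: by end_near. Qed.
(** For a later slot, the identity for the shorter list holds on the whole open set [O] and can be
    differentiated in the direction [p]. *)
Lemma line_derivative_linear y (pre post : seq X) (a : R) w w' : O y ->
  D y (pre ++ (a *: w + w') :: post) = a * D y (pre ++ w :: post) + D y (pre ++ w' :: post).
Proof.
elim: pre y => [|p pre ih] y Oy /=.
  by rewrite line_derivative_add// line_derivative_scale.
apply: (@is_derive_unique _ _ (D^~ (pre ++ (a *: w + w') :: post)) y p).
  exact: Dder.
apply: (@near_eq_is_derive _ _ _ ((a \*: (D^~ (pre ++ w :: post) : X -> R)) + D^~ (pre ++ w' :: post))).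
  have : \forall z \near y, O z by exact: open_nbhs_nbhs.
  by apply: filterS => z Oz; rewrite ih.
exact: (is_deriveD (is_deriveZ a (Dder p _ Oy)) (Dder p _ Oy)).
Qed.

Definition args_seq k (v : 'I_k -> X) : seq X := [seq v i | i <- enum 'I_k].

Lemma size_args_seq k (v : 'I_k -> X) : size (args_seq v) = k.
Proof. by rewrite size_map size_enum_ord. Qed.

Lemma args_seqS k (v : 'I_k.+1 -> X) :
  args_seq v = v ord0 :: args_seq (fun i => v (lift ord0 i)).
Proof. by rewrite /args_seq enum_ordSl/= -map_comp. Qed.

Lemma args_seq_nth vs : args_seq (fun i : 'I_(size vs) => nth 0 vs i) = vs.
Proof.
rewrite /args_seq (map_comp (nth 0 vs) val) val_enum_ord.
exact: mkseq_nth.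
Qed.

Lemma line_form_multilinear k y : O y -> multilinear (fun v : 'I_k -> X => D y (args_seq v)).
Proof.
move=> Oy v i a u u'.
have [pre [post [ipre ipost E]]] : exists pre post : seq 'I_k,
    [/\ i \notin pre, i \notin post & enum 'I_k = pre ++ i :: post].
  have := enum_uniq 'I_k; case/splitPr: (mem_enum 'I_k i) => pre post.
  rewrite cat_uniq/= => /and3P[_ /norP[ipre _] /andP[ipost _]].
  by exists pre, post.
have rE z : args_seq (replace_arg v i z) = map v pre ++ z :: map v post.
  rewrite /args_seq E map_cat/= /replace_arg eqxx; congr (_ ++ _ :: _).
    by apply/eq_in_map => j jpre; case: eqP => // ji; rewrite ji (negbTE ipre) in jpre.
  by apply/eq_in_map => j jpost; case: eqP => // ji; rewrite ji (negbTE ipost) in jpost.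
by rewrite !rE line_derivative_linear.
Qed.

Lemma line_form_bounded k y : O y -> bounded_form (fun v : 'I_k -> X => D y (args_seq v)).
Proof.
move=> Oy; have [d [C [d0 dC]]] := Dbounded k Oy; exists C => v.
rewrite (le_trans (dC y _ _ (size_args_seq v))) ?subrr ?normr0//.
by rewrite big_map big_enum.
Qed.

Definition line_form k y : mform X k := to_mform (fun v => D y (args_seq v)).

Lemma line_formE k y v : O y -> line_form k y v = D y (args_seq v).
Proof.
by move=> Oy; rewrite /line_form to_mformE//; [exact: line_form_multilinear|exact: line_form_bounded].
Qed.

Lemma mform_norm_le k (A : mform X k) C : 0 <= C ->
  (forall v, `|A v| <= C * \prod_i `|v i|) -> `|A| <= C.
Proof.
move=> C0 hA; apply: mform_norm_lub => v v1; rewrite (le_trans (hA v))//.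
rewrite -[leRHS]mulr1 ler_wpM2l//.
by apply: prodr_ile1 => i _; rewrite normr_ge0 v1.
Qed.

(** Stated for every [g] that agrees with [line_form] on [O], so that the induction in
    [fderiv_line_form] can apply it to [fderiv h k] itself. The constant of [local_taylor] is
    uniform in the list, hence the remainder is quadratic in the norm of forms. *)
Lemma line_form_diff k (g : X -> mform X k) y :
  (forall z, O z -> g z = line_form k z) -> O y ->
  differentiable g y /\ forall w v, 'd g y w v = D y (w :: args_seq v).
Proof.
move=> gE Oy.
have ml w : multilinear (fun v : 'I_k -> X => D y (w :: args_seq v)).
  move=> v i a u u'; pose w' : 'I_k.+1 -> X := fun j => oapp v w (unlift ord0 j).
  have := line_form_multilinear Oy w' (lift ord0 i) a u u'.
  have rE z : args_seq (replace_arg w' (lift ord0 i) z) = w :: args_seq (replace_arg v i z).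
    rewrite args_seqS; congr (_ :: _).
      by rewrite /replace_arg /w' unlift_none.
    congr (args_seq _); apply/funext => j.
    by rewrite /replace_arg /w' liftK (inj_eq lift_inj).
  by rewrite !rE.
have [d1 [C1 [d10 d1C]]] := Dbounded k.+1 Oy.
have bw w v : `|D y (w :: args_seq v)| <= `|C1| * `|w| * \prod_(i < k) `|v i|.
  have s1 : size (w :: args_seq v) = k.+1 by rewrite /= size_args_seq.
  rewrite (le_trans (d1C y _ _ s1)) ?subrr ?normr0//.
  rewrite big_cons big_map big_enum/= mulrA ler_wpM2r ?prodr_ge0// ler_wpM2r//.
  exact: ler_norm.
have bf w : bounded_form (fun v : 'I_k -> X => D y (w :: args_seq v)).
  by exists (`|C1| * `|w|) => v; exact: bw.
pose L w : mform X k := to_mform (fun v => D y (w :: args_seq v)).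
have LE w v : L w v = D y (w :: args_seq v) by rewrite /L to_mformE.
have Llin : linear L.
  move=> a u u'; apply/val_inj/funext => v.
  rewrite -[LHS]/(L _ v) -[RHS]/(a * L u v + L u' v) !LE.
  exact: (line_derivative_linear [::]).
pose Ll := HB.pack L (GRing.isLinear.Build R X (mform X k) _ L Llin) : {linear X -> mform X k}.
have Lc : continuous Ll.
  apply/linear_bounded_continuous/linear_boundedP.
  near=> r => w; apply: mform_norm_le => [|v]; first by rewrite mulr_ge0.
  rewrite -[Ll w v]/(L w v) LE (le_trans (bw _ _))// ler_wpM2r ?prodr_ge0// ler_wpM2r//.
have dL : g \o shift y = cst (g y) + Ll +o_ 0 id.
  have [d [C [d0 C0 dO dC]]] := local_taylor k Oy.
  apply/eqaddoP => e e0.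
  have C'0 : 0 < C + 1 by rewrite ltr_wpDl.
  have : \forall w \near (0 : X), `|w| < d /\ `|w| < e / (C + 1).
    apply/nbhs_ballP; exists (Num.min d (e / (C + 1))).
      by rewrite /= lt_min d0 divr_gt0.
    by move=> w; rewrite -ball_normE /= sub0r normrN lt_min => /andP[].
  apply: filterS => w [wd we].
  apply: mform_norm_le => [|v]; first by rewrite mulr_ge0// ltW.
  have wy : `|w + y - y| < d by rewrite addrK.
  have yy : `|y - y| < d by rewrite subrr normr0.
  have := dC _ _ (args_seq v) yy wy (size_args_seq v).
  rewrite addrK -!line_formE//; last exact: dO.
  rewrite -!gE//; last exact: dO.
  rewrite -[X in `|X| <= _ -> _]/(g (w + y) v - g y v - D y (w :: args_seq v)).
  rewrite -LE big_map big_enum /= => H.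
  rewrite [X in `|X|](_ : _ = g (w + y) v - g y v - L w v); last first.
    rewrite -[LHS]/(g (w + y) v - (g y v + L w v)).
    by rewrite opprD addrA.
  rewrite (le_trans H)// ler_wpM2r ?prodr_ge0// expr2 mulrA ler_wpM2r//.
  rewrite (@le_trans _ _ ((C + 1) * `|w|))//; first by rewrite ler_wpM2r// lerDl.
  by rewrite -ler_pdivlMl// mulrC ltW.
have dE : 'd g y = Ll :> (X -> mform X k) by rewrite (diff_unique Lc dL).
split; last by move=> w v; rewrite dE -[Ll w v]/(L w v) LE.
by apply/diff_locallyP; rewrite dE.
Unshelve. all: by end_near. Qed.

Lemma fderiv_line_form h k y : (forall z, O z -> h z = D z [::]) -> O y ->
  fderiv h k y = line_form k y.
Proof.
move=> hD; elim: k y => [|k ih] y Oy; apply/val_inj/funext => v.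
  rewrite -[LHS]/(fderiv h 0 y v) fderiv0E -[RHS]/(line_form 0 y v) line_formE// hD//.
  by congr (D y); apply/esym/size0nil; exact: size_args_seq.
have [dl dlE] := line_form_diff ih Oy.
rewrite -[LHS]/(fderiv h k.+1 y v) -[RHS]/(line_form k.+1 y v) line_formE// args_seqS.
by rewrite fderivSE// dlE.
Qed.

Lemma smooth_of_line_derivatives h : (forall z, O z -> h z = D z [::]) -> smooth_on O h.
Proof.
by move=> hD k y Oy; have [] := line_form_diff (@fderiv_line_form h k ^~ hD) Oy.
Qed.

Lemma fderiv_seq_of_line_derivatives h y vs :
  (forall z, O z -> h z = D z [::]) -> O y -> fderiv_seq h y vs = D y vs.
Proof.
by move=> hD Oy; rewrite /fderiv_seq (fderiv_line_form _ hD)// line_formE// args_seq_nth.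
Qed.

End Mean.

End DerivativeOnLists.

(** * Compact convex hulls *)

Section Mazur.
Context {R : realType}.

Lemma closure_normP (V : normedModType R) (A : set V) (x : V) :
  closure A x <-> forall e : R, 0 < e -> exists2 a, A a & `|x - a| < e.
Proof.
split=> [Ax e e0|H B /nbhs_ballP[e /= e0 eB]].
  have [a [Aa]] := Ax _ (nbhsx_ballx x e e0).
  by rewrite -ball_normE /= => ?; exists a.
have [a Aa xa] := H e e0; exists a; split=> //; apply: eB.
by rewrite -ball_normE.
Qed.

Lemma compact_totally_bounded (V : normedModType R) (A : set V) (e : R) : 0 < e ->
  compact A -> exists s : seq V, forall a, A a -> exists2 c, c \in s & `|a - c| < e.
Proof.
move=> e0; rewrite compact_cover => /(_ V A (ball ^~ e)).
case=> [c _|a Aa|D _ AD]; first exact: ball_open.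
  by exists a => //; exact: ballxx.
exists (enum_fset D) => a /AD[c /= cD]; rewrite -ball_normE /= distrC => ac.
by exists c.
Qed.

Lemma ultra_seq_union (T : Type) (F : set_system T) (I : eqType) (s : seq I) (B : I -> set T) :
  UltraFilter F -> F [set x | exists2 i, i \in s & B i x] -> exists2 i, i \in s & F (B i).
Proof.
move=> UF; elim: s => [|i s ih] Fs.
  by have [x [j]] := filter_ex Fs.
have [FB|FnB] := in_ultra_setVsetC (B i) UF; first by exists i => //; rewrite mem_head.
have [|j js Fj] := ih; last by exists j => //; rewrite in_cons js orbT.
apply: filterS (filterI Fs FnB) => x [[j]]; rewrite in_cons => /orP[/eqP ->//|js] Bj _.
by exists j.
Qed.

(** An ultrafilter containing [A] contains one of the finitely many small balls covering [A], for
    every radius; so it is Cauchy. *)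
Lemma totally_bounded_compact (V : completeNormedModType R) (A : set V) : closed A ->
  (forall e : R, 0 < e -> exists s : seq V, forall a, A a -> exists2 c, c \in s & `|a - c| < e) ->
  compact A.
Proof.
move=> cA tA; rewrite compact_ultra => F UF FA.
have : cvg F.
  apply: cauchy_cvg; apply: cauchy_exP => e e0; have [s sA] := tA e e0.
  have [|c _ Fc] := @ultra_seq_union _ F _ s (fun c => [set a | `|a - c| < e]) UF.
    by apply: filterS FA => a /sA[c cs ac]; exists c.
  by exists c; apply: filterS Fc => a; rewrite -ball_normE /= distrC.
move=> /cvg_ex[l Fl]; exists l; split=> //.
by apply: (@closed_cvg _ _ F _ id A cA) => //; exact: FA.
Qed.

Let convexP (V : lmodType R) (A : set V) := forall x y (t : R), 0 <= t -> t <= 1 ->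
  A x -> A y -> A (t *: x + (1 - t) *: y).

(** Adding a vertex [b] replaces [C] by the join of [b] and [C], a continuous image of [0, 1] x
    [C]. *)
Lemma finite_hull (V : normedModType R) (a : V) (s : seq V) : exists C : set V,
  [/\ compact C, convexP C, C a & forall x, x \in s -> C x].
Proof.
elim: s => [|b s [C [Cc Cconv Ca Cs]]].
  exists [set a]; split=> //; first exact: compact_set1.
  by move=> _ _ t _ _ -> ->; rewrite -scalerDl addrC subrK scale1r.
pose f (u : R * V) : V := u.1 *: b + (1 - u.1) *: u.2.
exists (f @` (`[0, 1]%classic `*` C)); split.
- apply: continuous_compact; last exact: compact_setX (@segment_compact R 0 1) Cc.
  apply: continuous_subspaceT => u; apply: cvgD; apply: cvgZ.
  + exact: cvg_fst.
  + exact: cvg_cst.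
  + by apply: cvgB; [exact: cvg_cst|exact: cvg_fst].
  + exact: cvg_snd.
- move=> _ _ t t0 t1 [[p x] /= [p01 Cx] <-] [[q y] /= [q01 Cy] <-].
  rewrite /= !in_itv/= in p01 q01; case/andP: p01 => p0 p1; case/andP: q01 => q0 q1.
  pose T := t * p + (1 - t) * q.
  have T0 : 0 <= T by rewrite /T; nra.
  have TE : 1 - T = t * (1 - p) + (1 - t) * (1 - q) by rewrite /T; ring.
  have u0 : 0 <= t * (1 - p) by nra.
  have v0 : 0 <= (1 - t) * (1 - q) by nra.
  (* The weight 1 - T that is left by [b] is divided between x and y; if it vanishes, so do both
     shares, and any point of [C] serves. *)
  have [z Cz zE] : exists2 z, C z &
      (1 - T) *: z = (t * (1 - p)) *: x + ((1 - t) * (1 - q)) *: y.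
    have [H|H] := eqVneq (1 - T) 0.
      exists x => //; rewrite H scale0r.
      have -> : t * (1 - p) = 0 by lra.
      have -> : (1 - t) * (1 - q) = 0 by lra.
      by rewrite !scale0r addr0.
    exists ((t * (1 - p) / (1 - T)) *: x + (1 - (t * (1 - p) / (1 - T))) *: y).
      have T1 : 0 < 1 - T by rewrite lt_neqAle eq_sym H TE addr_ge0.
      apply: Cconv => //; first by rewrite divr_ge0// ltW.
      by rewrite ler_pdivrMr// mul1r TE lerDl.
    rewrite scalerDr !scalerA mulrC divfK//; congr (_ + _ *: _).
    by rewrite mulrBr mulr1 [_ * (_ / _)]mulrC divfK// TE; ring.
  exists (T, z); first split=> //=.
    by rewrite /= in_itv/= T0/= -subr_ge0 TE addr_ge0.
  rewrite /f/= zE !scalerDr !scalerA addrACA -scalerDl.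
  by congr (_ + _).
- by exists (0, a); rewrite /f/= ?scale0r ?add0r ?subr0 ?scale1r//; split=> //=; rewrite in_itv/= lexx ler01.
- move=> x; rewrite in_cons => /orP[/eqP ->|/Cs Cx].
    exists (1, a); rewrite /f/= ?subrr ?scale0r ?addr0 ?scale1r//.
    by split=> //=; rewrite in_itv/= lexx ler01.
  by exists (0, x); rewrite /f/= ?scale0r ?add0r ?subr0 ?scale1r//; split=> //=; rewrite in_itv/= lexx ler01.
Qed.

Lemma convex_thickening (V : normedModType R) (C : set V) (e : R) : convexP C ->
  convexP [set x | exists2 c, C c & `|x - c| < e].
Proof.
move=> cC x y t t0 t1 [c Cc xc] [d Cd yd].
exists (t *: c + (1 - t) *: d); first exact: cC.
rewrite opprD addrACA -!scalerBr (le_lt_trans (ler_normD _ _))// !normrZ.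
rewrite !ger0_norm ?subr_ge0//.
have [->|t1'] := eqVneq t 1; first by rewrite subrr mul0r addr0 mul1r.
have {}t1 : 0 < 1 - t by rewrite subr_gt0 lt_neqAle t1'.
have := ler_wpM2l t0 (ltW xc); rewrite -(ltr_pM2l t1) in yd; lra.
Qed.

(** An (e/3)-net of [A] has a compact convex hull [C], and the hull of [A] lies in the convex
    (e/3)-thickening of [C]; an (e/3)-net of [C] and the closure account for the other thirds. The
    clause on balls serves to keep the hull inside an open set that need not be convex. *)
Lemma mazur_compact (V : completeNormedModType R) (A : set V) : compact A ->
  exists K : set V, [/\ compact K, convex_set K, A `<=` K &
    forall (y : V) r, (forall a, A a -> `|a - y| <= r) -> forall x, K x -> `|x - y| <= r].
Proof.
move=> cA.
(* The hull as an intersection: its points are used by choosing the convex set [C], first a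
   thickening and later a ball. *)
pose H : set V := [set x | forall C, convexP C -> A `<=` C -> C x].
have AH : A `<=` H by move=> a Aa C _ sAC; exact: sAC.
have Hconv : convexP H.
  by move=> x y t t0 t1 Hx Hy C cC sAC; exact: cC t0 t1 (Hx C cC sAC) (Hy C cC sAC).
exists (closure H); split.
- apply: totally_bounded_compact; first exact: closed_closure.
  move=> e e0; have e30 : 0 < e / 3 by rewrite divr_gt0.
  have [s As] := compact_totally_bounded e30 cA.
  have [C [Cc Cconv _ Cs]] := finite_hull 0 s.
  have [s' Cs'] := compact_totally_bounded e30 Cc.
  exists s' => x /closure_normP/(_ _ e30)[z Hz xz].
  have [|c Cc' zc] := Hz _ (@convex_thickening _ C (e / 3) Cconv).
    by move=> a /As[c cs ac]; exists c => //; exact: Cs.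
  have [c' c's' cc'] := Cs' _ Cc'; exists c' => //.
  rewrite (_ : e = e / 3 + (e / 3 + e / 3)); last by field.
  rewrite (le_lt_trans (ler_distD z _ _))// ltrD//.
  by rewrite (le_lt_trans (ler_distD c _ _))// ltrD.
- apply/convex_setP => x y t t0 t1 /closure_normP Hx /closure_normP Hy.
  apply/closure_normP => e e0.
  exact: (convex_thickening Hconv t0 t1 (Hx e e0) (Hy e e0)).
- by move=> a /AH; exact: subset_closure.
- move=> y r Ar x /closure_normP Hx; apply/ler_addgt0Pr => e e0.
  have [z Hz xz] := Hx e e0.
  have : `|z - y| <= r.
    apply: (Hz [set z | `|z - y| <= r]) => // u v t t0 t1 /= ur vr.
    have -> : t *: u + (1 - t) *: v - y = t *: (u - y) + (1 - t) *: (v - y).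
      by rewrite !scalerBr addrACA -opprD -scalerDl addrC [t + _]addrC subrK scale1r addrC.
    rewrite (le_trans (ler_normD _ _))// !normrZ !ger0_norm ?subr_ge0//.
    have := ler_wpM2l t0 ur; have := ler_wpM2l (_ : 0 <= 1 - t) vr.
    by rewrite subr_ge0 => /(_ t1); lra.
  move=> zy; rewrite (le_trans (ler_distD z _ _))// addrC lerD// ltW//.
Qed.

End Mazur.

(** * The terms of the Faa di Bruno formula *)

Section SetPartitions.
Context {T : choiceType}.
Implicit Types (w : T) (vs : seq T) (P Q : seq (seq T)).

(** One more direction falling on one of the inner derivatives: [w] joins an existing block. *)
Fixpoint insertions w P : seq (seq (seq T)) :=
  if P is b :: P' then ((w :: b) :: P') :: [seq b :: Q | Q <- insertions w P'] else [::].

(* The set partitions of the list of positions of [vs], with the blocks listed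
   by values: the terms of the Faa di Bruno formula. *)
Fixpoint partitions vs : seq (seq (seq T)) :=
  if vs is w :: vs' then
    flatten [seq ([:: w] :: P) :: insertions w P | P <- partitions vs']
  else [:: [::]].

Lemma partitions_ind (p : seq T -> seq (seq T) -> Prop) :
  p [::] [::] ->
  (forall w vs P, p vs P -> p (w :: vs) ([:: w] :: P)) ->
  (forall w vs P Q, p vs P -> Q \in insertions w P -> p (w :: vs) Q) ->
  forall vs P, P \in partitions vs -> p vs P.
Proof.
move=> p0 pnew pins; elim=> [|w vs ih] P /=; first by rewrite inE => /eqP ->.
move=> /flatten_mapP[Q /ih pQ]; rewrite inE => /orP[/eqP ->|]; first exact: pnew.
exact: pins.
Qed.

Lemma sum_partitions_cons (R : nmodType) (f : seq (seq T) -> R) w vs :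
  \sum_(P <- partitions (w :: vs)) f P =
  \sum_(P <- partitions vs) (f ([:: w] :: P) + \sum_(Q <- insertions w P) f Q).
Proof.
rewrite /= big_flatten/= big_map; apply: eq_bigr => P _.
by rewrite big_cons.
Qed.

Lemma insertions_size w P Q : Q \in insertions w P -> size Q = size P.
Proof.
elim: P Q => [|b P ih] Q //=; rewrite inE => /orP[/eqP -> //|/mapP[Q' /ih <- ->]//].
Qed.

Lemma insertions_prod (R : comPzRingType) (f : T -> R) w P Q : Q \in insertions w P ->
  \prod_(b <- Q) \prod_(v <- b) f v = f w * \prod_(b <- P) \prod_(v <- b) f v.
Proof.
elim: P Q => [|b P ih] Q //=; rewrite inE => /orP[/eqP ->|/mapP[Q' /ih H ->]].
  by rewrite !big_cons mulrA.
by rewrite !big_cons H mulrCA.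
Qed.

Lemma partitions_prod (R : comPzRingType) (f : T -> R) vs P : P \in partitions vs ->
  \prod_(b <- P) \prod_(v <- b) f v = \prod_(v <- vs) f v.
Proof.
apply: (partitions_ind (p := fun vs P =>
    \prod_(b <- P) \prod_(v <- b) f v = \prod_(v <- vs) f v)) => {vs P}.
- by rewrite !big_nil.
- by move=> w vs P H; rewrite !big_cons big_nil H mulr1.
- by move=> w vs P Q H /(insertions_prod f) ->; rewrite H big_cons.
Qed.

Lemma partitions_sumn vs P : P \in partitions vs -> sumn (map size P) = size vs.
Proof.
apply: (partitions_ind (p := fun vs P => sumn (map size P) = size vs)) => {vs P} //.
  by move=> w vs P /= ->.
move=> w vs P Q /= <-; elim: P Q => [|b P ih] Q //=.
by rewrite inE => /orP[/eqP -> //|/mapP[Q' /ih H ->]] /=; rewrite H addnS.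
Qed.

Lemma partitions_size vs P : P \in partitions vs -> (size P <= size vs)%N.
Proof.
apply: (partitions_ind (p := fun vs P => (size P <= size vs)%N)) => {vs P} //.
by move=> w vs P Q H /insertions_size ->; rewrite ltnW.
Qed.

Lemma partitions_block_size vs P b : P \in partitions vs -> b \in P ->
  (size b <= size vs)%N.
Proof.
move=> /partitions_sumn <-; elim: P => [//|c P ih]; rewrite inE /= => /orP[/eqP ->|/ih].
  exact: leq_addr.
by move=> H; rewrite (leq_trans H)// leq_addl.
Qed.

(** Enlarging the block b multiplies the product of factorials by |b| + 1, and these factors add up
    to the total size plus the number of blocks. *)
Lemma insertions_fact (R : pzSemiRingType) w P :
  \sum_(Q <- insertions w P) (\prod_(b <- Q) (size b)`!)%:R =
  ((\prod_(b <- P) (size b)`!) * (sumn (map size P) + size P))%:R :> R.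
Proof.
rewrite -natr_sum; congr (_%:R); elim: P => [|b P ih] /=; first by rewrite !big_nil muln0.
rewrite !big_cons big_map /=.
have -> : (\sum_(Q <- insertions w P) \prod_(c <- b :: Q) (size c)`! =
    (size b)`! * \sum_(Q <- insertions w P) \prod_(c <- Q) (size c)`!)%N.
  by rewrite big_distrr; apply: eq_bigr => Q _; rewrite big_cons.
by rewrite ih factS; nia.
Qed.

End SetPartitions.

(** * Sums over partitions with log-convex weights *)

Section WeightedPartitions.
Context {R : realFieldType} {T : choiceType} (M r : nat -> R).
Hypothesis M_gt0 : forall k, 0 < M k.
Hypothesis Mconvex : forall k, M k.+1 ^+ 2 <= M k * M k.+2.
Implicit Types (w : T) (vs : seq T) (P Q : seq (seq T)).

(** The quotients M_(k+1) / M_k are nondecreasing; stated without division. *)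
Lemma logconvex_ratio j k : (j <= k)%N -> M j.+1 * M k <= M j * M k.+1.
Proof.
elim: k => [|k ih]; first by rewrite leqn0 => /eqP ->; rewrite mulrC.
rewrite leq_eqVlt => /orP[/eqP ->|]; first by rewrite mulrC.
rewrite ltnS => /ih H.
rewrite -(ler_pM2r (M_gt0 k)) mulrAC.
rewrite (le_trans (ler_wpM2r (ltW (M_gt0 k.+1)) H))//.
have := ler_wpM2l (ltW (M_gt0 j)) (Mconvex k); rewrite expr2; lra.
Qed.

Lemma insertions_weight k w P Q : (forall b, b \in P -> (size b <= k)%N) ->
  Q \in insertions w P ->
  (\prod_(b <- Q) M (size b)) * M k <= (\prod_(b <- P) M (size b)) * M k.+1.
Proof.
elim: P Q => [//|b P ih] Q Pk; rewrite inE => /orP[/eqP ->|/mapP[Q' Q'P ->]].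
  rewrite !big_cons/= mulrAC [leRHS]mulrAC ler_wpM2r ?prodr_ge0//.
    by move=> c _; exact: ltW.
  by apply: logconvex_ratio; apply: Pk; rewrite mem_head.
rewrite !big_cons -!mulrA; apply: ler_wpM2l; first exact: ltW.
apply: ih => // c cP.
by apply: Pk; rewrite inE cP orbT.
Qed.

(** Add the elements one at a time. A new block multiplies the left side by M_1 M_(j+1) / M_j, an
    insertion by M_(a+1) / M_a, where j and a are at most the current size k; both quotients are at
    most M_(k+1) / M_k. *)
Lemma partitions_weight vs P : P \in partitions vs ->
  M (size P) * \prod_(b <- P) M (size b) <= M 1%N ^+ size P * M (size vs).
Proof.
have M_ge0 k : 0 <= M k by exact: ltW.
have prod_ge0 (S : seq (seq T)) : 0 <= \prod_(b <- S) M (size b) by exact: prodr_ge0.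
elim: vs P => [|w vs ih] P.
  by rewrite inE => /eqP ->; rewrite big_nil mulr1 mul1r.
move=> /flatten_mapP[Q Qvs]; have {}ih := ih _ Qvs.
rewrite inE -(ler_pM2r (M_gt0 (size vs))) => /orP[/eqP ->|PQ].
  rewrite big_cons/= exprS.
  have H := logconvex_ratio (partitions_size Qvs).
  have := ler_wpM2r (mulr_ge0 (M_ge0 1%N) (prod_ge0 Q)) H.
  have := ler_wpM2r (mulr_ge0 (M_ge0 1%N) (M_ge0 (size vs).+1)) ih.
  by move: (\prod_(_ <- _) _) => p; lra.
rewrite (insertions_size PQ) -mulrA.
rewrite (le_trans (ler_wpM2l (M_ge0 _) (insertions_weight _ PQ)))//.
  by move=> b bQ; exact: partitions_block_size bQ.
by rewrite mulrA [leRHS]mulrAC ler_wpM2r.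
Qed.

(** A partition of k elements into j blocks has extensions of total weight (j+1) x + k + j relative
    to its own, and this is at most (k+1)(x+2) since j <= k. *)
Lemma partitions_fact (x : R) vs : 0 <= x ->
  \sum_(P <- partitions vs) (size P)`!%:R * x ^+ size P * (\prod_(b <- P) (size b)`!)%:R <=
  (size vs)`!%:R * (x + 2) ^+ size vs.
Proof.
move=> x0; elim: vs => [|w vs ih]; first by rewrite big_seq1 big_nil !mulr1.
rewrite sum_partitions_cons/=.
have x2 : 0 <= (size vs).+1%:R * (x + 2) by rewrite mulr_ge0// addr_ge0.
rewrite factS natrM exprS.
rewrite (_ : _ * _ = ((size vs).+1%:R * (x + 2)) * ((size vs)`!%:R * (x + 2) ^+ size vs)); last by ring.
rewrite (le_trans _ (ler_wpM2l x2 ih))// mulr_sumr big_seq [leRHS]big_seq.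
apply: ler_sum => P Pvs.
rewrite big_cons (_ : (size [:: w])`! = 1)%N// mul1n.
have -> : \sum_(Q <- insertions w P) (size Q)`!%:R * x ^+ size Q * (\prod_(b <- Q) (size b)`!)%:R =
    (size P)`!%:R * x ^+ size P * ((\prod_(b <- P) (size b)`!) * (sumn (map size P) + size P))%:R.
  rewrite -(@insertions_fact _ _ w) mulr_sumr big_seq [RHS]big_seq; apply: eq_bigr => Q QP.
  by rewrite (insertions_size QP).
rewrite (partitions_sumn Pvs) factS exprS !natrM natrD.
have sP : (size P)%:R <= (size vs)%:R :> R by rewrite ler_nat partitions_size.
set p := (_)`!%:R; set q := (\prod_(_ <- _) _)%:R; set y := x ^+ _.
have W0 : 0 <= p * y * q by rewrite !mulr_ge0// exprn_ge0.
have -> : (size P).+1%:R * p * (x * y) * q + p * y * (q * ((size vs)%:R + (size P)%:R)) =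
  ((size P).+1%:R * x + (size vs)%:R + (size P)%:R) * (p * y * q) by ring.
rewrite ler_wpM2r// mulrDr -addrA lerD//; first by rewrite ler_wpM2r// ler_nat ltnS partitions_size.
by rewrite -natr1; lra.
Qed.

Hypothesis r_gt0 : forall k, 0 < r k.
Hypothesis r0 : r 0%N = 1.
Hypothesis rM : forall j k, r (j + k)%N <= r j * r k.

Lemma submultiplicative_partition P :
  r (sumn (map size P)) <= \prod_(b <- P) r (size b).
Proof.
elim: P => [|b P ih] /=; first by rewrite r0 big_nil.
by rewrite big_cons (le_trans (rM _ _))// ler_wpM2l// ltW.
Qed.

(** The factor M_1^j of [partitions_weight] joins s^j, and submultiplicativity bounds the product of
    the 1/r over the blocks by 1/r of the total size. *)
Lemma partitions_sum_bound (s : R) vs : 0 <= s ->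
  \sum_(P <- partitions vs) ((size P)`!%:R * s ^+ size P * M (size P)) *
     \prod_(b <- P) ((size b)`!%:R * M (size b) / r (size b)) <=
  (size vs)`!%:R * (s * M 1%N + 2) ^+ size vs * (M (size vs) / r (size vs)).
Proof.
move=> s0; have sM0 : 0 <= s * M 1%N by rewrite mulr_ge0// ltW.
have c0 : 0 <= M (size vs) / r (size vs) by rewrite divr_ge0// ltW.
rewrite (le_trans _ (ler_wpM2r c0 (partitions_fact vs sM0)))//.
rewrite mulr_suml big_seq [leRHS]big_seq; apply: ler_sum => P Pvs.
rewrite big_split big_split/= -natr_prod.
rewrite exprMn.
set f := (size P)`!%:R; set q := (\prod_(_ <- _) _)%:R.
have -> : f * s ^+ size P * M (size P) * (q * \prod_(b <- P) M (size b) * \prod_(b <- P) (r (size b))^-1) =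
  (f * s ^+ size P * q) * ((M (size P) * \prod_(b <- P) M (size b)) * \prod_(b <- P) (r (size b))^-1) by ring.
have -> : f * (s ^+ size P * M 1%N ^+ size P) * q * (M (size vs) / r (size vs)) =
  (f * s ^+ size P * q) * ((M 1%N ^+ size P * M (size vs)) * (r (size vs))^-1) by ring.
rewrite ler_wpM2l//; first by rewrite !mulr_ge0// exprn_ge0.
apply: ler_pM.
- by rewrite mulr_ge0 ?prodr_ge0// => *; rewrite ltW.
- by apply: prodr_ge0 => *; rewrite invr_ge0 ltW.
- exact: partitions_weight.
- rewrite prodfV lef_pV2 ?posrE//; last by apply: prodr_gt0.
  by rewrite -(partitions_sumn Pvs); exact: submultiplicative_partition.
Qed.

End WeightedPartitions.

(** * Derivatives of vector-valued maps *)

Lemma seq_eventually_bounded (R : realType) (u : nat -> R) (C : R) :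
  (\forall n \near \oo, u n <= C) -> exists D, forall n, u n <= D.
Proof.
move=> [N _ uC]; exists (C + \sum_(i < N) `|u i| + `|C|) => n.
have [nN|Nn] := ltnP n N.
  rewrite (le_trans (ler_norm _))// (@le_trans _ _ (\sum_(i < N) `|u i|))//.
    by rewrite (bigD1 (Ordinal nN))//= lerDl sumr_ge0.
  by have := ler_norm (- C); rewrite normrN; lra.
rewrite (le_trans (uC n Nn))// -addrA lerDl addr_ge0//; exact: sumr_ge0.
Qed.

Section SmoothFunctions.
Context {R : realType} {X : normedModType R} (O : set X) (h : X -> R).
Hypothesis hO : smooth_on O h.

Lemma smooth_line y w vs : O y -> is_derive y w (fderiv_seq h ^~ vs) (fderiv_seq h y (w :: vs)).
Proof. by move=> Oy; apply: fderiv_seq_is_derive; exact: hO. Qed.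

Lemma smooth_bounded y k : O y -> exists d C : R, 0 < d /\
  forall z vs, `|z - y| < d -> size vs = k -> `|fderiv_seq h z vs| <= C * \prod_(v <- vs) `|v|.
Proof.
move=> Oy; have /differentiable_continuous c := hO k Oy.
have : \forall z \near y, `|fderiv h k y - fderiv h k z| < 1.
  by have /cvgrPdist_lt/(_ _ ltr01) := c.
move=> /nbhs_ballP[d /= d0 dO]; exists d, (`|fderiv h k y| + 1); split=> // z vs zy vsk.
rewrite (le_trans (fderiv_seq_le _ _ _))// vsk ler_wpM2r ?prodr_ge0//.
have := dO z; rewrite -ball_normE /= distrC => /(_ zy) H.
have := ler_normB (fderiv h k y) (fderiv h k y - fderiv h k z).
by rewrite opprB addrC subrK => /le_trans; apply; rewrite lerD2l ltW.
Qed.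

End SmoothFunctions.

Section VectorDerivatives.
Context {R : realType} {X : normedModType R} {F : convenientType R}.
Variables (O : set X) (phi : X -> F).
Hypothesis Oopen : open O.
Hypothesis phi_smooth : forall l : {linear F -> R^o}, continuous l -> smooth_on O (l \o phi).

Lemma eq_of_functionals (x y : F) :
  (forall l : {linear F -> R^o}, continuous l -> l x = l y) -> x = y.
Proof.
move=> lxy; apply/eqP; rewrite -subr_eq0; apply/eqP.
apply: (tvs_separation (@convenient_hausdorff R F)) => l lc.
by rewrite linearB lxy// subrr.
Qed.

(** The rate 1/(n+1) is common to all functionals and only the constant depends on [l]. So the
    sequence is Mackey-Cauchy for the polar of these constants. *)
Lemma convenient_weak_limit (u : nat -> F) (L : {linear F -> R^o} -> R) :
  (forall l : {linear F -> R^o}, continuous l ->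
    exists b, forall n, `|l (u n) - L l| <= b * n.+1%:R^-1) ->
  exists e : F, forall l : {linear F -> R^o}, continuous l -> l e = L l.
Proof.
move=> uL.
have /choice[b bP] : forall l : {linear F -> R^o}, exists b, continuous l ->
    forall n, `|l (u n) - L l| <= b * n.+1%:R^-1.
  move=> l; have [lc|nlc] := pselect (continuous l).
    by have [b ?] := uL l lc; exists b.
  by exists 0.
have b0 (l : {linear F -> R^o}) : continuous l -> 0 <= b l.
  by move=> lc; have := bP l lc 0%N; rewrite invr1 mulr1; exact: le_trans.
pose mu n m : R := n.+1%:R^-1 + m.+1%:R^-1.
have e_cvg : (n.+1%:R^-1 : R) @[n --> \oo] --> (0 : R) by exact: cvg_harmonic.
have [|e ue] := @convenient_mackey_complete R F u.
  exists (polar_set b), mu; split.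
  - exact: polar_absolutely_convex.
  - exact: polar_bounded.
  - rewrite -[X in _ --> X]addr0; apply: cvgD.
      by apply: cvg_comp e_cvg; exact: cvg_fst.
    by apply: cvg_comp e_cvg; exact: cvg_snd.
  - move=> n m.
    have mu0 : 0 < mu n m by rewrite addr_gt0// invr_gt0.
    exists ((mu n m)^-1 *: (u n - u m)); last by rewrite scalerA divff ?gt_eqF// scale1r.
    move=> l lc; rewrite linearZ linearB /= normrM (@ger0_norm _ (mu n m)^-1) ?invr_ge0 ?(ltW mu0)//.
    rewrite ler_pdivrMl// (ger0_norm (b0 l lc)) /mu mulrDl.
    rewrite (le_trans (ler_distD (L l) _ _))//.
    by apply: lerD; rewrite [leRHS]mulrC; [exact: bP|rewrite distrC; exact: bP].
exists e => l lc.
apply: (@norm_cvg_unique _ R^o (l (u n) @[n --> \oo])).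
  exact: (cvg_comp _ _ ue (lc e)).
apply/cvgrPdist_lt => d d0.
have H : b l * n.+1%:R^-1 @[n --> \oo] --> (0 : R).
  by rewrite -(mulr0 (b l)); exact: cvgMr.
near=> n; rewrite distrC (le_lt_trans (bP l lc n))//.
by near: n; exact: (cvgr_lt 0 H).
Unshelve. all: by end_near. Qed.

(** The difference quotients of the derivative along [vs] converge at the rate 1/(n+1) against each
    functional, by Taylor's estimate; Mackey completeness supplies the limit. *)
Lemma vector_derivative_exists vs y : O y -> exists e : F,
  forall l : {linear F -> R^o}, continuous l -> l e = fderiv_seq (l \o phi) y vs.
Proof.
elim: vs y => [|w vs ih] y Oy.
  by exists (phi y) => l lc; rewrite fderiv_seq0.
have /choice[e eP] : forall z, exists e : F, O z ->
    forall l : {linear F -> R^o}, continuous l -> l e = fderiv_seq (l \o phi) z vs.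
  move=> z; have [Oz|nOz] := pselect (O z); last by exists 0.
  by have [e ?] := ih z Oz; exists e.
have /nbhs_ballP[d /= d0 dO] : nbhs y O by exact: open_nbhs_nbhs.
pose c := (`|w| + 1) / d.
have c0 : 0 < c by rewrite divr_gt0// ltr_wpDl.
(* The factor 1/(c+1) keeps all y + t_n w in the ball of radius [d], and t_n <= 1/(n+1). *)
pose t (n : nat) : R := (c + 1)^-1 * n.+1%:R^-1.
have c1 : 0 < c + 1 by rewrite addr_gt0.
have t0 n : 0 < t n by rewrite mulr_gt0 ?invr_gt0.
have tn n : O (y + t n *: w).
  apply: dO; rewrite -ball_normE /= opprD addrA subrr add0r normrN normrZ gtr0_norm//.
  rewrite /t -mulrA ltr_pdivrMl//.
  rewrite (@le_lt_trans _ _ `|w|)//; first by rewrite ler_piMl// invf_le1// ler1n.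
  rewrite (@lt_le_trans _ _ (c * d))//; first by rewrite /c divfK ?gt_eqF// ltrDl.
  by rewrite ler_wpM2r ?lerDl// ltW.
pose u n := (t n)^-1 *: (e (y + t n *: w) - e y).
apply: (@convenient_weak_limit u (fun l => fderiv_seq (l \o phi) y (w :: vs))) => l lc.
have hl := phi_smooth lc.
have [d' [C [d'0 C0 _ dC]]] := local_taylor (smooth_line hl) Oopen (smooth_bounded hl) (size vs) Oy.
have luE n : l (u n) = (t n)^-1 * (fderiv_seq (l \o phi) (y + t n *: w) vs - fderiv_seq (l \o phi) y vs).
  by rewrite /u linearZ linearB /= !eP.
pose P := \prod_(v <- vs) `|v|.
(* The radius d' of Taylor's estimate depends on [l], so the bound holds from some index on; the
   finitely many earlier indices only enlarge b. *)
have [b bP] : exists b, forall n,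
    `|l (u n) - fderiv_seq (l \o phi) y (w :: vs)| * n.+1%:R <= b.
  apply: (@seq_eventually_bounded _ _ (C * `|w| ^+ 2 * P)).
  have t_cvg : t n * `|w| @[n --> \oo] --> (0 : R).
    rewrite -(mul0r `|w|) -(mulr0 (c + 1)^-1); apply: cvgMl; apply: cvgMr; exact: cvg_harmonic.
  near=> n.
  have tw : t n * `|w| < d' by near: n; exact: (cvgr_lt 0 t_cvg).
  have yy : `|y - y| < d' by rewrite subrr normr0.
  have yE : y + t n *: w - y = t n *: w by rewrite addrAC subrr add0r.
  have yt : `|y + t n *: w - y| < d' by rewrite yE normrZ gtr0_norm.
  have := dC _ _ _ yy yt erefl.
  rewrite yE (line_derivative_scale (smooth_line hl))// -/P luE normrZ gtr0_norm//.
  set A := fderiv_seq _ _ _; set A0 := fderiv_seq _ _ vs; set A1 := fderiv_seq _ _ (w :: vs).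
  have -> : (t n)^-1 * (A - A0) - A1 = (t n)^-1 * (A - A0 - t n * A1).
    by field; rewrite gt_eqF.
  move=> H; rewrite normrM gtr0_norm ?invr_gt0// mulrAC.
  rewrite -ler_pdivlMl ?mulr_gt0 ?invr_gt0//; apply: (le_trans H).
  have tle : t n * n.+1%:R <= 1.
    by rewrite /t mulfVK// invf_le1// lerDr ltW.
  have -> : ((t n)^-1 * n.+1%:R)^-1 * (C * `|w| ^+ 2 * P) =
      t n * n.+1%:R^-1 * (C * `|w| ^+ 2 * P) by rewrite invfM invrK.
  rewrite exprMn (_ : C * (t n ^+ 2 * `|w| ^+ 2) * P = t n ^+ 2 * (C * `|w| ^+ 2 * P)); last by ring.
  rewrite ler_wpM2r//; first by rewrite mulr_ge0 ?prodr_ge0// mulr_ge0// exprn_ge0.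
  by rewrite expr2 ler_wpM2l ?(ltW (t0 n))// -[leRHS]mul1r ler_pdivlMr.
by exists b => n; rewrite ler_pdivlMr.
Unshelve. all: by end_near. Qed.

Lemma vector_derivatives : exists Phi : X -> seq X -> F,
  (forall y, O y -> Phi y [::] = phi y) /\
  forall y vs (l : {linear F -> R^o}), O y -> continuous l ->
    l (Phi y vs) = fderiv_seq (l \o phi) y vs.
Proof.
have /choice[Phi PhiP] : forall u : X * seq X, exists e : F, O u.1 ->
    forall l : {linear F -> R^o}, continuous l -> l e = fderiv_seq (l \o phi) u.1 u.2.
  move=> [y vs] /=; have [Oy|nOy] := pselect (O y); last by exists 0.
  by have [e ?] := vector_derivative_exists vs Oy; exists e.
exists (fun y vs => Phi (y, vs)); split=> [y Oy|y vs l Oy lc]; last by rewrite PhiP.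
by apply: eq_of_functionals => l lc; rewrite PhiP// fderiv_seq0.
Qed.

End VectorDerivatives.

(** * The chain rule *)

Lemma is_derive_diff_comp (R : realType) (V W : normedModType R) (f : R -> V) (g : V -> W)
    (t : R) (d : V) :
  is_derive t (1 : R) f d -> differentiable g (f t) ->
  is_derive t (1 : R) (g \o f) ('d g (f t) d).
Proof.
move=> fd dg; have df : differentiable f t by apply/derivable1_diffP; have [] := fd.
have dgf : differentiable (g \o f) t by exact: differentiable_comp.
split; first exact: diff_derivable.
rewrite deriveE// diff_comp//=; congr ('d g _ _).
by rewrite -(deriveE _ df); exact: derive_val.
Qed.

Lemma insertions_set_nth (T : choiceType) (w : T) (P : seq (seq T)) :
  insertions w P = [seq set_nth [::] P i (w :: nth [::] P i) | i <- iota 0 (size P)].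
Proof.
elim: P => [//|b P ih] /=; congr (_ :: _).
by rewrite ih -map_comp (iotaDl 1 0) -map_comp; apply: eq_map.
Qed.

Lemma fderiv_seqE (R : realType) (X : normedModType R) (h : X -> R) (z : X) (vs : seq X) k
    (v : 'I_k -> X) : size vs = k -> (forall i, v i = nth 0 vs i) ->
  fderiv_seq h z vs = fderiv h k z v.
Proof.
move=> vsk; subst k => H; rewrite /fderiv_seq; congr (mform_fun _ _).
by apply/funext => i; rewrite H.
Qed.

Lemma fderiv_seq_consE (R : realType) (X : normedModType R) (h : X -> R) (z w : X) (vs : seq X) k
    (v : 'I_k -> X) : size vs = k -> (forall i, v i = nth 0 vs i) ->
  differentiable (fderiv h k) z -> fderiv_seq h z (w :: vs) = 'd (fderiv h k) z w v.
Proof.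
move=> vsk; subst k => H dh; rewrite fderiv_seq_cons//; congr (mform_fun _ _).
by apply/funext => i; rewrite H.
Qed.

Section PolarLift.
Context {R : realType} {F : convenientType R} (b : {linear F -> R^o} -> R).

(** The default value 0 is taken off the span of the polar; [polar_liftP] excludes this case by
    testing functionals. *)
Definition polar_lift (x : F) : disk_space (polar_disk b) := insubd 0 x.

Lemma polar_liftP (x : F) (c : R) : 0 <= c ->
  (forall l : {linear F -> R^o}, continuous l -> `|l x| <= c * `|b l|) ->
  disk_incl (polar_lift x) = x /\ `|polar_lift x| <= c.
Proof.
move=> c0 xc.
(* Dilations have positive ratios while [c] may be 0, hence the passage to larger [e]. *)
have dil e : 0 < e -> c <= e -> dilations (polar_disk b) x e.
  move=> e0 ce; split=> //; exists (e^-1 *: x); last first.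
    by rewrite scalerA divff ?gt_eqF// scale1r.
  move=> l lc; rewrite linearZ normrM (@ger0_norm _ e^-1) ?invr_ge0 ?(ltW e0)//.
  by rewrite ler_pdivrMl// (le_trans (xc l lc))// ler_wpM2r.
have xP : x \in disk_space_pred (polar_disk b).
  by apply/asboolP/lin_spanP; exists (c + 1); apply: dil; rewrite ?ltr_wpDl ?lerDl.
have E : disk_incl (polar_lift x) = x by exact: (insubdK 0 xP).
split=> //; apply/ler_addgt0Pr => e e0.
rewrite disk_normE E; apply: minkowski_le; apply: dil; first by rewrite ltr_wpDl.
by rewrite lerDl ltW.
Qed.

End PolarLift.

Lemma disk_incl_inj (R : realType) (F : convenientType R) (B : disk F) :
  injective (@disk_incl R F B).
Proof. exact: val_inj. Qed.

Section IteratedDerivative.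
Context {R : realType} {F : convenientType R} (psi : F -> R).

(* Defined on [F] itself: its value does not depend on the disk in whose span the
   point and the directions are considered, see [line_deriv_disk]. *)
Fixpoint line_deriv (z : F) (ws : seq F) : R :=
  if ws is w :: ws' then 'D_1 (fun t : R => line_deriv (z + t *: w) ws') 0 else psi z.

Lemma line_deriv_disk (V : set F) (B : disk F) (z : disk_space B) (ws : seq (disk_space B)) :
  open (@disk_incl R F B @^-1` V) -> smooth_on (@disk_incl R F B @^-1` V) (psi \o @disk_incl R F B) ->
  V (disk_incl z) ->
  line_deriv (disk_incl z) (map (@disk_incl R F B) ws) =
  fderiv_seq (psi \o @disk_incl R F B) z ws.
Proof.
move=> Vo psis; elim: ws z => [|w ws ih] z Vz /=; first by rewrite fderiv_seq0.
apply: derive_val.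
have : is_derive (0 : R) (1 : R)
    (fun t : R => fderiv_seq (psi \o @disk_incl R F B) (z + t *: w) ws)
    (fderiv_seq (psi \o @disk_incl R F B) z (w :: ws)).
  apply/(@line_is_derive _ _ _ (fderiv_seq (psi \o @disk_incl R F B) ^~ ws)).
  by rewrite scale0r addr0; exact: (smooth_line psis).
apply: near_eq_is_derive.
have zw : z + t *: w @[t --> (0 : R)] --> z.
  rewrite -[X in _ --> X]addr0; apply: cvgD; first exact: cvg_cst.
  by rewrite -(scale0r w); apply: cvgZr_tmp; exact: cvg_id.
have : \forall t \near (0 : R), (@disk_incl R F B @^-1` V) (z + t *: w).
  by apply: zw; exact: open_nbhs_nbhs.
by apply: filterS => t Vt; rewrite -ih.
Qed.

End IteratedDerivative.

(** * The Faa di Bruno formula for a composite *)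

Section Composition.
Context {R : realType} {X : normedModType R} {F : convenientType R}.
Variables (O : set X) (V : set F) (phi : X -> F) (psi : F -> R).
Hypothesis Oopen : open O.
Hypothesis phi_smooth : forall l : {linear F -> R^o}, continuous l -> smooth_on O (l \o phi).
Hypothesis Vopen : forall B : disk F, open (@disk_incl R F B @^-1` V).
Hypothesis psi_smooth : forall B : disk F,
  smooth_on (@disk_incl R F B @^-1` V) (psi \o @disk_incl R F B).
Hypothesis phiV : forall y, O y -> V (phi y).
Variable Phi : X -> seq X -> F.
Hypothesis Phi0 : forall y, O y -> Phi y [::] = phi y.
Hypothesis PhiE : forall y vs (l : {linear F -> R^o}), O y -> continuous l ->
  l (Phi y vs) = fderiv_seq (l \o phi) y vs.

(** In contrast to [local_taylor], the interval |t| <= d is the same for all [l]: the second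
    derivative along the line is bounded by compactness of the segment. Only [b] depends on [l], so
    the remainders for all functionals fit into one polar. *)
Lemma quadratic_remainder y w vs (d : R) (l : {linear F -> R^o}) : continuous l ->
  (forall t : R, `|t| <= d -> O (y + t *: w)) ->
  exists b, forall t, `|t| <= d ->
    `|l (Phi (y + t *: w) vs - Phi y vs - t *: Phi y (w :: vs))| <= b * t ^+ 2.
Proof.
move=> lc yO; have hl := phi_smooth lc; set h := l \o phi in hl.
have sl := smooth_line hl.
have cH : {within `[- d, d], continuous (fun t : R => fderiv_seq h (y + t *: w) [:: w, w & vs])}.
  apply: derivable_within_continuous => t; rewrite in_itv/= -ler_norml => td.
  have : is_derive t (1 : R) (fun s : R => fderiv_seq h (y + s *: w) [:: w, w & vs])
      (fderiv_seq h (y + t *: w) [:: w, w, w & vs]).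
    apply/(@line_is_derive _ _ _ (fderiv_seq h ^~ [:: w, w & vs])).
    by apply: sl; exact: yO.
  by case.
have [b [_ Hb]] := compact_bounded (continuous_compact cH (@segment_compact R (- d) d)).
have b1 : b < b + 1 by rewrite ltrDl.
exists (b + 1) => t td.
have tO s : 0 <= s <= 1 -> O (y + s *: (t *: w)).
  move=> /andP[s0 s1]; rewrite scalerA; apply: yO; rewrite normrM ger0_norm//.
  by rewrite (le_trans _ td)// ler_piMl.
have Oy : O y by have := tO 0; rewrite scale0r addr0; apply; rewrite lexx ler01.
rewrite !linearB linearZ /= !PhiE//; last exact: yO.
rewrite -/h.
have [s s01 ->] := line_mean_value sl vs tO.
rewrite (line_derivative_scale sl)//; last exact: tO.
have sO u : 0 <= u <= 1 -> O (y + u *: (s *: (t *: w))).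
  move=> /andP[u0 u1]; rewrite scalerA; apply: tO; case/andP: s01 => s0 s1.
  by rewrite mulr_ge0//= (le_trans _ s1)// ler_piMl.
have tE (a : R^o) : t *: a = t * a :> R by [].
rewrite tE -mulrBr.
have [u u01 ->] := line_mean_value sl (w :: vs) sO.
rewrite (line_derivative_scale sl)//; last exact: sO.
rewrite (line_derivative_scale sl)//; last exact: sO.
case/andP: s01 => s0 s1; case/andP: u01 => u0 u1.
have xb : `|fderiv_seq h (y + u *: (s *: (t *: w))) [:: w, w & vs]| <= b + 1.
  apply: Hb => //; exists (u * s * t); last by rewrite !scalerA.
  rewrite /= in_itv/= -ler_norml normrM ger0_norm ?mulr_ge0//.
  by rewrite (le_trans _ td)// ler_piMl// mulr_ile1.
rewrite !normrM (ger0_norm s0) -(real_normK (num_real t)) expr2.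
rewrite (_ : _ * _ = (s * `|fderiv_seq h (y + u *: (s *: (t *: w))) [:: w, w & vs]|) * (`|t| * `|t|)); last by ring.
by rewrite ler_wpM2r ?mulr_ge0// (le_trans _ xb)// ler_piMl.
Qed.

Definition composite_term (P : seq (seq X)) (y : X) : R :=
  line_deriv psi (phi y) (map (Phi y) P).

(** Along the line through y in the direction w, phi and its derivatives over the blocks lift to
    curves in one disk space. There the term is a form evaluated at moving arguments:
    differentiating the form opens the new block [w], differentiating an argument inserts w into its
    block. *)
Lemma composite_term_is_derive P y w : O y ->
  is_derive y w (composite_term P)
    (composite_term ([:: w] :: P) y + \sum_(Q <- insertions w P) composite_term Q y).
Proof.
move=> Oy.
have /nbhs_ballP[d' /= d'0 dO] : nbhs y O by exact: open_nbhs_nbhs.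
pose d := d' / (2 * (`|w| + 1)).
have w1 : 0 < `|w| + 1 by rewrite ltr_wpDl.
have d0 : 0 < d by rewrite divr_gt0// mulr_gt0.
have yO t : `|t| <= d -> O (y + t *: w).
  move=> td; apply: dO; rewrite -ball_normE /= opprD addrA subrr add0r normrN normrZ.
  rewrite (le_lt_trans (ler_wpM2r (normr_ge0 w) td))//.
  rewrite /d mulrAC ltr_pdivrMr ?mulr_gt0// ltr_pM2l//.
  by have := normr_ge0 w; lra.
(* The empty block stands for phi itself. [b l] dominates values, derivatives in the direction w and
   remainders, so that all three lift to the polar of [b]. *)
have /choice[b bP] : forall l : {linear F -> R^o}, exists b, continuous l ->
    0 <= b /\ forall c, c \in [::] :: P ->
    [/\ `|l (Phi y c)| <= b, `|l (Phi y (w :: c))| <= b &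
      forall t, `|t| <= d ->
        `|l (Phi (y + t *: w) c - Phi y c - t *: Phi y (w :: c))| <= b * t ^+ 2].
  move=> l; have [lc|nlc] := pselect (continuous l); last by exists 0.
  elim: ([::] :: P) => [|c S [b ih]]; first by exists 0 => _; split.
  have [b0 bS] := ih lc; have [b' b'P] := quadratic_remainder c lc yO.
  exists (b + `|b'| + `|l (Phi y c)| + `|l (Phi y (w :: c))|) => _; split; first by rewrite !addr_ge0.
  have b'0 := normr_ge0 b'; have c0 := normr_ge0 (l (Phi y c)).
  have wc0 := normr_ge0 (l (Phi y (w :: c))).
  move=> c'; rewrite inE => /orP[/eqP ->|/bS[H1 H2 H3]].
    split; [lra|lra|move=> t td; rewrite (le_trans (b'P t td))// ler_wpM2r ?sqr_ge0//].
    by have := ler_norm b'; lra.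
  split; [lra|lra|move=> t td; rewrite (le_trans (H3 t td))// ler_wpM2r ?sqr_ge0//].
  lra.
pose lift := @polar_lift R F b.
have liftP (x : F) (c : R) : 0 <= c ->
    (forall l : {linear F -> R^o}, continuous l -> `|l x| <= c * b l) ->
    disk_incl (lift x) = x /\ `|lift x| <= c.
  move=> c0 H; apply: polar_liftP => // l lc.
  by rewrite (@ger0_norm _ (b l)) ?H//; case: (bP l lc).
have lift1 c : c \in [::] :: P -> disk_incl (lift (Phi y c)) = Phi y c.
  move=> cP; have [] // := liftP (Phi y c) 1 ler01.
  by move=> l lc; rewrite mul1r; have [_ /(_ c cP)[]] := bP l lc.
have lift2 c : c \in [::] :: P -> disk_incl (lift (Phi y (w :: c))) = Phi y (w :: c).
  move=> cP; have [] // := liftP (Phi y (w :: c)) 1 ler01.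
  by move=> l lc; rewrite mul1r; have [_ /(_ c cP)[]] := bP l lc.
have lift3 c t : c \in [::] :: P -> `|t| <= d ->
    disk_incl (lift (Phi (y + t *: w) c - Phi y c - t *: Phi y (w :: c))) =
      Phi (y + t *: w) c - Phi y c - t *: Phi y (w :: c) /\
    `|lift (Phi (y + t *: w) c - Phi y c - t *: Phi y (w :: c))| <= t ^+ 2.
  move=> cP td; apply: liftP; first exact: sqr_ge0.
  by move=> l lc; have [_ /(_ c cP)[_ _ /(_ t td)]] := bP l lc; rewrite mulrC.
(* The curve is assembled from its lifted Taylor expansion, so its derivative at 0 can be read off
   from the norm of the remainder. *)
pose a c t : disk_space (polar_disk b) := lift (Phi y c) + t *: lift (Phi y (w :: c)) +
  lift (Phi (y + t *: w) c - Phi y c - t *: Phi y (w :: c)).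
have aE c t : c \in [::] :: P -> `|t| <= d -> disk_incl (a c t) = Phi (y + t *: w) c.
  move=> cP td; rewrite /a !disk_inclD disk_inclZ lift1// lift2// (lift3 c t cP td).1.
  by rewrite addrC -[X in X + _]addrA -opprD subrK.
have rem0 c : c \in [::] :: P ->
    lift (Phi (y + 0 *: w) c - Phi y c - 0 *: Phi y (w :: c)) = 0.
  move=> cP; apply/eqP; rewrite -normr_le0.
  have d0' : `|0 : R| <= d by rewrite normr0 ltW.
  by have [_] := lift3 c 0 cP d0'; rewrite expr0n.
have a0 c : c \in [::] :: P -> a c 0 = lift (Phi y c).
  by move=> cP; rewrite /a rem0// addr0 scale0r addr0.
have da c : c \in [::] :: P -> is_derive (0 : R) (1 : R) (a c) (lift (Phi y (w :: c))).
  move=> cP; apply: (is_derive_quadratic (C := 1)); apply: (near0_norm d0) => h hd.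
  rewrite add0r [h%:A]mulr1 (a0 c cP) /a mul1r.
  have [_ H] := lift3 c h cP (ltW hd).
  by rewrite -[X in `|X|]addrA -opprD addrC addKr.
have nP : [::] \in [::] :: P by rewrite mem_head.
have Pi (i : 'I_(size P)) : nth [::] P i \in [::] :: P by rewrite inE mem_nth ?orbT.
set B := polar_disk b in lift liftP lift1 lift2 lift3 a aE rem0 a0 da *.
set Psi := psi \o @disk_incl R F B.
have Vy : V (disk_incl (lift (Phi y [::]))) by rewrite lift1// Phi0//; exact: phiV.
have [dPsi dPsi1] : differentiable (fderiv Psi (size P)) (a [::] 0) /\
    forall k, differentiable (fderiv Psi k) (lift (Phi y [::])).
  by rewrite a0//; split=> [|k]; exact: psi_smooth.
have dA := is_derive_diff_comp (da _ nP) dPsi.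
have dG := mform_curve_derive dA (fun i => da _ (Pi i)).
have termE t : `|t| <= d -> composite_term P (y + t *: w) =
    fderiv Psi (size P) (a [::] t) (fun i => a (nth [::] P i) t).
  move=> td; have Vt : V (disk_incl (a [::] t)) by rewrite aE// Phi0; [apply: phiV|]; exact: yO.
  rewrite -(@fderiv_seqE _ _ _ _ [seq a c t | c <- P]) ?size_map//; last first.
    by move=> i; rewrite (nth_map [::]).
  rewrite -(line_deriv_disk _ (@Vopen B) (@psi_smooth B) Vt) /composite_term.
  rewrite aE// Phi0; last exact: yO.
  rewrite -map_comp; congr line_deriv.
  by apply/eq_in_map => c cP; rewrite -(aE c t)// inE cP orbT.
have dT : is_derive (0 : R) (1 : R) (fun t => composite_term P (y + t *: w))
    ('d (fderiv Psi (size P)) (a [::] 0) (lift (Phi y [:: w])) (fun i => a (nth [::] P i) 0) +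
     \sum_(i < size P) fderiv Psi (size P) (a [::] 0)
       (replace_arg (fun i => a (nth [::] P i) 0) i (lift (Phi y (w :: nth [::] P i))))).
  apply: near_eq_is_derive dG; apply: (near0_norm d0) => t td.
  by rewrite termE// ltW.
have := (@line_is_derive _ _ _ (composite_term P) y w 0 _).2 dT.
rewrite scale0r addr0 => H; apply: (is_derive_eq H); congr (_ + _).
  rewrite /composite_term -Phi0// -(lift1 _ nP).
  have -> : map (Phi y) ([:: w] :: P) =
      map (@disk_incl R F B) (lift (Phi y [:: w]) :: [seq lift (Phi y c) | c <- P]).
    rewrite /= (lift2 _ nP) -map_comp; congr (_ :: _).
    by apply/eq_in_map => c cP; rewrite -(lift1 c)// inE cP orbT.
  rewrite (line_deriv_disk _ (@Vopen B) (@psi_smooth B))// a0//.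
  apply/esym/fderiv_seq_consE; [by rewrite size_map| |exact: dPsi1].
  by move=> i; rewrite (nth_map [::])// a0.
rewrite insertions_set_nth big_map (big_nth 0%N) size_iota big_mkord.
apply: eq_bigr => i _; rewrite nth_iota// add0n.
set Q := set_nth _ _ _ _.
have sQ : size Q = size P by rewrite size_set_nth; apply/maxn_idPr.
have liftQ c : c \in Q -> disk_incl (lift (Phi y c)) = Phi y c.
  rewrite /Q set_nthE ltn_ord mem_cat inE => /orP[/mem_take cP|/orP[/eqP ->|/mem_drop cP]].
  - by apply: lift1; rewrite inE cP orbT.
  - exact: lift2.
  - by apply: lift1; rewrite inE cP orbT.
rewrite /composite_term -Phi0// -(lift1 _ nP).
have -> : map (Phi y) Q = map (@disk_incl R F B) [seq lift (Phi y c) | c <- Q].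
  by rewrite -map_comp; apply/eq_in_map => c cQ; rewrite -(liftQ c).
rewrite (line_deriv_disk _ (@Vopen B) (@psi_smooth B))// a0//.
apply/esym/fderiv_seqE; first by rewrite size_map.
move=> j; rewrite (nth_map [::]) ?sQ// /Q nth_set_nth/= /replace_arg -val_eqE/=.
by case: eqP => // _; rewrite a0.
Qed.

Definition composite_deriv (y : X) (vs : seq X) : R :=
  \sum_(P <- partitions vs) composite_term P y.

Lemma composite_deriv_nil y : composite_deriv y [::] = psi (phi y).
Proof. by rewrite /composite_deriv big_seq1. Qed.

Lemma composite_deriv_is_derive y w vs : O y ->
  is_derive y w (composite_deriv ^~ vs) (composite_deriv y (w :: vs)).
Proof.
move=> Oy; rewrite /composite_deriv sum_partitions_cons.
elim: (partitions vs) => [|P S ih].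
  rewrite big_nil (_ : (fun _ => _) = cst 0); first exact: is_derive_cst.
  by apply/funext => z; rewrite big_nil.
rewrite big_cons (_ : (fun _ => _) = composite_term P + (fun z => \sum_(Q <- S) composite_term Q z)).
  by apply: is_deriveD ih; exact: composite_term_is_derive.
by apply/funext => z; rewrite big_cons.
Qed.

(** As [line_deriv] does not refer to a disk, [b] can be chosen to suit the estimate: the bounds on
    phi are asked of each functional, the bound on psi only at one point of the space spanned by the
    polar of [b]. *)
Lemma composite_deriv_le (b : {linear F -> R^o} -> R) (p q : nat -> R) y vs : O y ->
  (forall k, 0 <= p k) -> (forall k, 0 <= q k) ->
  (forall c (l : {linear F -> R^o}), (size c <= size vs)%N -> continuous l ->
     `|l (Phi y c)| <= p (size c) * \prod_(v <- c) `|v| * `|b l|) ->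
  (forall ws, (size ws <= size vs)%N ->
     `|fderiv_seq (psi \o @disk_incl R F (polar_disk b)) (polar_lift b (phi y)) ws| <=
     q (size ws) * \prod_(w <- ws) `|w|) ->
  `|composite_deriv y vs| <=
    (\sum_(P <- partitions vs) q (size P) * \prod_(c <- P) p (size c)) * \prod_(v <- vs) `|v|.
Proof.
move=> Oy p0 q0 pP qP; rewrite /composite_deriv (le_trans (ler_norm_sum _ _ _))//.
rewrite mulr_suml big_seq [leRHS]big_seq; apply: ler_sum => P Pvs.
have liftP c : (size c <= size vs)%N -> disk_incl (polar_lift b (Phi y c)) = Phi y c /\
    `|polar_lift b (Phi y c)| <= p (size c) * \prod_(v <- c) `|v|.
  move=> cvs; apply: polar_liftP; first by rewrite mulr_ge0// prodr_ge0.
  by move=> l lc; exact: pP.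
have lift0 : disk_incl (polar_lift b (phi y)) = phi y.
  by rewrite -Phi0//; exact: (liftP [::] _).1.
have Vy : V (disk_incl (polar_lift b (phi y))) by rewrite lift0; exact: phiV.
have -> : composite_term P y =
    fderiv_seq (psi \o @disk_incl R F (polar_disk b)) (polar_lift b (phi y))
      [seq polar_lift b (Phi y c) | c <- P].
  rewrite -(line_deriv_disk _ (@Vopen _) (@psi_smooth _) Vy) lift0 /composite_term -map_comp.
  congr line_deriv; apply/eq_in_map => c cP.
  by rewrite -[LHS](liftP c _).1// (partitions_block_size Pvs).
rewrite (le_trans (qP _ _)) ?size_map ?partitions_size//.
rewrite -mulrA ler_wpM2l// -(partitions_prod _ Pvs) -big_split big_map/=.
rewrite big_seq [leRHS]big_seq; apply: ler_prod => c cP; rewrite normr_ge0/=.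
by apply: (liftP c _).2; rewrite (partitions_block_size Pvs).
Qed.

(* A neighborhood of [y] need not be mapped by [phi] into the span of a single disk,
   but a sequence converging to [y] is; so an unbounded sequence is excluded. *)
Lemma composite_deriv_bounded y k : O y -> exists d C : R, 0 < d /\
  forall z vs, `|z - y| < d -> size vs = k -> `|composite_deriv z vs| <= C * \prod_(v <- vs) `|v|.
Proof.
move=> Oy; apply: contrapT => H.
have /nbhs_ballP[d /= d0 dO] : nbhs y O by exact: open_nbhs_nbhs.
have dn0 (n : nat) : 0 < d * n.+1%:R^-1 by rewrite mulr_gt0.
have /choice[u uP] : forall n : nat, exists u : X * seq X, [/\ `|u.1 - y| < d * n.+1%:R^-1,
    size u.2 = k & n%:R * \prod_(v <- u.2) `|v| < `|composite_deriv u.1 u.2|].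
  move=> n; apply: contrapT => Hn; apply: H; exists (d * n.+1%:R^-1), n%:R; split=> //.
  move=> z vs zy vsk; rewrite leNgt; apply/negP => ?; apply: Hn.
  by exists (z, vs).
pose z n := (u n).1.
have zd n : `|z n - y| < d * n.+1%:R^-1 by case: (uP n).
have zO n : O (z n).
  apply: dO; rewrite -ball_normE /= distrC (lt_le_trans (zd n))// ler_piMr ?(ltW d0)//.
  by rewrite invf_le1// ler1n.
have z_cvg : z n @[n --> \oo] --> y.
  apply/cvgrPdist_lt => e e0.
  have dc : d * n.+1%:R^-1 @[n --> \oo] --> (0 : R).
    by rewrite -(mulr0 d); apply: cvgMr; exact: cvg_harmonic.
  near=> n; rewrite distrC (lt_trans (zd n))//.
  by near: n; exact: (cvgr_lt 0 dc).
(* [b l] bounds the derivatives of order at most k along the whole sequence and dominates (n+1)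
   |l(phi(z n) - phi y)|; hence the lifted points converge in norm. *)
have /choice[b bP] : forall l : {linear F -> R^o}, exists b, continuous l ->
    [/\ 0 <= b, forall n c, (size c <= k)%N -> `|l (Phi (z n) c)| <= b * \prod_(v <- c) `|v|,
      forall n, `|l (phi (z n) - phi y)| <= n.+1%:R^-1 * b & `|l (phi y)| <= b].
  move=> l; have [lc|nlc] := pselect (continuous l); last by exists 0.
  have hl := phi_smooth lc; set h := l \o phi in hl.
  have [b1 b1P] : exists b1, forall n, \sum_(j < k.+1) `|fderiv h j (z n)| <= b1.
    apply: (@seq_eventually_bounded _ _ (\sum_(j < k.+1) `|fderiv h j y| + 1)).
    have c : \sum_(j < k.+1) `|fderiv h j (z n)| @[n --> \oo] -->
        \sum_(j < k.+1) `|fderiv h j y|.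
      apply: cvg_sum_ord => j; apply: cvg_norm; apply: (cvg_comp _ _ z_cvg).
      exact/differentiable_continuous/hl.
    by apply: (cvgr_le _ c); rewrite ltrDl.
  have [d' [C [d'0 C0 _ dC]]] := local_lipschitz (smooth_line hl) Oopen (smooth_bounded hl) 0 Oy.
  have [b2 b2P] : exists b2, forall n, `|h (z n) - h y| * n.+1%:R <= b2.
    apply: (@seq_eventually_bounded _ _ (C * d)).
    have : \forall n \near \oo, `|y - z n| < d' by move/cvgrPdist_lt: z_cvg; apply.
    apply: filterS => n; rewrite distrC => nd'.
    have := dC y (z n) [::] _ nd' erefl; rewrite subrr normr0 => /(_ d'0).
    rewrite !fderiv_seq0 big_nil mulr1 => Hn.
    rewrite -ler_pdivlMr// -mulrA (le_trans Hn)// ler_wpM2l//.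
    exact/ltW/zd.
  exists (`|b1| + `|b2| + `|l (phi y)|) => _; split.
  - by rewrite !addr_ge0.
  - move=> n c ck; rewrite PhiE// (le_trans (fderiv_seq_le _ _ _))// ler_wpM2r ?prodr_ge0//.
    rewrite -addrA ler_wpDr ?addr_ge0// (le_trans _ (ler_norm b1))//.
    have ck' : (size c < k.+1)%N by [].
    rewrite (le_trans _ (b1P n))//.
    by rewrite (bigD1 (Ordinal ck'))//= lerDl sumr_ge0.
  - move=> n; rewrite linearB /= ler_pdivlMl// mulrC (le_trans (b2P n))//.
    by rewrite addrAC ler_wpDl ?addr_ge0// ler_norm.
  - by rewrite lerDr addr_ge0.
pose Psi := psi \o @disk_incl R F (polar_disk b).
pose hy := polar_lift b (phi y).
have bN (l : {linear F -> R^o}) : continuous l -> `|b l| = b l.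
  by move=> lc; rewrite ger0_norm//; case: (bP l lc).
have hyE : disk_incl hy = phi y.
  apply: (polar_liftP (c := 1) _ _).1 => // l lc.
  by rewrite mul1r bN//; case: (bP l lc).
have hzP n : disk_incl (polar_lift b (phi (z n))) = phi (z n) /\
    `|polar_lift b (phi (z n)) - hy| <= n.+1%:R^-1.
  have [E1 N1] : disk_incl (polar_lift b (phi (z n) - phi y)) = phi (z n) - phi y /\
      `|polar_lift b (phi (z n) - phi y)| <= n.+1%:R^-1.
    by apply: polar_liftP => // l lc; rewrite bN//; case: (bP l lc).
  have E2 : disk_incl (polar_lift b (phi (z n))) = phi (z n).
    apply: (polar_liftP (c := 1) _ _).1 => // l lc.
    have [_ /(_ n [::] isT) + _ _] := bP l lc.
    by rewrite big_nil mulr1 mul1r bN// Phi0.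
  split=> //; rewrite (_ : _ - hy = polar_lift b (phi (z n) - phi y))//.
  by apply: disk_incl_inj; rewrite disk_inclB E2 hyE E1.
have hz_cvg : polar_lift b (phi (z n)) @[n --> \oo] --> hy.
  apply/cvgrPdist_lt => e e0; near=> n; rewrite distrC (le_lt_trans (hzP n).2)//.
  by near: n; exact: (cvgr_lt 0 (@cvg_harmonic R)).
have Vy : V (disk_incl hy) by rewrite hyE; exact: phiV.
pose Q := \sum_(j < k.+1) `|fderiv Psi j hy| + 1.
have Q0 : 0 <= Q by rewrite addr_ge0// sumr_ge0.
have cQ : \sum_(j < k.+1) `|fderiv Psi j (polar_lift b (phi (z n)))| @[n --> \oo] -->
    \sum_(j < k.+1) `|fderiv Psi j hy|.
  apply: cvg_sum_ord => j; apply: cvg_norm; apply: (cvg_comp _ _ hz_cvg).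
  exact/differentiable_continuous/psi_smooth.
have [n [nQ nC]] : exists n : nat,
    \sum_(j < k.+1) `|fderiv Psi j (polar_lift b (phi (z n)))| <= Q /\
    Q * (k`!%:R * (1 + 2) ^+ k) <= n%:R.
  have e1 : \forall n \near \oo, \sum_(j < k.+1) `|fderiv Psi j (polar_lift b (phi (z n)))| <= Q.
    by apply: (cvgr_le _ cQ); rewrite ltrDl.
  have e2 : \forall n \near \oo, Q * (k`!%:R * (1 + 2) ^+ k) <= n%:R by exact: nbhs_infty_ger.
  by have [n []] := filter_ex (filterI e1 e2); exists n.
have [_ vsk] := uP n; apply/negP; rewrite -leNgt.
(* The factorials are inserted, being at least 1, so that [partitions_fact] with x = 1 bounds the
   sum over the partitions by k! 3^k. *)
rewrite (le_trans (@composite_deriv_le b (fun j => j`!%:R) (fun j => Q * j`!%:R) _ _ _ _ _ _ _))//.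
- exact: zO.
- by move=> j; rewrite mulr_ge0.
- rewrite vsk => c l ck lc; have [_ /(_ n c ck) + _ _] := bP l lc.
  move=> /le_trans; apply; rewrite bN// mulrC ler_wpM2r//; first by case: (bP l lc).
  by rewrite ler_peMl ?prodr_ge0// ler1n fact_gt0.
- rewrite vsk => ws wk; rewrite (le_trans (fderiv_seq_le _ _ _))// ler_wpM2r ?prodr_ge0//.
  rewrite (@le_trans _ _ Q)//; last by rewrite ler_peMr// ler1n fact_gt0.
  have wk' : (size ws < k.+1)%N by [].
  rewrite (le_trans _ nQ)//.
  by rewrite (bigD1 (Ordinal wk'))//= lerDl sumr_ge0.
- rewrite ler_wpM2r ?prodr_ge0// (le_trans _ nC)//.
  have pf := @partitions_fact R X 1 (u n).2 ler01; rewrite vsk in pf.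
  rewrite (le_trans _ (ler_wpM2l Q0 pf))// mulr_sumr; apply: ler_sum => P _.
  by rewrite expr1n mulr1 natr_prod mulrA.
Unshelve. all: by end_near. Qed.

Lemma composite_smooth : smooth_on O (psi \o phi).
Proof.
apply: (smooth_of_line_derivatives (D := composite_deriv)) => //.
- by move=> y w vs; exact: composite_deriv_is_derive.
- by move=> y k; exact: composite_deriv_bounded.
- by move=> y _; rewrite composite_deriv_nil.
Qed.

Lemma composite_fderiv_seq y vs : O y -> fderiv_seq (psi \o phi) y vs = composite_deriv y vs.
Proof.
move=> Oy; apply: (fderiv_seq_of_line_derivatives (D := composite_deriv)) Oy => //.
- by move=> y' w vs'; exact: composite_deriv_is_derive.
- by move=> y' k; exact: composite_deriv_bounded.
- by move=> y' _; rewrite composite_deriv_nil.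
Qed.

End Composition.

(** * Estimates *)

Section GrowthLemma.
Context {R : realType}.

(* In the Roumieu case the constant [rho] depends on the functional; testing against
   subexponential weights [r] replaces it by a bound that is uniform in [rho]. *)
Lemma subexponential_test (A : nat -> R) :
  (forall r : nat -> R, (forall k, 0 < r k) -> r 0%N = 1 ->
    (forall j k, r (j + k)%N <= r j * r k) ->
    (forall rho, 0 < rho -> exists C, forall k, r k * rho ^+ k <= C) ->
    exists2 C, 1 <= C & forall k, A k * r k <= C * C ^+ k) ->
  exists2 rho, 0 < rho & exists C, forall k, A k <= C * rho ^+ k.
Proof.
move=> test; apply: contrapT => nA.
(* The base is a square so that it outgrows the weight, which divides it by at most n + 2. *)
have big n N : exists k, (N <= k)%N /\ (n.+1%:R ^+ 2) ^+ k < A k.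
  apply: contrapT => H; apply: nA; exists (n.+1%:R ^+ 2); first by rewrite exprn_gt0.
  have g1 k : 1 <= (n.+1%:R ^+ 2) ^+ k :> R by rewrite !exprn_ege1// ler1n.
  have [C HC] : exists C, forall k, A k / (n.+1%:R ^+ 2) ^+ k <= C.
    apply: (@seq_eventually_bounded _ _ 1); exists N => // k /= Nk.
    rewrite ler_pdivrMr ?(lt_le_trans ltr01)// mul1r leNgt; apply/negP => ?.
    by apply: H; exists k.
  by exists C => k; rewrite -ler_pdivrMr ?HC// (lt_le_trans ltr01).
have /choice[nxt nxtP] : forall u : nat * nat, exists k, (u.2 < k)%N /\ (u.1.+1%:R ^+ 2) ^+ k < A k.
  by move=> [n N]; exact: big.
pose kap := fix kap (n : nat) : nat := if n is m.+1 then nxt (n, kap m) else nxt (0, 0)%N.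
have kapA n : (n.+1%:R ^+ 2) ^+ kap n < A (kap n).
  by case: n => [|n]; [exact: (nxtP (0, 0)%N).2|exact: (nxtP (n.+1, kap n)).2].
have kap_lt n : (kap n < kap n.+1)%N by exact: (nxtP (n.+1, kap n)).1.
have kap_mono : {homo kap : m n / (m < n)%N} by exact: homo_ltn ltn_trans kap_lt.
have kap_leq m n : (kap m <= kap n)%N = (m <= n)%N.
  have [mn|nm] := leqP m n; last by apply/negbTE; rewrite -ltnNge kap_mono.
  by move: mn; rewrite leq_eqVlt => /orP[/eqP ->|/kap_mono/ltnW ->//]; rewrite leqnn.
have kap_ge n : (n <= kap n)%N.
  by elim: n => // n ih; exact: leq_ltn_trans ih (kap_lt n).
(* One plus the number of n with kap n <= k; the range n <= k captures all of them, since n <= kap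
   n. It tends to infinity, but is at most n + 2 at kap n. *)
pose s k : nat := (\sum_(n < k.+1) (kap n <= k)).+1.
have s_mono j k : (j <= k)%N -> (s j <= s k)%N.
  move=> jk; rewrite /s ltnS -(subnKC (_ : j.+1 <= k.+1)%N)//.
  rewrite big_split_ord/= (leq_trans _ (leq_addr _ _))//.
  apply: leq_sum => i _; have [H|//] := boolP (kap i <= j)%N.
  by rewrite (leq_trans H).
have s_kap n : (s (kap n) <= n.+2)%N.
  rewrite /s ltnS.
  under eq_bigr do rewrite kap_leq.
  rewrite -(big_mkord xpredT (fun i => nat_of_bool (i <= n)%N)).
  rewrite (@leq_trans (\sum_(0 <= i < (kap n).+1 | (i <= n)%N) 1)%N)//.
    by rewrite [leqRHS]big_mkcond/=; apply: leq_sum => i _; case: (i <= n)%N.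
  rewrite -big_filter sum1_size.
  rewrite -(size_iota 0 n.+1); apply: uniq_leq_size; first by rewrite filter_uniq// iota_uniq.
  by move=> i; rewrite mem_filter mem_iota => /andP[].
have s_large N k : (kap N <= k)%N -> (N <= s k)%N.
  move=> Nk; rewrite /s.
  have Nk1 : (N <= k.+1)%N by rewrite ltnW// ltnS (leq_trans (kap_ge N)).
  rewrite -(subnKC Nk1) big_split_ord/= leqW// (leq_trans _ (leq_addr _ _))//.
  rewrite (eq_bigr (fun=> 1%N)); first by rewrite sum1_card card_ord.
  by move=> i _; rewrite (leq_trans _ Nk)// kap_leq ltnW.
have s0 k : 0 < (s k)%:R :> R by rewrite ltr0n.
(* Submultiplicative because s is nondecreasing; r k rho^k = (rho / s k)^k is bounded because s is
   unbounded. *)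
pose r k : R := (s k)%:R ^- k.
have rs k (c : R) : r k * c ^+ k = (c / (s k)%:R) ^+ k by rewrite /r mulrC -exprVn -exprMn.
have [||||C C1 HC] := test r.
- by move=> k; rewrite invr_gt0 exprn_gt0.
- by rewrite /r expr0 invr1.
- move=> j k; rewrite /r -invfM lef_pV2 ?posrE ?mulr_gt0 ?exprn_gt0// exprD.
  by apply: ler_pM; rewrite ?exprn_ge0//; apply: lerXn2r; rewrite ?nnegrE// ler_nat s_mono// ?leq_addr ?leq_addl.
- move=> rho rho0; apply: (@seq_eventually_bounded _ _ 1).
  have [N rhoN] : exists N : nat, rho < N%:R by exists (Num.truncn rho).+1; exact: truncnS_gt.
  exists (kap N) => // k /= Nk; rewrite rs exprn_ile1 ?divr_ge0 ?(ltW rho0)//.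
  rewrite ler_pdivrMr// mul1r (le_trans (ltW rhoN))// ler_nat; exact: s_large.
have [N CN] : exists N : nat, 2 * C ^+ 2 < N%:R by exists (Num.truncn (2 * C ^+ 2)).+1; exact: truncnS_gt.
pose n := N.+1; pose k := kap n.
have k0 : (0 < k)%N by rewrite (leq_trans _ (kap_ge n)).
have C0 : 0 <= C by rewrite (le_trans ler01).
(* C C^k <= (C^2)^k, as k >= 1 and C >= 1; so k-th roots can be compared. *)
have H1 : n.+1%:R ^+ 2 / (s k)%:R <= C ^+ 2.
  rewrite -(@ler_pXn2r _ k)// ?nnegrE ?divr_ge0 ?exprn_ge0//.
  rewrite -rs mulrC (le_trans (ler_wpM2r _ (ltW (kapA n))))//.
    by rewrite invr_ge0 exprn_ge0.
  rewrite (le_trans (HC k))// -exprS -exprM ler_weXn2l// mul2n -addnn.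
  by rewrite -addn1 leq_add2l.
have : n.+1%:R ^+ 2 / n.+2%:R <= C ^+ 2.
  rewrite (le_trans _ H1)// ler_wpM2l ?exprn_ge0// lef_pV2 ?posrE//.
  by rewrite ler_nat; exact: s_kap.
apply/negP; rewrite -ltNge ltr_pdivlMr//.
have nN : N%:R <= n.+1%:R :> R by rewrite ler_nat /n ltnW.
have n2 : n.+2%:R <= 2 * n.+1%:R :> R by rewrite -natrM ler_nat; lia.
have := ler_wpM2l (exprn_ge0 2 C0) n2.
have n1 : 0 < n.+1%:R :> R by [].
rewrite [X in _ < X]expr2; move: (n.+1%:R : R) (n.+2%:R : R) nN n1 => u v.
by set D := C ^+ 2 in CN *; nra.
Qed.

End GrowthLemma.

(** Monotonicity in [C] turns bounds near each point into a property of all large [C], to which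
    compactness in its covering form applies. *)
Lemma compact_uniform_bound (R : realType) (X : normedModType R) (K : set X)
    (P : R -> X -> Prop) : compact K ->
  (forall C C' x, C <= C' -> P C x -> P C' x) ->
  (forall x, K x -> exists e C : R, 0 < e /\ forall x', K x' -> `|x' - x| < e -> P C x') ->
  exists C, forall x, K x -> P C x.
Proof.
move=> cK Pmono Ploc.
have /compact_near_coveringP H := cK.
have /filter_ex[C HC] : \forall C \near (+oo : set_system R), K `<=` (fun x => K x -> P C x).
  apply: H => x Kx.
  have [e [C [e0 eP]]] := Ploc x Kx.
  exists ([set x' | `|x' - x| < e], [set D | C <= D]) => /=.
    split; last by apply: nbhs_pinfty_ge; rewrite num_real.
    by apply/nbhs_ballP; exists e => //= z; rewrite -ball_normE /= distrC.
  by move=> [x' D] /= [x'e CD] Kx'; apply: (Pmono C) => //; exact: eP.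
by exists C => x Kx; exact: HC.
Qed.

Lemma fderiv_norm_le (R : realType) (X : normedModType R) (h : X -> R) k y (C : R) : 0 <= C ->
  (forall vs, size vs = k -> `|fderiv_seq h y vs| <= C * \prod_(v <- vs) `|v|) ->
  `|fderiv h k y| <= C.
Proof.
move=> C0 H; apply: mform_norm_le => // v.
rewrite -(@fderiv_seqE _ _ h y (args_seq v)) ?size_args_seq//.
  by rewrite (le_trans (H _ (size_args_seq v)))// big_map big_enum.
by move=> i; rewrite (nth_map i) ?size_enum_ord// nth_ord_enum.
Qed.

(** * Bounds for the composite on a compact convex set *)

Section Estimates.
Context {R : realType} {X : normedModType R} {F : convenientType R}.
Variables (O : set X) (V : set F) (phi : X -> F) (psi : F -> R).
Hypothesis Oopen : open O.
Hypothesis phi_smooth : forall l : {linear F -> R^o}, continuous l -> smooth_on O (l \o phi).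
Hypothesis Vopen : forall B : disk F, open (@disk_incl R F B @^-1` V).
Hypothesis psi_smooth : forall B : disk F,
  smooth_on (@disk_incl R F B @^-1` V) (psi \o @disk_incl R F B).
Hypothesis phiV : forall y, O y -> V (phi y).
Variables (M r : nat -> R).
Hypothesis M_gt0 : forall k, 0 < M k.
Hypothesis M0 : M 0%N = 1.
Hypothesis Mconvex : log_convex M.
Hypothesis r_gt0 : forall k, 0 < r k.
Hypothesis r0 : r 0%N = 1.
Hypothesis rM : forall j k, r (j + k)%N <= r j * r k.
Variables (K : set X) (b : {linear F -> R^o} -> R).
Hypothesis K_compact : compact K.
Hypothesis K_convex : convex_set K.
Hypothesis KO : K `<=` O.
Hypothesis b_bound : forall (l : {linear F -> R^o}) x vs, continuous l -> K x ->
  `|fderiv_seq (l \o phi) x vs| <=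
    (size vs)`!%:R * M (size vs) / r (size vs) * \prod_(v <- vs) `|v| * `|b l|.

Let hphi x : disk_space (polar_disk b) := polar_lift b (phi x).

Lemma polar_lift_on_compact x : K x -> disk_incl (hphi x) = phi x.
Proof.
move=> Kx; apply: (polar_liftP (c := 1) _ _).1 => // l lc.
have := b_bound [::] lc Kx; rewrite fderiv_seq0 big_nil/= M0 r0 fact0.
by rewrite divr1 !mulr1.
Qed.

(** The mean value theorem is applied to each functional on a segment, which lies in the convex set
    [K]; the bounds are multiples of [b l] with a common factor, hence a norm bound. *)
Lemma polar_lift_lipschitz : exists2 L, 0 < L & forall x x', K x -> K x' ->
  `|hphi x' - hphi x| <= L * `|x' - x|.
Proof.
pose L := 1`!%:R * M 1%N / r 1%N; have L0 : 0 < L by rewrite divr_gt0 ?mulr_gt0.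
exists L => // x x' Kx Kx'.
have [E N] : disk_incl (polar_lift b (phi x' - phi x)) = phi x' - phi x /\
    `|polar_lift b (phi x' - phi x)| <= L * `|x' - x|.
  apply: polar_liftP; first by rewrite mulr_ge0// ltW.
  move=> l lc; have hl := phi_smooth lc.
  have seg (t : R) : 0 <= t <= 1 -> K (x + t *: (x' - x)).
    case/andP=> t0 t1; have -> : x + t *: (x' - x) = t *: x' + (1 - t) *: x.
      by rewrite scalerBr scalerBl scale1r addrCA.
    by have /convex_setP := K_convex; apply.
  have [t t01 H] := line_mean_value (smooth_line hl) [::] (fun t t01 => KO (seg t t01)).
  have := b_bound [:: x' - x] lc (seg t t01); rewrite -H big_seq1.
  by rewrite (addrC x) subrK !fderiv_seq0 linearB.
rewrite (_ : hphi x' - hphi x = polar_lift b (phi x' - phi x))//.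
by apply: disk_incl_inj; rewrite disk_inclB E !polar_lift_on_compact.
Qed.

(** The convex hull of the whole lifted image of [K] could leave [V]. The piece of radius d / (2 L)
    is mapped into a ball of radius d / 2 inside [V], and its hull stays in that ball. *)
Lemma composite_local_compact x : K x -> exists (e : R) (K' : set (disk_space (polar_disk b))),
  [/\ 0 < e, compact K', convex_set K', K' `<=` @disk_incl R F (polar_disk b) @^-1` V &
      forall x', K x' -> `|x' - x| < e -> K' (hphi x')].
Proof.
move=> Kx; have [L L0 HL] := polar_lift_lipschitz.
have Vx : (@disk_incl R F (polar_disk b) @^-1` V) (hphi x).
  by rewrite /= polar_lift_on_compact//; apply/phiV/KO.
have /nbhs_ballP[d /= d0 dV] : nbhs (hphi x) (@disk_incl R F (polar_disk b) @^-1` V).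
  exact: open_nbhs_nbhs.
pose e := d / (2 * L).
have e0 : 0 < e by rewrite divr_gt0// mulr_gt0.
pose A := K `&` [set x' | `|x' - x| <= e].
have cA : compact A.
  apply: compact_closedI => //.
  rewrite (_ : [set x' | _] = (fun x' => `|x' - x|) @^-1` [set s : R | s <= e])//.
  apply: closed_comp; last exact: closed_le.
  by move=> x' _; apply: cvg_norm; apply: cvgB; [exact: cvg_id|exact: cvg_cst].
have cf : {within A, continuous hphi}.
  apply/subspace_continuousP => y [Ky _]; apply/cvgrPdist_lt => s s0.
  near=> z.
  have [Kz _] : A z by near: z; exact: withinT.
  rewrite distrC (le_lt_trans (HL _ _ Ky Kz))// -ltr_pdivlMl//.
  near: z; apply: cvg_within; apply/nbhs_ballP; exists (L^-1 * s).
    by rewrite /= mulr_gt0// invr_gt0.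
  by move=> z; rewrite -ball_normE /= distrC.
have [K' [K'c K'conv AK' K'ball]] := mazur_compact (continuous_compact cf cA).
exists e, K'; split=> //.
- move=> z /(K'ball (hphi x) (d / 2)) H; apply: dV; rewrite -ball_normE /= distrC.
  rewrite (le_lt_trans (H _))//; last by rewrite ltr_pdivrMr// ltr_pMr// ltr1n.
  move=> _ [x' [Kx' x'e] <-]; rewrite (le_trans (HL _ _ Kx Kx'))//.
  rewrite (le_trans (ler_wpM2l (ltW L0) x'e))//.
  have -> // : L * e = d / 2 by rewrite /e; field; rewrite gt_eqF.
- by move=> x' Kx' /ltW x'e; apply: AK'; exists x'.
Unshelve. all: by end_near. Qed.

Lemma composite_estimate (Q s : R) (K' : set (disk_space (polar_disk b))) x vs :
  0 <= Q -> 0 <= s ->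
  (forall z ws, K' z -> `|fderiv_seq (psi \o @disk_incl R F (polar_disk b)) z ws| <=
    Q * ((size ws)`!%:R * s ^+ size ws * M (size ws)) * \prod_(w <- ws) `|w|) ->
  K x -> K' (hphi x) ->
  `|fderiv_seq (psi \o phi) x vs| <=
    Q * ((size vs)`!%:R * (s * M 1%N + 2) ^+ size vs * (M (size vs) / r (size vs))) *
    \prod_(v <- vs) `|v|.
Proof.
move=> Q0 s0 HK' Kx K'x; have Ox := KO Kx.
have [Phi [Phi0 PhiE]] := vector_derivatives Oopen phi_smooth.
rewrite (composite_fderiv_seq Oopen phi_smooth Vopen psi_smooth phiV Phi0 PhiE)//.
rewrite (le_trans (composite_deriv_le (b := b) (p := fun k => k`!%:R * M k / r k)
  (q := fun k => Q * (k`!%:R * s ^+ k * M k)) Vopen psi_smooth phiV Phi0 Ox _ _ _ _))//.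
- by move=> k; rewrite divr_ge0 ?mulr_ge0// ltW.
- by move=> k; rewrite !mulr_ge0 ?exprn_ge0// ltW.
- by move=> c l _ lc; rewrite PhiE//; exact: b_bound.
- by move=> ws _; exact: HK'.
- rewrite ler_wpM2r ?prodr_ge0//.
  have := partitions_sum_bound M_gt0 Mconvex r_gt0 r0 rM vs s0.
  move=> /(ler_wpM2l Q0); apply: le_trans; rewrite mulr_sumr.
  by apply: ler_sum => P _; rewrite -[leLHS]mulrA.
Qed.

End Estimates.

Section DerivativeBounds.
Context {R : realType} {X : completeNormedModType R} (M : nat -> R) (rho : R).
Hypothesis M_gt0 : forall k, 0 < M k.
Hypothesis rho_gt0 : 0 < rho.

Let den_gt0 k : 0 < k`!%:R * rho ^+ k * M k.
Proof. by rewrite !mulr_gt0 ?exprn_gt0// ltr0n fact_gt0. Qed.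

Lemma dc_bounded_seq (K : set X) (h : X -> R) : dc_bounded M rho K h ->
  exists2 C, 0 <= C & forall x vs, K x ->
    `|fderiv_seq h x vs| <=
      C * ((size vs)`!%:R * rho ^+ size vs * M (size vs)) * \prod_(v <- vs) `|v|.
Proof.
move=> [C HC]; exists `|C| => // x vs Kx.
rewrite (le_trans (fderiv_seq_le _ _ _))// ler_wpM2r ?prodr_ge0// -ler_pdivrMr//.
by rewrite (le_trans _ (ler_norm C))//; apply: HC; exists x => //; exists (size vs).
Qed.

Lemma dc_bounded_of_seq (K : set X) (h : X -> R) (C : R) :
  (forall x vs, K x -> `|fderiv_seq h x vs| <=
      C * ((size vs)`!%:R * rho ^+ size vs * M (size vs)) * \prod_(v <- vs) `|v|) ->
  dc_bounded M rho K h.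
Proof.
move=> HC; exists `|C| => _ [x Kx] [k _ <-]; rewrite ler_pdivrMr//.
apply: fderiv_norm_le; first by rewrite mulr_ge0// ltW.
move=> vs vsk; rewrite (le_trans (HC x vs Kx))// vsk ler_wpM2r ?prodr_ge0//.
by rewrite ler_wpM2r ?ler_norm// ltW.
Qed.

End DerivativeBounds.

(** * The Beurling and Roumieu cases on a Banach space *)

Section CompositionOnDisk.
Context {R : realType} {X : completeNormedModType R} {F : convenientType R}.
Variables (O : set X) (V : set F) (phi : X -> F) (psi : F -> R).
Hypothesis Oopen : open O.
Hypothesis Vopen : forall B : disk F, open (@disk_incl R F B @^-1` V).
Hypothesis phiV : forall y, O y -> V (phi y).
Variable M : nat -> R.
Hypothesis M_weight : weight_sequence M.
Hypothesis M_convex : log_convex M.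

Let M_gt0 k : 0 < M k. Proof. by case: M_weight. Qed.

Lemma dc_banach_comp (t : dc_type) :
  (forall l : {linear F -> R^o}, continuous l -> dc_banach t M O (l \o phi)) ->
  (forall B : disk F, dc_banach t M (@disk_incl R F B @^-1` V) (psi \o @disk_incl R F B)) ->
  dc_banach t M O (psi \o phi).
Proof.
move=> phi_dc psi_dc; have [_ M0 M1] := M_weight.
have phi_smooth l lc := (phi_dc l lc).1.
have psi_smooth B := (psi_dc B).1.
have [Phi [Phi0 PhiE]] := vector_derivatives Oopen phi_smooth.
have smooth_comp := composite_smooth Oopen phi_smooth Vopen psi_smooth phiV Phi0 PhiE.
split=> // K Kc Kconv KO.
case: t phi_dc psi_dc => phi_dc psi_dc.
(* With s = 1 / M_1 the growth factor s M_1 + 2 of the partition sum is 3. *)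
- move=> tau tau0; pose rho := tau / 3.
  have rho0 : 0 < rho by rewrite divr_gt0.
  (* Then 1 / r k = rho^k, and the bound required of phi is the hypothesis with the radius rho. *)
  pose r k : R := rho ^- k.
  have r_gt0 k : 0 < r k by rewrite invr_gt0 exprn_gt0.
  have r0 : r 0%N = 1 by rewrite /r expr0 invr1.
  have rM j k : r (j + k)%N <= r j * r k by rewrite /r exprD invfM.
  have /choice[b bP] : forall l : {linear F -> R^o}, exists b : R, continuous l ->
      forall x vs, K x -> `|fderiv_seq (l \o phi) x vs| <=
        (size vs)`!%:R * M (size vs) / r (size vs) * \prod_(v <- vs) `|v| * `|b|.
    move=> l; have [lc|nlc] := pselect (continuous l); last by exists 0.
    have [C C0 HC] := dc_bounded_seq M_gt0 rho0 ((phi_dc l lc).2 K Kc Kconv KO rho rho0).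
    exists C => _ x vs Kx; rewrite (le_trans (HC x vs Kx))// (ger0_norm C0) /r invrK.
    by rewrite le_eqVlt; apply/orP; left; apply/eqP; ring.
  have bP' l x vs lc Kx := bP l lc x vs Kx.
  pose s := (M 1%N)^-1.
  have s0 : 0 < s by rewrite invr_gt0.
  have [C HC] : exists C, forall x, K x -> forall vs, `|fderiv_seq (psi \o phi) x vs| <=
      C * ((size vs)`!%:R * tau ^+ size vs * M (size vs)) * \prod_(v <- vs) `|v|.
    apply: (compact_uniform_bound (P := fun C x => forall vs, _ <= C * _ * _) Kc).
      move=> C C' x CC' H vs; rewrite (le_trans (H vs))// ler_wpM2r ?prodr_ge0//.
      by rewrite ler_wpM2r// !mulr_ge0 ?exprn_ge0// ltW.
    move=> x Kx.
    have [e [K' [e0 K'c K'conv K'V HK']]] := composite_local_compact phi_smooth Vopen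
      phiV M_gt0 M0 r_gt0 r0 Kc Kconv KO bP' Kx.
    have [Q Q0 HQ] := dc_bounded_seq M_gt0 s0 ((psi_dc _).2 K' K'c K'conv K'V s s0).
    exists e, Q; split=> // x' Kx' x'e vs.
    rewrite (le_trans (composite_estimate Oopen phi_smooth Vopen psi_smooth phiV M_gt0 M_convex
      r_gt0 r0 rM KO bP' vs Q0 (ltW s0) (fun z ws => HQ z ws) Kx' (HK' x' Kx' x'e)))//.
    rewrite ler_wpM2r ?prodr_ge0// ler_wpM2l//.
    have -> : s * M 1%N + 2 = 3 by rewrite /s mulVf ?gt_eqF//; ring.
    have -> : tau ^+ size vs = 3 ^+ size vs * rho ^+ size vs.
      by rewrite -exprMn /rho mulrC divfK.
    by rewrite /r invrK le_eqVlt; apply/orP; left; apply/eqP; ring.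
  by apply: (dc_bounded_of_seq M_gt0 tau0 (C := C)) => x vs Kx; exact: HC.
(* The suprema below need a nonempty [K]; on the empty set any radius works. *)
- have [[x0 Kx0]|K0] := pselect (K !=set0); last first.
    by exists 1 => //; exists 0 => u [x Kx]; exfalso; apply: K0; exists x.
  set h := psi \o phi in smooth_comp *.
  have /choice[S0 S0P] : forall k, exists C, forall x, K x -> `|fderiv h k x| <= C.
    move=> k; apply: (compact_uniform_bound (P := fun C x => `|fderiv h k x| <= C) Kc).
      by move=> C C' x CC' /le_trans; exact.
    move=> x /KO Ox; have [d [C [d0 dC]]] := smooth_bounded smooth_comp k Ox.
    exists d, `|C|; split=> // x' _ x'd; apply: fderiv_norm_le => // vs vsk.
    by rewrite (le_trans (dC _ _ x'd vsk))// ler_wpM2r ?prodr_ge0// ler_norm.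
  pose S k := [set `|fderiv h k x| | x in K].
  have S_sup k : has_sup (S k).
    split; first by exists `|fderiv h k x0|, x0.
    by exists (S0 k) => _ [x Kx <-]; exact: S0P.
  have fM k : 0 < k`!%:R * M k by rewrite mulr_gt0// ltr0n fact_gt0.
  pose A k := sup (S k) / (k`!%:R * M k).
  have [|rho rho0 [C HC]] := @subexponential_test R A; last first.
    exists rho => //; exists C => _ [x Kx] [k _ <-].
    rewrite ler_pdivrMr ?mulr_gt0 ?exprn_gt0 ?ltr0n ?fact_gt0//.
    rewrite (@le_trans _ _ (sup (S k)))//.
      by apply: (sup_upper_bound (S_sup k)); exists x.
    have := HC k; rewrite /A ler_pdivrMr// => /le_trans; apply.
    by rewrite le_eqVlt; apply/orP; left; apply/eqP; ring.
  move=> r r_gt0 r0 rM r_small.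
  have /choice[b bP] : forall l : {linear F -> R^o}, exists b : R, continuous l ->
      forall x vs, K x -> `|fderiv_seq (l \o phi) x vs| <=
        (size vs)`!%:R * M (size vs) / r (size vs) * \prod_(v <- vs) `|v| * `|b|.
    move=> l; have [lc|nlc] := pselect (continuous l); last by exists 0.
    have [rho rho0 rho_b] := (phi_dc l lc).2 K Kc Kconv KO.
    have [C C0 HC] := dc_bounded_seq M_gt0 rho0 rho_b.
    (* rho depends on [l], but rho^k <= C1 / r k moves this dependence into the constant [b l]. *)
    have [C1 HC1] := r_small rho rho0.
    have C10 : 0 <= C1 by have := HC1 0%N; rewrite r0 mul1r expr0; exact: le_trans.
    exists (C * C1) => _ x vs Kx; rewrite (le_trans (HC x vs Kx))//.
    rewrite ger0_norm ?mulr_ge0// [leRHS]mulrAC ler_wpM2r ?prodr_ge0//.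
    set k := size vs.
    rewrite (_ : _ * (C * C1) = (C * (k`!%:R * M k)) * (C1 / r k)); last by ring.
    rewrite (_ : C * (_ * _) = (C * (k`!%:R * M k)) * rho ^+ k); last by ring.
    rewrite ler_wpM2l ?mulr_ge0 ?(ltW (M_gt0 k))//.
    by rewrite ler_pdivlMr// mulrC.
  have bP' l x vs lc Kx := bP l lc x vs Kx.
  (* One constant, at least 1, is both factor and base: this is the form asked by
     [subexponential_test], and it is monotone in [C]. *)
  have [C HC] : exists C, forall x, K x -> 1 <= C /\ forall vs, `|fderiv_seq h x vs| <=
      C * ((size vs)`!%:R * C ^+ size vs * (M (size vs) / r (size vs))) * \prod_(v <- vs) `|v|.
    have Mr0 k : 0 <= M k / r k by rewrite divr_ge0// ltW.
    apply: (compact_uniform_bound (P := fun C x => 1 <= C /\ forall vs, _ <= C * (_ * C ^+ _ * _) * _) Kc).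
      move=> C C' x CC' [C1 H]; have C0 : 0 <= C by rewrite (le_trans _ C1).
      split; first exact: le_trans CC'.
      move=> vs; rewrite (le_trans (H vs))// ler_wpM2r ?prodr_ge0//.
      apply: ler_pM => //; first by rewrite mulr_ge0// mulr_ge0 ?exprn_ge0.
      rewrite ler_wpM2r// ler_wpM2l//; apply: lerXn2r; rewrite ?nnegrE//.
      exact: le_trans CC'.
    move=> x Kx.
    have [e [K' [e0 K'c K'conv K'V HK']]] := composite_local_compact phi_smooth Vopen
      phiV M_gt0 M0 r_gt0 r0 Kc Kconv KO bP' Kx.
    have [s s0 s_b] := (psi_dc _).2 K' K'c K'conv K'V.
    have [Q Q0 HQ] := dc_bounded_seq M_gt0 s0 s_b.
    have sM0 : 0 <= s * M 1%N by rewrite mulr_ge0// ltW.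
    exists e, (Q + (s * M 1%N + 2)); split=> // x' Kx' x'e; split; first lra.
    move=> vs.
    rewrite (le_trans (composite_estimate Oopen phi_smooth Vopen psi_smooth phiV M_gt0 M_convex
      r_gt0 r0 rM KO bP' vs Q0 (ltW s0) (fun z ws => HQ z ws) Kx' (HK' x' Kx' x'e)))//.
    rewrite ler_wpM2r ?prodr_ge0//.
    have s20 : 0 <= s * M 1%N + 2 by lra.
    apply: ler_pM => //; first by rewrite mulr_ge0// mulr_ge0 ?exprn_ge0.
      by rewrite lerDl.
    rewrite ler_wpM2r// ler_wpM2l//; apply: lerXn2r; rewrite ?nnegrE ?addr_ge0//.
    by rewrite lerDr.
  have [C1 _] := HC x0 Kx0; exists C => // k.
  have C0 : 0 <= C by rewrite (le_trans _ C1).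
  rewrite /A mulrAC ler_pdivrMr// -ler_pdivlMr//.
  apply: ge_sup; first by case: (S_sup k).
  move=> _ [x Kx <-]; apply: fderiv_norm_le.
    by rewrite divr_ge0 ?mulr_ge0 ?exprn_ge0// ltW.
  move=> vs vsk; rewrite (le_trans ((HC x Kx).2 vs))// vsk ler_wpM2r ?prodr_ge0//.
  by rewrite le_eqVlt; apply/orP; left; apply/eqP; ring.
Qed.

End CompositionOnDisk.

Theorem theorem4p11 (R : realType) (M : nat -> R)
    (M_weight : weight_sequence M) (M_logconvex : log_convex M)
    (t : dc_type) (E F G : convenientType R)
    (U : set E) (V : set F) (U_open : cinfty_open U) (V_open : cinfty_open V)
    (f : E -> F) (g : F -> G) (fUV : f @` U `<=` V)
    (f_dc : dc_convenient t M U f) (g_dc : dc_convenient t M V g) :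
  dc_convenient t M U (g \o f).
Proof.
have fV x : U x -> V (f x) by move=> Ux; apply: fUV; exists x.
split=> [c cs Uc|l B lc].
  by apply: (g_dc.1 (f \o c)) => [|s]; [exact: f_dc.1|exact/fV/Uc].
(* [phi] is f on the space spanned by [B], and [psi] is the scalar function l o g, so the class of g
   enters through all disks of [F]. *)
apply: (@dc_banach_comp R _ F (@disk_incl R E B @^-1` U) V (f \o @disk_incl R E B) (l \o g)) => //.
- exact: cinfty_open_disk.
- by move=> B'; exact: cinfty_open_disk.
- by move=> y; exact: fV.
- by move=> l' l'c; exact: f_dc.2.
- by move=> B'; exact: g_dc.2.
Qed.
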